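(* Let $K$ be a commutative ring and let $\pi\colon B\to A$ be a $K$-linear homological epimorphism between $K$-algebras which are projective as $K$-modules. Then the functor $$A\otimes_B(-)\otimes_B A\colon \mathrm{Mod}(B^{\mathrm{ev}})\longrightarrow\mathrm{Mod}(A^{\mathrm{ev}})$$ maps $B$ to $A$ (up to canonical isomorphism) and induces a homomorphism $$\pi_\ast\colon\mathrm{HH}^\ast(B)=\mathrm{Ext}^\ast_{B^{\mathrm{ev}}}(B,B)\longrightarrow\mathrm{Ext}^\ast_{A^{\mathrm{ev}}}(A,A)=\mathrm{HH}^\ast(A)$$ of strict Gerstenhaber algebras; that is, $\pi_\ast$ is a graded $K$-algebra homomorphism, $\pi_{m+n-1}(\{\alpha,\beta\}_B)=\{\pi_m(\alpha),\pi_n(\beta)\}_A$ for all $\alpha\in\mathrm{HH}^m(B)$, $\beta\in\mathrm{HH}^n(B)$, and $\pi_{4n-1}(sq_B(\alpha))=sq_A(\pi_{2n}(\alpha))$ for all $\alpha\in\mathrm{HH}^{2n}(B)$ (all $m,n\geqslant0$).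
   Context: Conventions. Algebras are unital and associative; $\otimes=\otimes_K$; $\Lambda^{\mathrm{ev}}=\Lambda\otimes\Lambda^{\mathrm{op}}$; $\mathrm{Mod}$ denotes left modules. A ring homomorphism $\pi\colon B\to A$ is a homological epimorphism if it is an epimorphism in the category of rings (equivalently, the multiplication map $A\otimes_BA\to A$ is an isomorphism) and $\mathrm{Tor}^B_i(A,A)=0$ for all $i>0$. The map $\pi_\ast$ is the one induced by the total left derived functor of $A\otimes_B(-)\otimes_BA\cong A^{\mathrm{ev}}\otimes_{B^{\mathrm{ev}}}(-)$, namely $$A\otimes_B^{\mathbf L}(-)\otimes_B^{\mathbf L}A\colon \mathrm{Hom}_{\mathbf D(B^{\mathrm{ev}})}(B,B[\ast])\to\mathrm{Hom}_{\mathbf D(A^{\mathrm{ev}})}(A,A[\ast]),$$ where $A\otimes_B^{\mathbf L}B\otimes_B^{\mathbf L}A\cong A$ in the derived category because $\pi$ is homological. Hochschild cohomology. For a $K$-projective $K$-algebra $\Lambda$, $\mathrm{HH}^\ast(\Lambda)$ is the cohomology of the Hochschild cocomplex $C^n(\Lambda,\Lambda)=\mathrm{Hom}_K(\Lambda^{\otimes n},\Lambda)$ with its usual differential, identified via the bar resolution with the graded algebra $\mathrm{Ext}^\ast_{\Lambda^{\mathrm{ev}}}(\Lambda,\Lambda)$. Its strict Gerstenhaber structure consists of: the cup product $(f\cup g)(a_1\otimes\cdots\otimes a_{m+n})=f(a_1\otimes\cdots\otimes a_m)g(a_{m+1}\otimes\cdots\otimes a_{m+n})$; the bracket $\{-,-\}_\Lambda\colon\mathrm{HH}^m\times\mathrm{HH}^n\to\mathrm{HH}^{m+n-1}$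 induced by $\{f,g\}=f\bullet g-(-1)^{(m-1)(n-1)}g\bullet f$, where for $f\in C^m$, $g\in C^n$, $f\bullet g=\sum_{i=1}^m(-1)^{(i-1)(n-1)}f\bullet_i g$ and $(f\bullet_i g)(a_1\otimes\cdots\otimes a_{m+n-1})=f(a_1\otimes\cdots\otimes a_{i-1}\otimes g(a_i\otimes\cdots\otimes a_{i+n-1})\otimes a_{i+n}\otimes\cdots\otimes a_{m+n-1})$; and the squaring map $sq_\Lambda\colon\mathrm{HH}^{2n}(\Lambda)\to\mathrm{HH}^{4n-1}(\Lambda)$ induced by $f\mapsto f\bullet f$. *)

(* Defs.v *)
From HB Require Import structures.
From mathcomp Require Import all_boot all_order all_algebra.
From mathcomp Require Import ring_quotient.
From mathcomp Require Import boolp functions.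

Set Implicit Arguments.
Unset Strict Implicit.
Unset Printing Implicit Defensive.

Import GRing.Theory.
Local Open Scope ring_scope.
Local Open Scope quotient_scope.

(* Tensor products are obtained from one construction: the R-module generated *)
(* by symbols [x] (x : X) which is universal among the maps f : X -> G into   *)
(* R-modules satisfying [adm]. Elements are formal sums; two formal sums are  *)
(* identified iff every admissible map takes the same value on them. When     *)
(* [adm] is given by linear equations, this is the quotient of the free       *)
(* module on X by these equations.                                            *)
Section UniversalModule.
Variables (R : pzRingType) (X : Type).
Variable adm : forall G : lmodType R, (X -> G) -> Prop.

Definition fsum : Type := seq (R * X).
HB.instance Definition _ := gen_eqMixin fsum.
HB.instance Definition _ := gen_choiceMixin fsum.

Definition fsum_eval (G : lmodType R) (f : X -> G) (s : fsum) : G :=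
  \sum_(p <- s) p.1 *: f p.2.

Definition fsum_eq (s t : fsum) : bool :=
  `[< forall (G : lmodType R) (f : X -> G), adm f ->
        fsum_eval f s = fsum_eval f t >].

Lemma fsum_eq_refl : reflexive fsum_eq.
Proof. by move=> s; apply/asboolP. Qed.
Lemma fsum_eq_sym : symmetric fsum_eq.
Proof.
move=> s t; apply/asboolP/asboolP => H G f hf; by rewrite H.
Qed.
Lemma fsum_eq_trans : transitive fsum_eq.
Proof.
move=> t s u /asboolP H1 /asboolP H2; apply/asboolP => G f hf.
by rewrite H1 ?H2.
Qed.

Canonical fsum_equiv := EquivRel fsum_eq fsum_eq_refl fsum_eq_sym fsum_eq_trans.

Definition umod : Type := {eq_quot fsum_equiv}.
HB.instance Definition _ := Choice.on umod.

Definition umod_pi (s : fsum) : umod := \pi_{eq_quot fsum_equiv} s.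
Definition umod_repr (x : umod) : fsum := repr (x : {eq_quot fsum_equiv}).

Definition gen (x : X) : umod := umod_pi [:: (1, x)].

Definition umod_eval (G : lmodType R) (f : X -> G) (x : umod) : G :=
  fsum_eval f (umod_repr x).

Lemma umod_evalE (G : lmodType R) (f : X -> G) s :
  adm f -> umod_eval f (umod_pi s) = fsum_eval f s.
Proof.
move=> hf; rewrite /umod_eval.
have /asboolP H : fsum_eq (umod_repr (umod_pi s)) s.
  by apply/eqmodP; rewrite [LHS]reprK.
exact: H.
Qed.

Lemma umodP (x y : umod) :
  (forall (G : lmodType R) (f : X -> G), adm f ->
     umod_eval f x = umod_eval f y) -> x = y.
Proof.
move=> H; rewrite -[x]reprK -[y]reprK.
by apply/eqmodP/asboolP => G f hf; exact: H.
Qed.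

Definition umod_zero : umod := umod_pi [::].
Definition umod_add (x y : umod) : umod :=
  umod_pi (umod_repr x ++ umod_repr y).
Definition umod_scale (r : R) (x : umod) : umod :=
  umod_pi [seq (r * p.1, p.2) | p <- umod_repr x].

Section Eval.
Variables (G : lmodType R) (f : X -> G).
Hypothesis hf : adm f.

Lemma umod_eval0 : umod_eval f umod_zero = 0.
Proof. by rewrite umod_evalE // /fsum_eval big_nil. Qed.
Lemma umod_evalD x y :
  umod_eval f (umod_add x y) = umod_eval f x + umod_eval f y.
Proof. by rewrite umod_evalE // /fsum_eval big_cat. Qed.
Lemma umod_evalZ r x : umod_eval f (umod_scale r x) = r *: umod_eval f x.
Proof.
rewrite umod_evalE // /umod_eval /fsum_eval big_map scaler_sumr.
by apply: eq_bigr => p _; rewrite scalerA.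
Qed.
Lemma umod_eval_gen x : umod_eval f (gen x) = f x.
Proof. by rewrite umod_evalE // /fsum_eval big_seq1 scale1r. Qed.
End Eval.

Definition umod_evalS := (umod_eval0, umod_evalD, umod_evalZ).

Lemma umod_addA : associative umod_add.
Proof. by move=> x y z; apply: umodP => G f hf; rewrite !umod_evalS // addrA. Qed.
Lemma umod_addC : commutative umod_add.
Proof. by move=> x y; apply: umodP => G f hf; rewrite !umod_evalS // addrC. Qed.
Lemma umod_add0 : left_id umod_zero umod_add.
Proof. by move=> x; apply: umodP => G f hf; rewrite !umod_evalS // add0r. Qed.
Lemma umod_addN : left_inverse umod_zero (umod_scale (-1)) umod_add.
Proof.
move=> x; apply: umodP => G f hf.
by rewrite !umod_evalS // scaleN1r addNr.
Qed.
HB.instance Definition _ :=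
  GRing.isZmodule.Build umod umod_addA umod_addC umod_add0 umod_addN.

Lemma umod_scaleA r s (x : umod) :
  umod_scale r (umod_scale s x) = umod_scale (r * s) x.
Proof. by apply: umodP => G f hf; rewrite !umod_evalS // scalerA. Qed.
Lemma umod_scale1 : left_id 1 umod_scale.
Proof. by move=> x; apply: umodP => G f hf; rewrite !umod_evalS // scale1r. Qed.
Lemma umod_scaleDr : right_distributive umod_scale +%R.
Proof. by move=> r x y; apply: umodP => G f hf; rewrite !umod_evalS // scalerDr. Qed.
Lemma umod_scaleDl (x : umod) : {morph umod_scale^~ x : r s / r + s}.
Proof. by move=> r s; apply: umodP => G f hf; rewrite !umod_evalS // scalerDl. Qed.
HB.instance Definition _ := GRing.Zmodule_isLmodule.Build R umod
  umod_scaleA umod_scale1 umod_scaleDr umod_scaleDl.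

Definition umod_lift (G : lmodType R) (f : X -> G) (hf : adm f) (x : umod) : G :=
  umod_eval f x.

Lemma umod_lift_linear (G : lmodType R) (f : X -> G) (hf : adm f) :
  linear (umod_lift hf).
Proof. by move=> r x y; rewrite /umod_lift umod_evalD // umod_evalZ. Qed.
HB.instance Definition _ (G : lmodType R) (f : X -> G) (hf : adm f) :=
  GRing.isLinear.Build R umod G _ (umod_lift hf) (umod_lift_linear hf).

Lemma umod_lift_gen (G : lmodType R) (f : X -> G) (hf : adm f) x :
  umod_lift hf (gen x) = f x.
Proof. exact: umod_eval_gen. Qed.

Lemma umod_sum (x : umod) : exists s : fsum, x = \sum_(p <- s) p.1 *: gen p.2.
Proof.
exists (umod_repr x); apply: umodP => G f hf.
rewrite -[RHS]/(umod_lift hf _) linear_sum.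
by apply: eq_bigr => p _; rewrite linearZ /= umod_lift_gen.
Qed.

Lemma umod_ext (G : lmodType R) (f g : {linear umod -> G}) :
  (forall x, f (gen x) = g (gen x)) -> f =1 g.
Proof.
move=> H x; have [s ->] := umod_sum x; rewrite !linear_sum.
by apply: eq_bigr => p _; rewrite !linearZ /= H.
Qed.

End UniversalModule.

(* restriction of scalars *)
Definition scalres (R S : pzRingType) (phi : {rmorphism R -> S})
  (N : lmodType S) : Type := N.

Section Restrict.
Variables (R S : pzRingType) (phi : {rmorphism R -> S}) (N : lmodType S).
Local Notation scalres := (scalres phi N).

HB.instance Definition _ := GRing.Zmodule.on scalres.

Definition scalres_scale (r : R) (x : scalres) : scalres :=
  (phi r *: (x : N))%R.

Lemma scalres_scaleA r s (x : scalres) :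
  scalres_scale r (scalres_scale s x) = scalres_scale (r * s) x.
Proof. by rewrite /scalres_scale scalerA rmorphM. Qed.
Lemma scalres_scale1 : left_id 1 scalres_scale.
Proof. by move=> x; rewrite /scalres_scale rmorph1 scale1r. Qed.
Lemma scalres_scaleDr : right_distributive scalres_scale +%R.
Proof. by move=> r x y; rewrite /scalres_scale scalerDr. Qed.
Lemma scalres_scaleDl (x : scalres) : {morph scalres_scale^~ x : r s / r + s}.
Proof. by move=> r s; rewrite /scalres_scale rmorphD scalerDl. Qed.
HB.instance Definition _ := GRing.Zmodule_isLmodule.Build R scalres
  scalres_scaleA scalres_scale1 scalres_scaleDr scalres_scaleDl.
End Restrict.

Section Extend.
Variables (R S : pzRingType) (phi : {rmorphism R -> S}).

(* S (x)_R M, generated by the elements 1 (x) m *)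
Definition phi_linear (M : lmodType R) (G : lmodType S) (f : M -> G) : Prop :=
  forall (r : R) (x y : M), f (r *: x + y) = phi r *: f x + f y.

Definition scalext (M : lmodType R) : Type := umod (@phi_linear M).
HB.instance Definition _ (M : lmodType R) := GRing.Lmodule.on (scalext M).

Definition etens (M : lmodType R) (x : M) : scalext M := gen (@phi_linear M) x.

Lemma etens_phi_linear (M : lmodType R) : phi_linear (@etens M).
Proof.
move=> r x y; apply: umodP => G f hf.
by rewrite umod_evalD // umod_evalZ // !umod_eval_gen // hf.
Qed.

Definition scalext_lift (M : lmodType R) (G : lmodType S) (f : M -> G)
  (hf : phi_linear f) : {linear scalext M -> G} := umod_lift hf.

Lemma scalext_map_subproof (M N : lmodType R) (f : {linear M -> N}) :
  phi_linear (fun x => etens (f x)).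
Proof. by move=> r x y; rewrite linearP etens_phi_linear. Qed.

Definition scalext_map (M N : lmodType R) (f : {linear M -> N}) :
  {linear scalext M -> scalext N} := scalext_lift (scalext_map_subproof f).

End Extend.

(* A K-algebra is a ring with a central ring map from K. This is used instead *)
(* of [algType K] because the latter excludes the zero algebra.               *)
HB.mixin Record isKAlgebra (K : pzRingType) A of GRing.PzRing A := {
  kunit : {rmorphism K -> A};
  kunit_central : forall (k : K) (x : A), kunit k * x = x * kunit k
}.

#[short(type="kalgType")]
HB.structure Definition KAlgebra (K : pzRingType) :=
  {A of GRing.PzRing A & isKAlgebra K A}.

Definition kmod (K : pzRingType) (A : kalgType K) : Type :=
  scalres (@kunit K A) A^o.
HB.instance Definition _ (K : pzRingType) (A : kalgType K) :=
  GRing.Lmodule.on (kmod A).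

(* A^ev = A (x)_K A^op *)
Section Enveloping.
Variables (K : comPzRingType) (A : kalgType K).

Definition bilin (G : lmodType K) (f : A * A -> G) : Prop :=
  (forall k a a' b, f (kunit k * a + a', b) = k *: f (a, b) + f (a', b)) /\
  (forall k a b b', f (a, kunit k * b + b') = k *: f (a, b) + f (a, b')).

Definition ev : Type := umod bilin.
HB.instance Definition _ := GRing.Lmodule.on ev.

Definition tens (a b : A) : ev := gen bilin (a, b).

Lemma tens_linl k a a' b :
  tens (kunit k * a + a') b = k *: tens a b + tens a' b.
Proof.
apply: umodP => G f hf; rewrite umod_evalD // umod_evalZ // !umod_eval_gen //.
by case: hf => ->.
Qed.
Lemma tens_linr k a b b' :
  tens a (kunit k * b + b') = k *: tens a b + tens a b'.
Proof.
apply: umodP => G f hf; rewrite umod_evalD // umod_evalZ // !umod_eval_gen //.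
by case: hf => _ ->.
Qed.

Lemma ev_ind (P : ev -> Prop) :
  (forall k a b x, P x -> P (k *: tens a b + x)) -> P 0 -> forall x, P x.
Proof.
move=> H H0 x; have [s ->] := umod_sum x.
elim: s => [|[k [a b]] s IH]; first by rewrite big_nil.
by rewrite big_cons; exact: H.
Qed.

(* (a (x) b) (c (x) d) = (a c) (x) (d b): the second factor is A^op. *)
Definition ev_mul (x y : ev) : ev :=
  umod_eval (fun p : A * A =>
    umod_eval (fun q : A * A => tens (p.1 * q.1) (q.2 * p.2)) y) x.
Definition ev_one : ev := tens 1 1.

Let mulq (p : A * A) (q : A * A) := tens (p.1 * q.1) (q.2 * p.2).
Let mulq_bilin p : bilin (mulq p).
Proof.
split=> k a a' b; rewrite /mulq /= ?mulrDr ?mulrDl.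
  by rewrite mulrA -kunit_central -mulrA tens_linl.
by rewrite -mulrA tens_linr.
Qed.
Let mulp (y : ev) (p : A * A) : ev := umod_lift (mulq_bilin p) y.
Let mulp_bilin y : bilin (mulp y).
Proof.
split=> k a a' b; rewrite /mulp; elim/ev_ind: y => [l c d x IH|];
  rewrite ?linear0 ?scaler0 ?addr0 //.
  rewrite !umod_lift_linear IH !umod_lift_gen /mulq /= !mulrDl -!mulrA tens_linl.
  by rewrite !scalerDr addrACA !scalerA [k * l]mulrC.
rewrite !umod_lift_linear IH !umod_lift_gen /mulq /= mulrDr mulrA -kunit_central -mulrA.
by rewrite tens_linr !scalerDr addrACA !scalerA [k * l]mulrC.
Qed.

Let ev_mulE x y : ev_mul x y = umod_lift (mulp_bilin y) x.
Proof. by []. Qed.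

Lemma ev_mul_tens a b c d : ev_mul (tens a b) (tens c d) = tens (a * c) (d * b).
Proof. by rewrite ev_mulE umod_lift_gen /mulp umod_lift_gen. Qed.
Lemma ev_mul_linl y : linear (ev_mul^~ y).
Proof. by move=> k u v; rewrite !ev_mulE umod_lift_linear. Qed.
Lemma ev_mul_linr x : linear (ev_mul x).
Proof.
move=> k u v; rewrite !ev_mulE; elim/ev_ind: x => [l c d x IH|];
  rewrite ?linear0 ?scaler0 ?addr0 //.
rewrite !umod_lift_linear IH !umod_lift_gen /mulp umod_lift_linear !scalerDr addrACA !scalerA.
by rewrite [k * l]mulrC.
Qed.
Let ev_mul0l y : ev_mul 0 y = 0.
Proof. by rewrite ev_mulE linear0. Qed.
Let ev_mul0r x : ev_mul x 0 = 0.
Proof.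
by have := ev_mul_linr x (- 1) 0 0; rewrite scaler0 addr0 scaleN1r addNr.
Qed.

Lemma ev_mulA : associative ev_mul.
Proof.
move=> x y z; elim/ev_ind: x => [k a b x IHx|]; last by rewrite !ev_mul0l.
rewrite !ev_mul_linl IHx; congr (_ *: _ + _) => {k x IHx}.
elim/ev_ind: y => [k c d y IHy|]; last by rewrite !(ev_mul0l, ev_mul0r).
rewrite ev_mul_linl !ev_mul_linr ev_mul_linl IHy; congr (_ *: _ + _) => {k y IHy}.
elim/ev_ind: z => [k u v z IHz|]; last by rewrite !ev_mul0r.
by rewrite !ev_mul_linr IHz !ev_mul_tens !mulrA.
Qed.
Lemma ev_mul1r : left_id ev_one ev_mul.
Proof.
elim/ev_ind => [k a b x IHx|]; last by rewrite ev_mul0r.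
by rewrite ev_mul_linr IHx ev_mul_tens mul1r mulr1.
Qed.
Lemma ev_mulr1 : right_id ev_one ev_mul.
Proof.
elim/ev_ind => [k a b x IHx|]; last by rewrite ev_mul0l.
by rewrite ev_mul_linl IHx ev_mul_tens mul1r mulr1.
Qed.
Lemma ev_mulDl : left_distributive ev_mul +%R.
Proof. by move=> x y z; have := ev_mul_linl z 1 x y; rewrite !scale1r. Qed.
Lemma ev_mulDr : right_distributive ev_mul +%R.
Proof. by move=> x y z; have := ev_mul_linr x 1 y z; rewrite !scale1r. Qed.

HB.instance Definition _ := GRing.Zmodule_isPzRing.Build ev
  ev_mulA ev_mul1r ev_mulr1 ev_mulDl ev_mulDr.

Lemma ev_scaleAl k (x y : ev) : k *: (x * y) = (k *: x) * y.
Proof.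
by move: (ev_mul_linl y k x 0) => /=; rewrite ev_mul0l !addr0 => /esym.
Qed.
Lemma ev_scaleAr k (x y : ev) : k *: (x * y) = x * (k *: y).
Proof.
by move: (ev_mul_linr x k y 0) => /=; rewrite ev_mul0r !addr0 => /esym.
Qed.

Definition ev_unit (k : K) : ev := k *: ev_one.
Lemma ev_unit_zmod : zmod_morphism ev_unit.
Proof. by move=> k l; rewrite /ev_unit scalerBl. Qed.
Lemma ev_unit_monoid : monoid_morphism ev_unit.
Proof.
split; first by rewrite /ev_unit scale1r.
by move=> k l; rewrite /ev_unit -ev_scaleAl [ev_one * _]ev_mul1r scalerA.
Qed.
HB.instance Definition _ := GRing.isZmodMorphism.Build K ev ev_unit ev_unit_zmod.
HB.instance Definition _ := GRing.isMonoidMorphism.Build K ev ev_unit ev_unit_monoid.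

Lemma ev_unit_central (k : K) (x : ev) : ev_unit k * x = x * ev_unit k.
Proof. by rewrite /ev_unit -ev_scaleAl -ev_scaleAr [_ * x]ev_mul1r [x * _]ev_mulr1. Qed.
HB.instance Definition _ := isKAlgebra.Build K ev ev_unit_central.

End Enveloping.

(* A as a left A^ev-module: (a (x) b) x = a x b. *)
Definition bimod (K : comPzRingType) (A : kalgType K) : Type := A.

Section Bimod.
Variables (K : comPzRingType) (A : kalgType K).
Local Notation bimod := (bimod A).
HB.instance Definition _ := GRing.Zmodule.on bimod.

Definition bimod_scale (e : ev A) (x : bimod) : bimod :=
  umod_eval (fun p : A * A => (p.1 * (x : A) * p.2 : kmod A)) e.

Let act (x : bimod) (p : A * A) : kmod A := p.1 * (x : A) * p.2.
Let act_bilin x : bilin (act x).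
Proof.
split=> k a a' b.
  suff E : (kunit k * a + a') * (x : A) * b
         = kunit k * (a * (x : A) * b) + a' * (x : A) * b by exact: E.
  by rewrite !mulrDl !mulrA.
suff E : a * (x : A) * (kunit k * a' + b)
       = kunit k * (a * (x : A) * a') + a * (x : A) * b by exact: E.
by rewrite mulrDr [_ * (_ * _)]mulrA -kunit_central !mulrA.
Qed.
Let bimod_scaleE e x : bimod_scale e x = umod_lift (act_bilin x) e.
Proof. by []. Qed.

Lemma bimod_scale_tens a b (x : bimod) :
  bimod_scale (tens a b) x = a * (x : A) * b.
Proof. by rewrite bimod_scaleE umod_lift_gen. Qed.
Lemma bimod_scale_linl (k : K) (e e' : ev A) (x : bimod) :
  bimod_scale (k *: e + e') x = kunit k * (bimod_scale e x : A) + bimod_scale e' x.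
Proof. by rewrite !bimod_scaleE umod_lift_linear. Qed.
Let bimod_scale0l x : bimod_scale 0 x = 0.
Proof. by rewrite bimod_scaleE linear0. Qed.

Lemma bimod_scaleDr : right_distributive bimod_scale +%R.
Proof.
move=> e x y; elim/ev_ind: e => [k a b e IH|]; last by rewrite !bimod_scale0l addr0.
rewrite !bimod_scale_linl IH !bimod_scale_tens addrACA; congr (_ + _).
by rewrite -mulrDr -mulrDl -mulrDr.
Qed.
Let bimod_scale0r e : bimod_scale e 0 = 0.
Proof.
by apply: (addrI (bimod_scale e 0)); rewrite -bimod_scaleDr !addr0.
Qed.
Lemma bimod_scaleDl (x : bimod) : {morph bimod_scale^~ x : e f / e + f}.
Proof. by move=> e f; rewrite !bimod_scaleE linearD. Qed.
Lemma bimod_scale1 : left_id 1 bimod_scale.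
Proof. by move=> x; rewrite bimod_scale_tens mul1r mulr1. Qed.
Let bimod_scale_kunit e k (x : bimod) :
  bimod_scale e (kunit k * (x : A)) = kunit k * (bimod_scale e x : A).
Proof.
elim/ev_ind: e => [l a b e IH|]; last by rewrite !bimod_scale0l mulr0.
rewrite !bimod_scale_linl IH !bimod_scale_tens mulrDr; congr (_ + _).
rewrite !mulrA; congr (_ * _ * _).
by rewrite -!mulrA -(kunit_central k a) !mulrA -(kunit_central k (kunit l)).
Qed.
Lemma bimod_scaleA e f (x : bimod) :
  bimod_scale e (bimod_scale f x) = bimod_scale (e * f) x.
Proof.
elim/ev_ind: e => [k a b e IH|]; last by rewrite mul0r !bimod_scale0l.
rewrite mulrDl -ev_scaleAl !bimod_scale_linl IH; congr (_ * _ + _) => {k e IH}.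
elim/ev_ind: f => [k c d f IH|]; last by rewrite mulr0 !bimod_scale0l bimod_scale0r.
rewrite mulrDr -ev_scaleAr !bimod_scale_linl bimod_scaleDr bimod_scale_kunit IH.
by rewrite [tens a b * tens c d]ev_mul_tens !bimod_scale_tens !mulrA.
Qed.
HB.instance Definition _ := GRing.Zmodule_isLmodule.Build (ev A) bimod
  bimod_scaleA bimod_scale1 bimod_scaleDr bimod_scaleDl.
End Bimod.

HB.mixin Record isKLinear (K : pzRingType) (A B : kalgType K) (f : A -> B) := {
  klinear : forall (k : K) (x : A), f (kunit k * x) = kunit k * f x
}.
HB.structure Definition KAlgHom (K : pzRingType) (A B : kalgType K) :=
  {f of @GRing.RMorphism A B f & isKLinear K A B f}.

Section EvMap.
Variables (K : comPzRingType) (B A : kalgType K) (pi : KAlgHom.type B A).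

Lemma ev_map_subproof :
  bilin (fun p : B * B => tens (pi p.1) (pi p.2) : ev A).
Proof.
by split=> k a a' b /=; rewrite rmorphD /= klinear (tens_linl, tens_linr).
Qed.

Definition ev_map (x : ev B) : ev A := umod_lift ev_map_subproof x.

Lemma ev_map_tens a b : ev_map (tens a b) = tens (pi a) (pi b).
Proof. exact: umod_lift_gen. Qed.
Let ev_mapP k x y : ev_map (k *: x + y) = k *: ev_map x + ev_map y.
Proof. exact: umod_lift_linear. Qed.
Lemma ev_map_zmod : zmod_morphism ev_map.
Proof. by move=> x y; rewrite addrC -scaleN1r ev_mapP scaleN1r addrC. Qed.
Lemma ev_map_monoid : monoid_morphism ev_map.
Proof.
split; first by rewrite ev_map_tens !rmorph1.
have ev_map0 : ev_map 0 = 0 by rewrite -(subrr 0) ev_map_zmod subrr.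
move=> x y; elim/ev_ind: x => [k a b x IH|]; last by rewrite mul0r ev_map0 mul0r.
rewrite mulrDl -ev_scaleAl !ev_mapP IH mulrDl -ev_scaleAl.
congr (_ *: _ + _) => {k x IH}.
elim/ev_ind: y => [k c d y IH|]; last by rewrite mulr0 ev_map0 mulr0.
rewrite mulrDr -ev_scaleAr !ev_mapP IH mulrDr -ev_scaleAr; congr (_ *: _ + _).
rewrite [tens a b * tens c d]ev_mul_tens !ev_map_tens.
by rewrite [tens (pi a) _ * _]ev_mul_tens !rmorphM.
Qed.
HB.instance Definition _ :=
  GRing.isZmodMorphism.Build (ev B) (ev A) ev_map ev_map_zmod.
HB.instance Definition _ :=
  GRing.isMonoidMorphism.Build (ev B) (ev A) ev_map ev_map_monoid.

(* A (x)_B M (x)_B A, as A^ev (x)_(B^ev) M *)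
Definition base_change (M : lmodType (ev B)) : lmodType (ev A) :=
  scalext ev_map M.

Lemma base_change_counit_subproof :
  phi_linear ev_map (pi : bimod B -> bimod A).
Proof.
move=> e x y.
have -> : pi (e *: x + y) = pi (e *: x) + pi y by exact: rmorphD.
congr (_ + _); elim/ev_ind: e => [k a b e IH|]; last first.
  by rewrite rmorph0 !scale0r rmorph0.
rewrite [X in _ = X *: _]ev_mapP.
have -> : (k *: tens a b + e) *: x
   = (kunit k * (a * (x : B) * b) : B) + (e *: x : bimod B).
  by rewrite -(bimod_scale_tens a b x); exact: bimod_scale_linl.
have -> : (k *: ev_map (tens a b) + ev_map e) *: (pi x : bimod A)
   = (kunit k * (pi a * pi x * pi b) : A) + (ev_map e *: (pi x : bimod A)).
  rewrite ev_map_tens -(bimod_scale_tens (pi a) (pi b) (pi x)).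
  exact: bimod_scale_linl.
by rewrite rmorphD /= klinear !rmorphM IH.
Qed.

(* the canonical map A (x)_B B (x)_B A -> A, a (x) b (x) a' |-> a pi(b) a' *)
Definition base_change_counit : {linear base_change (bimod B) -> bimod A} :=
  scalext_lift base_change_counit_subproof.
End EvMap.

Definition projective (R : pzRingType) (P : lmodType R) : Prop :=
  forall (M N : lmodType R) (p : {linear M -> N}) (f : {linear P -> N}),
    (forall y, exists x, p x = y) -> exists g : {linear P -> M}, p \o g =1 f.

(* M_0 <- M_1 <- M_2 <- ...; that the composites vanish is part of the        *)
(* exactness required of a resolution.                                        *)
Record modseq (R : pzRingType) := ModSeq {
  mobj :> nat -> lmodType R;
  mdif : forall n, {linear mobj n.+1 -> mobj n}
}.

Definition projective_resolution (R : pzRingType) (M : lmodType R)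
    (P : modseq R) (eps : {linear P 0%N -> M}) : Prop :=
  [/\ forall n, projective (P n),
      forall m, exists x, eps x = m,
      forall x : P 0%N, eps x = 0 <-> exists y, x = mdif P 0%N y
    & forall n (x : P n.+1), mdif P n x = 0 <-> exists y, x = mdif P n.+1 y].

Definition scalext_seq (R S : pzRingType) (phi : {rmorphism R -> S})
    (P : modseq R) : modseq S :=
  @ModSeq S (fun n => scalext phi (P n)) (fun n => scalext_map phi (mdif P n)).

Definition ring_epimorphism (R S : pzRingType) (phi : {rmorphism R -> S}) :=
  forall (T : pzRingType) (f g : {rmorphism S -> T}),
    (forall r, f (phi r) = g (phi r)) -> f =1 g.

(* Tor^R_i(S,S) is the homology of S (x)_R P, for P a projective resolution   *)
(* of the left R-module S.                                                    *)
Definition homological_epimorphism (R S : pzRingType)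
    (phi : {rmorphism R -> S}) : Prop :=
  ring_epimorphism phi /\
  forall (P : modseq R) (eps : {linear P 0%N -> scalres phi S^o}),
    projective_resolution eps ->
    forall i (x : scalext_seq phi P i.+1), mdif (scalext_seq phi P) i x = 0 ->
      exists y, x = mdif (scalext_seq phi P) i.+1 y.

(* Z / B, for submodules B <= Z of V *)
Section Subquotient.
Variables (R : pzRingType) (V : lmodType R) (Z B : submodClosed V).

Let memB (S : submodClosed V) x y : x \in S -> y \in S -> x - y \in S.
Proof. by move=> Sx Sy; rewrite -scaleN1r rpredD ?rpredZ. Qed.

Record subq_car := SubqCar { subq_val :> V; _ : subq_val \in Z }.
HB.instance Definition _ := [isSub for subq_val].
HB.instance Definition _ := [Choice of subq_car by <:].
HB.instance Definition _ := [SubChoice_isSubLmodule of subq_car by <:].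

Definition subq_den : {pred subq_car} := [pred x | \val x \in B].
Lemma subq_den_zmod : zmod_closed subq_den.
Proof.
split=> [|x y]; first by rewrite inE raddf0 rpred0.
by rewrite !inE => Bx By; rewrite raddfB memB.
Qed.
HB.instance Definition _ :=
  GRing.isZmodClosed.Build subq_car subq_den subq_den_zmod.

Definition subq : Type := Quotient.quot subq_den.
HB.instance Definition _ := GRing.Zmodule.on subq.

Definition subq_pi (x : subq_car) : subq := \pi_(Quotient.quot subq_den) x.
Definition subq_repr (x : subq) : subq_car := repr (x : Quotient.quot subq_den).

(* the class in Z / B of v; only meaningful for v in Z *)
Definition subq_class (v : V) : subq :=
  if insub v is Some x then subq_pi x else 0.
(* a representative in Z of a class in Z / B *)
Definition subq_rep (x : subq) : V := \val (subq_repr x).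

Lemma subq_repK x : subq_pi (subq_repr x) = x.
Proof. exact: reprK. Qed.
Lemma subq_piP x y : subq_pi x = subq_pi y <-> \val x - \val y \in B.
Proof.
rewrite -raddfB; split=> [/eqP|] H.
  by rewrite -[_ \in B]/(x - y \in subq_den) Quotient.idealrBE.
by apply/eqP; rewrite -Quotient.idealrBE.
Qed.
Lemma subq_piD x y : subq_pi (x + y) = subq_pi x + subq_pi y.
Proof. exact: raddfD. Qed.

Definition subq_scale (r : R) (x : subq) : subq := subq_pi (r *: subq_repr x).

Lemma subq_piZ r x : subq_scale r (subq_pi x) = subq_pi (r *: x).
Proof.
apply/subq_piP; 
have valZ (z : subq_car) : \val (r *: z) = r *: \val z by exact: linearZ.
rewrite !valZ -scalerBr rpredZ //.
by apply/subq_piP; rewrite subq_repK.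
Qed.
Lemma subq_scaleA r s (x : subq) :
  subq_scale r (subq_scale s x) = subq_scale (r * s) x.
Proof. by rewrite -[x]subq_repK !subq_piZ scalerA. Qed.
Lemma subq_scale1 : left_id 1 subq_scale.
Proof. by move=> x; rewrite -[x]subq_repK subq_piZ scale1r. Qed.
Lemma subq_scaleDr : right_distributive subq_scale +%R.
Proof.
move=> r x y; rewrite -[x]subq_repK -[y]subq_repK -subq_piD !subq_piZ.
by rewrite scalerDr subq_piD.
Qed.
Lemma subq_scaleDl (x : subq) : {morph subq_scale^~ x : r s / r + s}.
Proof. by move=> r s; rewrite -[x]subq_repK !subq_piZ scalerDl subq_piD. Qed.
HB.instance Definition _ := GRing.Zmodule_isLmodule.Build R subq
  subq_scaleA subq_scale1 subq_scaleDr subq_scaleDl.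
End Subquotient.

Section Hochschild.
Variables (K : comPzRingType) (A : kalgType K).

(* K-multilinear maps A^n -> G, as functions on sequences which are extended  *)
(* by 0 to the sequences of length other than n.                              *)
Definition multilinear (n : nat) (G : lmodType K) (f : seq A -> G) : Prop :=
  (forall s, size s != n -> f s = 0) /\
  (forall s t k a b, (size s + size t)%N.+1 = n ->
     f (s ++ (kunit k * a + b) :: t) = k *: f (s ++ a :: t) + f (s ++ b :: t)).

(* a_0, ..., a_i a_(i+1), ..., a_n *)
Fixpoint merge (i : nat) (s : seq A) : seq A :=
  match i, s with
  | 0, a :: b :: t => a * b :: t
  | j.+1, a :: t => a :: merge j t
  | _, _ => s
  end.

Lemma size_merge i s : (i.+1 < size s)%N -> size (merge i s) = (size s).-1.
Proof.
elim: i s => [|i IH] [|a [|b s]] //= H.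
by rewrite IH.
Qed.

Lemma merge_middle i s t : (i < size s + size t)%N ->
  exists s' t' (phi : A -> A),
    [/\ (size s' + size t')%N.+1 = (size s + size t)%N,
        forall k a b, phi (kunit k * a + b) = kunit k * phi a + phi b
      & forall x, merge i (s ++ x :: t) = s' ++ phi x :: t'].
Proof.
elim: s i => [|c s IH] [|i] /=; rewrite ?add0n.
- case: t => [|c t] // _; exists [::], t, (fun x => x * c); split=> //.
  by move=> k a b; rewrite mulrDl mulrA.
- move=> H; exists [::], (merge i t), id; split=> //=.
  by rewrite size_merge // add0n; case: (size t) H.
- case: s {IH} => [|d s] _.
    exists [::], t, (fun x => c * x); split=> // k a b.
    by rewrite mulrDr mulrA -kunit_central mulrA.
  by exists (c * d :: s), t, id; split=> //=; rewrite addSn.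
- rewrite addSn ltnS => /IH [s' [t' [phi [H1 H2 H3]]]].
  exists (c :: s'), t', phi; split=> //= [|x]; first by rewrite addSn H1.
  by rewrite H3.
Qed.

(* The Hochschild differential of the cochains with values in a bimodule G,   *)
(* given by its left and right actions.                                       *)
Definition hoch_diff (G : lmodType K) (l r : A -> G -> G) (n : nat)
    (f : seq A -> G) (s : seq A) : G :=
  if size s == n.+1 then
    l s`_0 (f (behead s)) + \sum_(i < n) (-1) ^+ i.+1 *: f (merge i s)
      + (-1) ^+ n.+1 *: r s`_n (f (take n s))
  else 0.

Definition action_bilinear (G : lmodType K) (l : A -> G -> G) : Prop :=
  (forall k a b x, l (kunit k * a + b) x = k *: l a x + l b x) /\
  (forall a, linear (l a)).

Lemma hoch_diff_multilinear (G : lmodType K) (l r : A -> G -> G) n f :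
  action_bilinear l -> action_bilinear r ->
  multilinear n f -> multilinear n.+1 (hoch_diff l r n f).
Proof.
move=> [l1 l2] [r1 r2] [f0 fP]; split=> [s /negbTE Hs|s t k a b [Hst]].
  by rewrite /hoch_diff Hs.
have Hs x : size (s ++ x :: t) = n.+1 by rewrite size_cat /= addnS Hst.
rewrite /hoch_diff !Hs eqxx 2!scalerDr !addrA.
set L := fun x => l (s ++ x :: t)`_0 (f (behead (s ++ x :: t))).
set M := fun x => \sum_(i < n) (-1) ^+ i.+1 *: f (merge i (s ++ x :: t)).
set T := fun x => (-1) ^+ n.+1 *: r (s ++ x :: t)`_n (f (take n (s ++ x :: t))).
have HL : L (kunit k * a + b) = k *: L a + L b.
  rewrite /L; case: s Hst {Hs L M T} => [|c s] /= Hst; first exact: l1.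
  by rewrite fP // l2.
have HM : M (kunit k * a + b) = k *: M a + M b.
  rewrite /M scaler_sumr -big_split; apply: eq_bigr => i _ /=.
  have Hi : (i < size s + size t)%N by rewrite Hst.
  have [s' [t' [phi [H1 H2 H3]]]] := merge_middle Hi.
  rewrite !H3 H2 fP ?H1 // scalerDr !scalerA; congr (_ *: _ + _).
  by rewrite mulrC.
have HT : T (kunit k * a + b) = k *: T a + T b.
  rewrite /T !scalerA [k * _]mulrC -!scalerA -scalerDr; congr (_ *: _).
  case/lastP: t Hst {Hs L M T HL HM} => [|t c].
    rewrite addn0 => <-; rewrite !nth_cat !ltnn !subnn /= !take_size_cat //.
  rewrite size_rcons addnS => Hst.
  have E x : s ++ x :: rcons t c = rcons (s ++ x :: t) c.
    by rewrite rcons_cat rcons_cons.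
  have Hn x : size (s ++ x :: t) = n by rewrite size_cat /= addnS.
  rewrite !E !nth_rcons !Hn !ltnn !eqxx -!cats1 !take_size_cat //.
  by rewrite fP // r2.
rewrite -![l _ _]/(L _) -!/(M _) -![_ *: r _ _]/(T _) HL HM HT.
rewrite -!addrA; congr (_ + _).
move: (L b) (k *: M a) (M b) (k *: T a) (T b) => u v w x y.
by rewrite [LHS]addrCA [w + _]addrCA [u + (x + _)]addrCA.
Qed.
End Hochschild.

(* The bar resolution of A over A^ev. In degree n it is                       *)
(* A^ev (x)_K A^(x)n = A (x) A^(x)n (x) A, the A^ev-module generated by the   *)
(* symbols [a_1, ..., a_n] = 1 (x) a_1 (x) ... (x) a_n (x) 1, multilinear     *)
(* over K.                                                                    *)
Section Bar.
Variables (K : comPzRingType) (A : kalgType K).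

Definition bar_adm (n : nat) (G : lmodType (ev A)) (f : seq A -> G) : Prop :=
  multilinear n (f : seq A -> scalres (@kunit K (ev A)) G).

Definition bar_obj (n : nat) : lmodType (ev A) := umod (bar_adm n).

Definition bar_sym (n : nat) (s : seq A) : bar_obj n := gen (bar_adm n) s.

Lemma bar_sym_multilinear n : bar_adm n (@bar_sym n).
Proof.
split=> [s Hs|s t k a b Hst]; apply: umodP => G f hf.
  by rewrite umod_eval0 // umod_eval_gen //; case: hf => -> .
rewrite umod_evalD // umod_evalZ // !umod_eval_gen //.
by case: hf => _; apply.
Qed.

(* d [a_1, ..., a_(n+1)] = a_1 [a_2, ..., a_(n+1)]                            *)
(*   + sum_(1 <= i <= n) (-1)^i [a_1, ..., a_i a_(i+1), ..., a_(n+1)]         *)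
(*   + (-1)^(n+1) [a_1, ..., a_n] a_(n+1)                                     *)
Definition bar_face (n : nat) : seq A -> bar_obj n :=
  hoch_diff (G := scalres (@kunit K (ev A)) (bar_obj n))
    (fun a x => tens a 1 *: (x : bar_obj n))
    (fun a x => tens 1 a *: (x : bar_obj n)) n (@bar_sym n).

Let act_bilinear (n : nat) (c : A -> ev A) :
  (forall k a b, c (kunit k * a + b) = k *: c a + c b) ->
  action_bilinear (G := scalres (@kunit K (ev A)) (bar_obj n))
    (fun a x => c a *: (x : bar_obj n)).
Proof.
have kE k (e : ev A) : k *: e = (kunit k : ev A) * e.
  by rewrite -[kunit k]/(ev_unit A k) -ev_scaleAl [ev_one A * _]ev_mul1r.
move=> cP; split=> [k a b x|a k x y].
  by rewrite cP kE [LHS]scalerDl -[in LHS]scalerA.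
by rewrite [LHS]scalerDr [X in X + _]scalerA -kunit_central -scalerA.
Qed.

Lemma bar_face_multilinear n : bar_adm n.+1 (@bar_face n).
Proof.
apply: hoch_diff_multilinear; last exact: bar_sym_multilinear.
  by apply: act_bilinear => k a b; rewrite tens_linl.
by apply: act_bilinear => k a b; rewrite tens_linr.
Qed.

Definition bar_dif (n : nat) : {linear bar_obj n.+1 -> bar_obj n} :=
  umod_lift (bar_face_multilinear n).

Definition bar : modseq (ev A) := ModSeq bar_dif.

Lemma bar_aug_subproof :
  bar_adm 0%N (fun s : seq A => (if s is [::] then 1 else 0 : A) : bimod A).
Proof. by split=> [[|a s]|]. Qed.

(* the augmentation a (x) a' |-> a a' *)
Definition bar_aug : {linear bar 0%N -> bimod A} := umod_lift bar_aug_subproof.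

End Bar.

Section HochschildCohomology.
Variables (K : comPzRingType) (A : kalgType K).

Definition cochain : Type := seq A -> kmod A.
HB.instance Definition _ := GRing.Lmodule.on cochain.

Definition hh_diff (n : nat) (f : cochain) : cochain :=
  hoch_diff (G := kmod A) (fun a x => a * (x : A)) (fun a x => (x : A) * a) n f.

Definition is_cocycle (n : nat) (f : cochain) : Prop :=
  multilinear n f /\ hh_diff n f = 0.

Definition is_coboundary (n : nat) (f : cochain) : Prop :=
  match n with
  | 0 => f = 0
  | m.+1 => exists2 h : cochain, multilinear m h & f = hh_diff m h
  end.

Lemma cochain_linE r (f g : cochain) s : (r *: f + g) s = r *: f s + g s.
Proof. by []. Qed.

Lemma multilinear_lin n r (f g : cochain) :
  multilinear n f -> multilinear n g -> multilinear n (r *: f + g : cochain).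
Proof.
move=> [f0 fP] [g0 gP]; split=> [s Hs|s t k a b Hst].
  by rewrite cochain_linE g0 // addr0 f0 // scaler0.
rewrite !cochain_linE fP // gP //.
by rewrite !scalerDr !scalerA [k * r]mulrC addrACA.
Qed.

Lemma multilinear0 n : multilinear n (0 : cochain).
Proof.
split=> [//|s t k a b _].
suff E : k *: (0 : kmod A) + (0 : kmod A) = 0 by exact: esym E.
by rewrite scaler0 addr0.
Qed.

Let lin3 (G : lmodType K) (k c : K) (x y s t u w : G) :
  (k *: x + y) + (k *: s + t) + c *: (k *: u + w)
  = k *: (x + s + c *: u) + (y + t + c *: w).
Proof.
by rewrite [c *: _]scalerDr !scalerA mulrC -scalerA !scalerDr (addrACA (k *: x))
  [LHS]addrACA.
Qed.

Lemma hh_diff_linear n : linear (hh_diff n).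
Proof.
move=> r f g; apply: funext => s.
rewrite cochain_linE /hh_diff /hoch_diff.
case: eqP => _; last by rewrite scaler0 addr0.
set x := s`_0; set y := s`_n.
have -> : x * ((r *: f + g) (behead s) : A)
    = r *: (x * (f (behead s) : A) : kmod A) + (x * (g (behead s) : A) : kmod A).
  rewrite -[(r *: f + g) _]/(kunit r * (f (behead s) : A) + g (behead s)).
  rewrite -[r *: _]/(kunit r * (x * (f (behead s) : A))).
  by rewrite mulrDr !mulrA kunit_central.
have -> : ((r *: f + g) (take n s) : A) * y
    = r *: ((f (take n s) : A) * y : kmod A) + ((g (take n s) : A) * y : kmod A).
  rewrite -[(r *: f + g) _]/(kunit r * (f (take n s) : A) + g (take n s)).
  rewrite -[r *: _]/(kunit r * ((f (take n s) : A) * y)).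
  by rewrite mulrDl !mulrA.
have -> : \sum_(i < n) (-1) ^+ i.+1 *: (r *: f + g) (merge i s)
    = r *: (\sum_(i < n) (-1) ^+ i.+1 *: f (merge i s))
      + \sum_(i < n) (-1) ^+ i.+1 *: g (merge i s).
  rewrite scaler_sumr -big_split; apply: eq_bigr => i _.
  by rewrite /= cochain_linE scalerDr !scalerA mulrC.
exact: lin3.
Qed.

Definition cocycles (n : nat) : {pred cochain} := fun f => `[< is_cocycle n f >].
Lemma cocycles_submod n : submod_closed (cocycles n).
Proof.
split=> [|r f g /asboolP [Hf df] /asboolP [Hg dg]]; apply/asboolP.
  split; first exact: multilinear0.
  by move: (hh_diff_linear n (-1) 0 0); rewrite scaler0 addr0 scaleN1r addNr.
split; first exact: multilinear_lin.
by rewrite hh_diff_linear df dg scaler0 addr0.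
Qed.
HB.instance Definition _ n :=
  GRing.isSubmodClosed.Build K cochain (cocycles n) (cocycles_submod n).

Definition coboundaries (n : nat) : {pred cochain} :=
  fun f => `[< is_coboundary n f >].
Lemma coboundaries_submod n : submod_closed (coboundaries n).
Proof.
split=> [|r f g /asboolP Hf /asboolP Hg]; apply/asboolP.
  case: n => [//|n]; exists 0; first exact: multilinear0.
  by move: (hh_diff_linear n (-1) 0 0); rewrite scaler0 addr0 scaleN1r addNr => ->.
case: n Hf Hg => [-> ->|n [h Hh ->] [h' Hh' ->]] /=.
  by rewrite scaler0 addr0.
by exists (r *: h + h'); [exact: multilinear_lin|rewrite hh_diff_linear].
Qed.
HB.instance Definition _ n :=
  GRing.isSubmodClosed.Build K cochain (coboundaries n) (coboundaries_submod n).

Definition HH (n : nat) : lmodType K := subq (cocycles n) (coboundaries n).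

(* the class of a cocycle, and a cocycle in a class *)
Definition hh_class (n : nat) (f : cochain) : HH n :=
  subq_class (cocycles n) (coboundaries n) f.
Definition hh_rep (n : nat) (x : HH n) : cochain := subq_rep x.

Definition cup (m : nat) (f g : cochain) : cochain :=
  fun s => (f (take m s) : A) * (g (drop m s) : A).

(* With i counted from 0 the sign of the i-th insertion is (-1)^(i (n-1));    *)
(* n-1 is replaced by n+1, of the same parity, since it is -1 for n = 0. The  *)
(* same is done for the sign (-1)^((m-1)(n-1)) in the bracket.                *)
Definition bullet (m n : nat) (f g : cochain) : cochain := fun s =>
  \sum_(i < m) (-1) ^+ (i * n.+1)%N *:
    f (take i s ++ (g (take n (drop i s)) : A) :: drop (i + n)%N s).

Definition bracket (m n : nat) (f g : cochain) : cochain :=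
  bullet m n f g - (-1) ^+ (m.+1 * n.+1)%N *: bullet n m g f.

(* The operations on classes, computed on representatives: these expressions  *)
(* in cocycles are cocycles, and their classes do not depend on the choice of *)
(* the representatives. In degree -1, which occurs for m = n = 0, HH^(-1) = 0;*)
(* here the bracket and the square are then the zero of HH 0, because the     *)
(* bullet product of 0-cochains is 0.                                         *)
Definition hh_one : HH 0%N :=
  hh_class 0%N (fun s => (if s is [::] then 1 else 0 : A) : kmod A).
Definition hh_cup (m n : nat) (x : HH m) (y : HH n) : HH (m + n)%N :=
  hh_class (m + n)%N (cup m (hh_rep x) (hh_rep y)).
Definition hh_bracket (m n : nat) (x : HH m) (y : HH n) : HH (m + n)%N.-1 :=
  hh_class (m + n)%N.-1 (bracket m n (hh_rep x) (hh_rep y)).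
Definition hh_sq (n : nat) (x : HH (2 * n)%N) : HH (4 * n)%N.-1 :=
  hh_class (4 * n)%N.-1 (bullet (2 * n)%N (2 * n)%N (hh_rep x) (hh_rep x)).

(* The A^ev-linear map F on A (x) A^(x)n (x) A with                           *)
(* F(1 (x) a_1 ... a_n (x) 1) = f(a_1 ... a_n); it determines f, and d^* F    *)
(* corresponds to hh_diff f.                                                  *)
Definition represents (n : nat) (F : {linear bar A n -> bimod A}) (f : cochain) :=
  forall s, F (bar_sym n s) = f s.

End HochschildCohomology.

Definition chain_map (R : pzRingType) (P Q : modseq R)
    (c : forall n, {linear P n -> Q n}) : Prop :=
  forall n x, c n (mdif P n x) = mdif Q n (c n.+1 x).

(* chain maps P -> P[k], for the differential (-1)^k d on P[k] *)
Definition shift_map (R : pzRingType) (P : modseq R) (k : nat)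
    (u : forall i, {linear P (i + k)%N -> P i}) : Prop :=
  forall i x, u i (mdif P (i + k)%N x) = (-1) ^+ k *: mdif P i (u i.+1 x).

Definition hom_coboundary (R : pzRingType) (P : modseq R) (N : lmodType R)
    (k : nat) : (P k -> N) -> Prop :=
  match k return (P k -> N) -> Prop with
  | 0 => fun H => forall x, H x = 0
  | j.+1 => fun H => exists h : {linear P j -> N}, forall x, H x = h (mdif P j x)
  end.

(* Let F = S (x)_R -, and let theta : F(M) -> N. For projective resolutions P *)
(* of M and Q of N, the morphisms M -> M[k] and N -> N[k] of the derived      *)
(* categories are given by cocycles f : P_k -> M and g : Q_k -> N up to       *)
(* coboundaries. Lift f to a chain map u : P -> P[k]; then the total left     *)
(* derived functor sends f to F(u) : F(P) -> F(P)[k]. If theta F(epsP) is a   *)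
(* resolution F(P) -> N, so that F(P) and N are isomorphic in the derived     *)
(* category, with the inverse isomorphism given by a chain map c : Q -> F(P)  *)
(* over N, then the endomorphism of N of degree k so obtained is the class of *)
(* theta F(epsP) F(u_0) c_k. The predicate says that this is the class of g.  *)
Definition derived_image (R S : pzRingType) (phi : {rmorphism R -> S})
    (M : lmodType R) (N : lmodType S) (theta : {linear scalext phi M -> N})
    (P : modseq R) (epsP : {linear P 0%N -> M})
    (Q : modseq S) (epsQ : {linear Q 0%N -> N})
    (k : nat) (f : {linear P k -> M}) (g : {linear Q k -> N}) : Prop :=
  let FP := scalext_seq phi P in
  let epsFP : {linear FP 0%N -> N} := theta \o scalext_map phi epsP in
  [/\ projective_resolution epsP, projective_resolution epsQ,
      projective_resolution epsFP
    & exists (u : forall i, {linear P (i + k)%N -> P i})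
             (c : forall i, {linear Q i -> FP i}),
      [/\ shift_map u, forall x, epsP (u 0%N x) = f x,
          chain_map c, forall x, epsFP (c 0%N x) = epsQ x
        & hom_coboundary
            (fun x => g x - epsFP (scalext_map phi (u 0%N) (c k x)))]].

(* y is the image of x under the map induced on HH^n = Ext^n by the total     *)
(* left derived functor of A (x)_B - (x)_B A, HH^n being identified with      *)
(* Ext^n by means of the bar resolutions.                                     *)
Definition hh_derived_image (K : comPzRingType) (B A : kalgType K)
    (pi : KAlgHom.type B A) (n : nat) (x : HH B n) (y : HH A n) : Prop :=
  exists (f : cochain B) (g : cochain A)
         (F : {linear bar B n -> bimod B}) (G : {linear bar A n -> bimod A}),
    [/\ is_cocycle n f /\ hh_class n f = x, is_cocycle n g /\ hh_class n g = y,
        represents F f, represents G g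
      & derived_image (base_change_counit pi) (bar_aug B) (bar_aug A) F G].

(* Main.v *)
(* The derived functor is computed on Hochschild cochains. Composition with   *)
(* pi and restriction along pi are chain maps C(B,B) -> C(B,A) <- C(A,A). As  *)
(* pi is a homological epimorphism, A (x)_B Bar(B) (x)_B A is a projective    *)
(* resolution of A: it is A (x)_B (-) applied to the resolution               *)
(* Bar(B) (x)_B A of the B-module A, so its homology in positive degrees is   *)
(* Tor^B(A,A) = 0, and in degree 0 the equality A (x)_B A = A holds because   *)
(* pi is an epimorphism. Hence the restriction is a quasi-isomorphism, pi_*   *)
(* is its inverse after the composition with pi, and pi_* [f] = [g] iff       *)
(* pi f - g pi = dh for some cochain h of B with values in A.                 *)
(*   Let also pi f' - g' pi = dh'. Gerstenhaber's formula for d(x o y) remains*)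
(* true when the arguments are transported along ring homomorphisms, and      *)
(* shows that pi (f o f') - (g o g') pi, which equals g o dh' + dh o f', is,  *)
(* up to coboundaries, a sum of cup products of h with f' and g' and of h'    *)
(* with f and g. In the bracket these products add up to                      *)
(* +-d(h' u h) +-d(h u h'), and in the square of an even class to d(h u h).   *)

(* Everything is compared in the complex C(B,A) of cochains of B with values in A. Write pi f for
   the composition of a cochain f of B with [pi], and g pi for the restriction of a cochain g of A
   along [pi]. The pair f, g is [compatible] when pi f - g pi is a coboundary of C(B,A).

   The derived functor is the relation [compatible]. By [FB_resolution] the complex A (x)_B Bar(B)
   (x)_B A is a projective resolution of A. In degree 0 this rests on [ring_epimorphism_central]: an
   element of an A-bimodule that commutes with the image of B commutes with A. In positive degrees
   the complex is A (x)_B applied to the resolution [lbar] of the left B-module A, so its homology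
   is Tor. Hence it is homotopy equivalent to Bar(A), by the map c that applies [pi] to all symbols
   ([FB_to_bar_exists]) and some comparison map d in the other direction. Moving cocycles along c
   and d shows that every cocycle f has a compatible cocycle g ([compatible_total]), that g is
   unique up to coboundaries ([compatible_inj]), and that the derived functor sends the class of f
   to the class of g iff f and g are compatible ([derived_imageP]).

   It remains to see that the operations preserve compatibility. For cup products this is the
   Leibniz rule ([compatible_cup]). For the bullet product let pi f = g pi + dh and pi f' = g' pi +
   dh'. Then pi (f o f') - (g o g') pi = g o dh' + dh o f' ([bullet_defect]), and Gerstenhaber's
   formula for d(x o y), proved along ring maps B -> C -> A in [rdiff_rbullet], turns the right side
   into a boundary plus cup products of h, h' with cocycles. In the bracket the products with g and
   g' cancel and the others form d of a combination of h' u h and h u h' ([compatible_bracket_pos]);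
   in the square of an even class they form d(h u h) ([compatible_bullet_even]). *)
Require Import Defs.
From HB Require Import structures.
From mathcomp Require Import all_boot all_order all_algebra.
From mathcomp Require Import boolp functions ring zify.
Set Implicit Arguments.
Unset Strict Implicit.
Unset Printing Implicit Defensive.
Import GRing.Theory.
Local Open Scope ring_scope.
Local Notation merge := Defs.merge.

(* The square-zero extension K (+) V; through it [ring] proves identities in  *)
(* K-modules.                                                                 *)
Definition sqzero (K : comPzRingType) (V : lmodType K) : Type := (K * V)%type.

Section SquareZero.
Variables (K : comPzRingType) (V : lmodType K).
Local Notation T := (sqzero V).
HB.instance Definition _ := GRing.Zmodule.on T.

Definition sqzero_mul (x y : T) : T := (x.1 * y.1, x.1 *: y.2 + y.1 *: x.2).

Lemma sqzero_mulA : associative sqzero_mul.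
Proof.
move=> [a x] [b y] [c z]; congr (_, _) => /=; first by rewrite mulrA.
by rewrite !scalerDr !scalerA addrA [c * a]mulrC [c * b]mulrC.
Qed.
Lemma sqzero_mulC : commutative sqzero_mul.
Proof. by move=> [a x] [b y]; congr (_, _) => /=;
  rewrite ?(mulrC b) // addrC. Qed.
Lemma sqzero_mul1 : left_id ((1, 0) : T) sqzero_mul.
Proof. by move=> [a x]; congr (_, _) => /=; rewrite ?mul1r // scaler0 addr0
  scale1r. Qed.
Lemma sqzero_mulD : left_distributive sqzero_mul +%R.
Proof.
move=> [a x] [b y] [c z]; congr (_, _) => /=; first by rewrite mulrDl.
by rewrite scalerDl scalerDr addrACA.
Qed.
HB.instance Definition _ := GRing.Zmodule_isComPzRing.Build T
  sqzero_mulA sqzero_mulC sqzero_mul1 sqzero_mulD.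

Definition sqzero_in (v : V) : T := (0, v).
Definition sqzero_scalar (k : K) : T := (k, 0).

Lemma sqzero_inj (u v : V) : sqzero_in u = sqzero_in v -> u = v.
Proof. by case. Qed.
Lemma sqzero_inD u v : sqzero_in (u + v) = sqzero_in u + sqzero_in v.
Proof. by congr (_, _); rewrite ?addr0. Qed.
Lemma sqzero_inN u : sqzero_in (- u) = - sqzero_in u.
Proof. by congr (_, _); rewrite ?oppr0. Qed.
Lemma sqzero_in0 : sqzero_in 0 = 0. Proof. by []. Qed.
Lemma sqzero_inZ k u : sqzero_in (k *: u) = sqzero_scalar k * sqzero_in u.
Proof. by congr (_, _) => /=; rewrite ?mulr0 // scale0r addr0. Qed.
Lemma sqzero_scalarD k l : sqzero_scalar (k + l)
  = sqzero_scalar k + sqzero_scalar l.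
Proof. by congr (_, _); rewrite ?addr0. Qed.
Lemma sqzero_scalarN k : sqzero_scalar (- k) = - sqzero_scalar k.
Proof. by congr (_, _); rewrite ?oppr0. Qed.
Lemma sqzero_scalarM k l : sqzero_scalar (k * l)
  = sqzero_scalar k * sqzero_scalar l.
Proof. by congr (_, _) => /=; rewrite !scaler0 addr0. Qed.
Lemma sqzero_scalar1 : sqzero_scalar 1 = 1. Proof. by []. Qed.
Lemma sqzero_scalar0 : sqzero_scalar 0 = 0. Proof. by []. Qed.
End SquareZero.

Ltac module_ring := apply: sqzero_inj;
  rewrite ?(sqzero_inD, sqzero_inN, sqzero_in0, sqzero_inZ, sqzero_scalarD,
    sqzero_scalarN, sqzero_scalarM, sqzero_scalar1, sqzero_scalar0); ring.

(** * Cochains and the multilinear calculus *)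

Section MergeSum.
Variables (K : comPzRingType) (A : kalgType K) (V : lmodType K).
Implicit Types (F : seq A -> V) (s t u : seq A).

(** The inner faces of [hoch_diff], without the outer ones; the degree is read off [s], which makes
    induction on [s] possible. *)
Definition merge_sum F s : V :=
  \sum_(i < (size s).-1) (-1) ^+ i.+1 *: F (merge i s).

Lemma eq_merge_sum F F' s :
  (forall u, size u = (size s).-1 -> F u = F' u) ->
  merge_sum F s = merge_sum F' s.
Proof.
move=> eqF; apply: eq_bigr => i _; rewrite eqF // Defs.size_merge //.
by case: s i {eqF} => [[]|a s i] //=; rewrite ltnS; exact: ltn_ord.
Qed.

Lemma merge_sum_lin k F F' s :
  merge_sum (fun u => F u + k *: F' u) s
  = merge_sum F s + k *: merge_sum F' s.
Proof.
rewrite scaler_sumr -big_split; apply: eq_bigr => i _ /=.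
by rewrite scalerDr !scalerA mulrC.
Qed.

Lemma merge_sum0 s : merge_sum (fun=> 0) s = 0.
Proof. by apply: big1 => i _; rewrite scaler0. Qed.

Lemma merge_sum_small F s : (size s <= 1)%N -> merge_sum F s = 0.
Proof. by case: s => [|a [|b s]] // _; rewrite /merge_sum big_ord0. Qed.

Lemma merge_sum_cons F a b s :
  merge_sum F (a :: b :: s)
  = - F (a * b :: s) - merge_sum (fun u => F (a :: u)) (b :: s).
Proof.
rewrite /merge_sum /= big_ord_recl /= expr1 scaleN1r; congr (_ + _).
rewrite -sumrN; apply: eq_bigr => i _.
by rewrite /bump add1n exprS mulN1r scaleNr.
Qed.

(** A face either multiplies two of the first n+1 letters or two of the letters from position n on;
    the letter in position n belongs to both groups. This is the combinatorial core of the Leibniz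
    rules. *)
Lemma merge_sum_split (F : seq A -> seq A -> V) n s : (n < size s)%N ->
  merge_sum (fun u => F (take n u) (drop n u)) s
  = merge_sum (F^~ (drop n.+1 s)) (take n.+1 s)
    + (-1) ^+ n *: merge_sum (F (take n s)) (drop n s).
Proof.
elim: n s F => [|n IH] s F.
  case: s => [//|a s] _; rewrite [X in _ = X + _]merge_sum_small /=; last first.
    by rewrite take0.
  rewrite add0r scale1r; apply: eq_merge_sum => u _; by rewrite take0 drop0.
case: s => [//|a [//|b s]]; rewrite ltnS => Hn.
rewrite [drop _ _]/= ![take _ _]/= !merge_sum_cons /=.
rewrite (IH (b :: s) (fun u v => F (a :: u) v)) // opprD !addrA.
by rewrite exprS mulN1r scaleNr.
Qed.

End MergeSum.

Lemma morph_add0 (V W : zmodType) (f : V -> W) :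
  {morph f : x y / x + y} -> f 0 = 0.
Proof. by move=> fD; apply: (addrI (f 0)); rewrite -fD !addr0. Qed.

Lemma morph_addB (V W : zmodType) (f : V -> W) :
  {morph f : x y / x + y} -> {morph f : x y / x - y}.
Proof. by move=> fD x y; apply: (addIr (f y)); rewrite -fD !subrK. Qed.

(** Signs are preserved by every additive map, also between modules over different rings. *)
Lemma morph_add_sign (K L : pzRingType) (V : lmodType K) (W : lmodType L)
    (f : V -> W) i x : {morph f : x y / x + y} ->
  f ((-1) ^+ i *: x) = (-1) ^+ i *: f x.
Proof.
move=> fD; rewrite -(signr_odd L) -(signr_odd K) !scaler_sign; case: odd => //.
by rewrite -[- x]sub0r morph_addB // morph_add0 // sub0r.
Qed.

Lemma morph_add_sum (V W : zmodType) (f : V -> W) I r (P : pred I) (F : I -> V) :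
  {morph f : x y / x + y} ->
  f (\sum_(i <- r | P i) F i) = \sum_(i <- r | P i) f (F i).
Proof. by move=> fD; apply: big_morph => //; exact: morph_add0. Qed.

Lemma merge_map (K : comPzRingType) (A B : kalgType K) (phi : B -> A) i s :
  {morph phi : x y / x * y} -> merge i (map phi s) = map phi (merge i s).
Proof.
move=> phiM; elim: s i => [|a s IH] [|i] //=; last by rewrite IH.
by case: s {IH} => [|b s] //=; rewrite phiM.
Qed.

Lemma merge_sum_map (K : comPzRingType) (A B : kalgType K) (V : lmodType K)
    (F : seq A -> V) (phi : B -> A) s :
  {morph phi : x y / x * y} ->
  merge_sum F (map phi s) = merge_sum (fun u => F (map phi u)) s.
Proof.
move=> phiM; rewrite /merge_sum size_map.
by apply: eq_bigr => i _; rewrite merge_map.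
Qed.

Lemma merge_sum_additive (K : comPzRingType) (A : kalgType K) (V W : lmodType K)
    (f : V -> W) (F : seq A -> V) s :
  {morph f : x y / x + y} -> f (merge_sum F s) = merge_sum (fun u => f (F u)) s.
Proof.
move=> fD; rewrite morph_add_sum //.
by apply: eq_bigr => i _; rewrite morph_add_sign.
Qed.

Lemma hoch_diffE (K : comPzRingType) (A : kalgType K) (V : lmodType K)
    (l r : A -> V -> V) n (F : seq A -> V) s : size s = n.+1 ->
  hoch_diff l r n F s
  = l (nth (0 : A) s 0) (F (behead s)) + merge_sum F s
    + (-1) ^+ n.+1 *: r (nth (0 : A) s n) (F (take n s)).
Proof. by move=> Hs; rewrite /hoch_diff /merge_sum Hs eqxx. Qed.

Lemma hoch_diff_size (K : comPzRingType) (A : kalgType K) (V : lmodType K)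
    (l r : A -> V -> V) n (F : seq A -> V) s : size s != n.+1 ->
  hoch_diff l r n F s = 0.
Proof. by move=> /negbTE Hs; rewrite /hoch_diff Hs. Qed.

Lemma hoch_diff_map (K : comPzRingType) (A B : kalgType K) (V : lmodType K)
    (pi : KAlgHom.type B A) (l r : A -> V -> V) n (F : seq A -> V) (s : seq B) :
  hoch_diff (fun b => l (pi b)) (fun b => r (pi b)) n (fun u => F (map pi u)) s
  = hoch_diff l r n F (map pi s).
Proof.
have [Hs|Hs] := eqVneq (size s) n.+1; last by rewrite !hoch_diff_size // size_map.
have pM : {morph pi : x y / x * y} by exact: rmorphM.
rewrite !hoch_diffE ?size_map // (merge_sum_map _ _ pM) !(nth_map 0) ?Hs //.
by rewrite behead_map map_take.
Qed.

Section Multilinear.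
Variables (K : comPzRingType) (A : kalgType K) (V : lmodType K).
Implicit Types (F : seq A -> V) (s t u : seq A).

Lemma multilinear_size n F s : multilinear n F -> size s != n -> F s = 0.
Proof. by case=> + _; apply. Qed.

Lemma multilinearD n F s t a b : multilinear n F -> (size s + size t)%N.+1 = n ->
  F (s ++ a + b :: t) = F (s ++ a :: t) + F (s ++ b :: t).
Proof.
by move=> [_ H] /H{}H; have := H 1 a b; rewrite rmorph1 mul1r scale1r.
Qed.

Lemma multilinear_zero n F s t : multilinear n F -> F (s ++ 0 :: t) = 0.
Proof.
move=> HF; have [Hst|Hst] := eqVneq (size s + size t)%N.+1 n; last first.
  by rewrite (multilinear_size HF) // size_cat /= addnS.
by apply: (addrI (F (s ++ 0 :: t))); rewrite -(multilinearD _ _ HF) // !addr0.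
Qed.

Lemma multilinearZ n F s t k a : multilinear n F ->
  F (s ++ kunit k * a :: t) = k *: F (s ++ a :: t).
Proof.
move=> HF; have [Hst|Hst] := eqVneq (size s + size t)%N.+1 n; last first.
  by rewrite !(multilinear_size HF) ?scaler0 // size_cat /= addnS.
have := HF.2 s t k a 0 Hst; rewrite addr0 => ->.
by rewrite (multilinear_zero _ _ HF) addr0.
Qed.

Lemma multilinear_cons n F a :
  multilinear n.+1 F -> multilinear n (fun u => F (a :: u)).
Proof.
move=> HF; split=> [s Hs|s t k x y Hst]; first by rewrite (multilinear_size HF).
by rewrite -!cat_cons HF.2 // addSn Hst.
Qed.

Lemma multilinear_addZ n F F' k : multilinear n F -> multilinear n F' ->
  multilinear n (fun s => F s + k *: F' s).
Proof.
move=> [f0 fP] [g0 gP]; split=> [s Hs|s t l a b Hst].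
  by rewrite g0 // f0 // scaler0 addr0.
by rewrite fP // gP //; module_ring.
Qed.

Lemma multilinear_scale n F k : multilinear n F ->
  multilinear n (fun s => k *: F s).
Proof.
move=> [f0 fP]; split=> [s Hs|s t l a b Hst]; first by rewrite f0 // scaler0.
by rewrite fP //; module_ring.
Qed.

Lemma multilinear0 n : multilinear n (fun _ : seq A => 0 : V).
Proof. by split=> [//|s t k a b _]; rewrite scaler0 addr0. Qed.

End Multilinear.

Lemma multilinear_comp (K : comPzRingType) (A B : kalgType K) (V W : lmodType K)
    (pi : KAlgHom.type B A) (f : V -> W) n (F : seq A -> V) :
  (forall k x y, f (k *: x + y) = k *: f x + f y) ->
  multilinear n F -> multilinear n (fun s => f (F (map pi s))).
Proof.
move=> flin HF; split=> [s Hs|s t k a b Hst].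
  rewrite (multilinear_size HF) ?size_map //.
  by have := flin (-1) 0 0; rewrite scaler0 addr0 scaleN1r addNr.
by rewrite !map_cat /= rmorphD /= klinear HF.2 // !size_map.
Qed.

(** * Cochains of B with values in A *)

Section RelativeCochains.
Variables (K : comPzRingType) (B A : kalgType K).
Implicit Types (x y : seq B -> kmod A) (s : seq B).

Lemma kmod_scaleAl k (a b : A) : (k *: (a : kmod A) : A) * b
  = k *: (a * b : kmod A).
Proof. exact/esym/mulrA. Qed.
Lemma kmod_scaleAr k (a b : A) : a * (k *: (b : kmod A) : A)
  = k *: (a * b : kmod A).
Proof. by rewrite [LHS]mulrA -kunit_central -mulrA. Qed.

(** The differential of C(B,A), with A a B-bimodule along [pi]. For [idfun] it is the differential
    of C(A,A), so one calculus serves both. *)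
Definition rdiff (pi : KAlgHom.type B A) n (x : seq B -> kmod A) : seq B ->
  kmod A :=
  hoch_diff (fun b (a : kmod A) => pi b * (a : A)) (fun b (a : kmod A) => (a :
    A) * pi b) n x.

Definition rcup m (x y : seq B -> kmod A) : seq B -> kmod A :=
  fun s => (x (take m s) : A) * (y (drop m s) : A).

Lemma merge_sum_mulr x (c : A) s :
  merge_sum (fun u => (x u : A) * c : kmod A) s = (merge_sum x s : A) * c.
Proof.
by rewrite (merge_sum_additive (W := kmod A) (f :=
  fun a : kmod A => (a : A) * c : kmod A)) // => a b; exact: mulrDl.
Qed.
Lemma merge_sum_mull x (c : A) s :
  merge_sum (fun u => c * (x u : A) : kmod A) s = c * (merge_sum x s : A).
Proof.
by rewrite (merge_sum_additive (W := kmod A) (f :=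
  fun a : kmod A => c * (a : A) : kmod A)) // => a b; exact: mulrDr.
Qed.

(** The inner faces split by [merge_sum_split]. The last outer face of x and the first outer face of
    y both multiply by the letter in position m, with opposite signs, and cancel. *)
Lemma rdiff_rcup (pi : KAlgHom.type B A) m n x y s : size s = (m + n).+1 ->
  rdiff pi (m + n) (rcup m x y) s
  = rcup m.+1 (rdiff pi m x) y s + (-1) ^+ m *: rcup m x (rdiff pi n y) s.
Proof.
move=> Hs.
have sz1 : size (take m.+1 s) = m.+1 by rewrite size_takel // Hs ltnS leq_addr.
have sz2 : size (drop m s) = n.+1 by rewrite size_drop Hs -addnS addKn.
rewrite /rdiff hoch_diffE // /rcup (hoch_diffE _ _ _ sz1) (hoch_diffE _ _ _ sz2).
rewrite (@merge_sum_split _ _ _ (fun u v => (x u : A) * (y v : A) : kmod A) m);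
  last by rewrite Hs ltnS leq_addr.
rewrite merge_sum_mulr merge_sum_mull -!drop1 !drop_drop !take_drop.

rewrite [(n + m)%N]addnC [(1 + m)%N]add1n addn1 (take_takel _ (leqnSn m))
  !nth_take //.
rewrite !nth_drop addn0 mulrA !(mulrDl, mulrDr) kmod_scaleAl kmod_scaleAr.
rewrite (take_takel _ (leq_addr n m)) !mulrA !exprS !exprD.
move: (x (take m s) * _ * _) (_ * pi _) (_ * _ * y _) => a b c.
module_ring.
Qed.
End RelativeCochains.

Lemma sign_cases (R : pzRingType) n : (-1) ^+ n = 1 :> R \/ (-1) ^+ n = -1 :> R.
Proof. by rewrite -signr_odd; case: odd; [right|left]. Qed.

(** * Gerstenhaber's insertion product along ring maps *)

Section Insertion.
Variables (K : comPzRingType) (B C : kalgType K) (pi : KAlgHom.type B C).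
Variable V : lmodType K.
Implicit Types (f : seq C -> V) (g : seq B -> kmod C) (s : seq B).

(* Gerstenhaber's f o g, where the arguments of f that are not values of g    *)
(* are transported along pi.                                                  *)
Definition rbullet m n f g s : V :=
  \sum_(i < m) (-1) ^+ (i * n.+1)%N *:
    f (map pi (take i s) ++ (g (take n (drop i s)) : C)
       :: map pi (drop (i + n)%N s)).

Lemma rbullet_cons m n f g a s :
  rbullet m.+1 n f g (a :: s)
  = f ((g (take n (a :: s)) : C) :: map pi (drop n (a :: s)))
    + (-1) ^+ n.+1 *: rbullet m n (fun u => f (pi a :: u)) g s.
Proof.
rewrite /rbullet big_ord_recl mul0n scale1r add0n /= scaler_sumr.
by congr (_ + _); apply: eq_bigr => i _; rewrite scalerA mulSn exprD.
Qed.

Lemma rbullet1 n f g s :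
  rbullet 1 n f g s = f ((g (take n s) : C) :: map pi (drop n s)).
Proof. by rewrite /rbullet big_ord1 /= take0 drop0 mul0n scale1r. Qed.

Lemma rbullet_eq m n f f' g g' s :
  (forall u, size u = n -> g u = g' u) ->
  (forall u, size u = m -> f u = f' u) -> (size s).+1 = (m + n)%N ->
  rbullet m n f g s = rbullet m n f' g' s.
Proof.
move=> eqg eqf Hs; apply: eq_bigr => i _; congr (_ *: _).
have Him := ltn_ord i.
rewrite eqg ?eqf // ?size_takel ?size_cat /= ?size_map ?size_drop ?size_takel;
  lia.
Qed.

Lemma rbullet_linl m n f f' g k s :
  rbullet m n (fun u => f u + k *: f' u) g s
  = rbullet m n f g s + k *: rbullet m n f' g s.
Proof.
rewrite /rbullet scaler_sumr -big_split; apply: eq_bigr => i _ /=.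
by rewrite scalerDr !scalerA mulrC.
Qed.

Lemma rbulletZ m n f g k s :
  rbullet m n (fun u => k *: f u) g s = k *: rbullet m n f g s.
Proof.
rewrite /rbullet scaler_sumr; apply: eq_bigr => i _ /=.
by rewrite !scalerA mulrC.
Qed.

Lemma rbullet_addr m n f g g' s : multilinear m f -> (size s).+1 = (m + n)%N ->
  rbullet m n f (fun u => g u + g' u) s = rbullet m n f g s + rbullet m n f g' s.
Proof.
move=> Hf Hs; rewrite -big_split; apply: eq_bigr => i _ /=.
have Him := ltn_ord i.
rewrite -scalerDr; congr (_ *: _); apply: (multilinearD _ _ Hf).
by rewrite !size_map size_drop size_takel; lia.
Qed.

(* The faces that multiply a value of g with a neighbouring argument are the  *)
(* inner faces of f on one side and the outer faces of g on the other.        *)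
Lemma merge_sum_rbullet m n f g s :
  multilinear m f -> size s = (m + n)%N ->
  merge_sum (rbullet m n f g) s
  = (-1) ^+ n.+1 *: rbullet m.+1 n (merge_sum f) g s
    + rbullet m n.+1 f (rdiff pi n g) s.
Proof.
elim: m f s => [|m IH] f s Hf Hs.
  rewrite rbullet1 drop_oversize ?Hs // [merge_sum f _]merge_sum_small //.
  rewrite scaler0 add0r.
  rewrite [RHS]big_ord0 -[RHS](merge_sum0 V s); apply: eq_merge_sum => u _.
  by rewrite /rbullet big_ord0.
case: s Hs => [//|a s] Hs.
have Hs' : size s = (m + n)%N by case: Hs.
have sz : size (take n.+1 (a :: s)) = n.+1 by rewrite size_takel //=; lia.
(* [x] is the value of [g] on the first block, [c] the letter right after this block and [w] the
   rest; [c] exists because the total length is m+1+n. *)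
set x := g (take n (a :: s)).
have [c [w Hcw]] : exists c w, drop n (a :: s) = c :: w.
  case E: (drop n (a :: s)) => [|c w]; last by exists c, w.
  by have := size_drop n (a :: s); rewrite E /=; lia.
have cE : nth (0 : B) (a :: s) n = c by rewrite -[n]addn0 -nth_drop Hcw.
have wE : drop n.+1 (a :: s) = w by rewrite -addn1 addnC -drop_drop Hcw /= drop0.
have wE' : drop n s = w by rewrite -wE.
have pM : {morph pi : x y / x * y} by exact: rmorphM.
(* Insertion into the first slot: the faces among the first n+1 letters are inner faces of [g], the
   others are the faces of [f] at [x :: pi c :: pi w] except the product of [x] and [pi c], which
   has to be compensated. *)
have Head : merge_sum (fun u => f ((g (take n u) : C) :: map pi (drop n u))) (a
  :: s)
    = f ((merge_sum g (take n.+1 (a :: s)) : C) :: map pi w)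
    - (-1) ^+ n *: (merge_sum f ((x : C) :: pi c :: map pi w)
        + f ((x : C) * pi c :: map pi w)).
  rewrite (@merge_sum_split _ _ _ (fun u v => f ((g u : C) :: map pi v)) n);
    last first.
    by rewrite /= Hs'; lia.
  rewrite wE Hcw merge_sum_cons; congr (_ + _).
    have fD : {morph (fun z : kmod C => f ((z : C) :: map pi w)) : z y / z + y}.
      have Hw : (0 + size (map pi w))%N.+1 = m.+1.
        by rewrite size_map -wE size_drop /= Hs'; lia.
      by move=> y z; exact: (@multilinearD _ _ _ _ _ [::] _ y z Hf Hw).
    exact/esym/(merge_sum_additive g _ fD).
  rewrite -(merge_sum_map (fun u => f ((x : C) :: u)) (c :: w) pM) map_cons.
  module_ring.
have headP k y z : f ((k *: y + z : kmod C) :: map pi w)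
    = k *: f (y :: map pi w) + f (z :: map pi w).
  have Hw : (0 + size (map pi w))%N.+1 = m.+1.
    by rewrite size_map -wE size_drop /= Hs'; lia.
  exact: (Hf.2 [::] _ k y z Hw).
have DgE : f ((rdiff pi n g (take n.+1 (a :: s)) : C) :: map pi w)
    = f (pi a * g (take n s) :: map pi w)
      + f ((merge_sum g (take n.+1 (a :: s)) : C) :: map pi w)
      + (-1) ^+ n.+1 *: f ((x : C) * pi c :: map pi w).
  have -> : rdiff pi n g (take n.+1 (a :: s))
      = 1 *: (pi a * g (take n s) : kmod C)
        + ((-1) ^+ n.+1 *: ((x : C) * pi c : kmod C)
           + merge_sum g (take n.+1 (a :: s))).
    rewrite /rdiff (hoch_diffE _ _ _ sz) scale1r !nth_take // cE take_takel //.
    by rewrite -addrA; congr (_ + _); exact: addrC.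
  by rewrite !headP scale1r -addrA; congr (_ + _); exact: addrC.
(* [mulhd] is the face of [f] on [pi a :: u] in which [pi a] is absorbed by the next entry. *)
pose mulhd u := if u is d :: v then f (pi a * d :: v) else 0.
have Hmerge : rbullet m.+1 n (fun u => merge_sum f (pi a :: u)) g s
    = - rbullet m.+1 n mulhd g s
      - rbullet m.+1 n (merge_sum (fun u => f (pi a :: u))) g s.
  rewrite -[in RHS]scaleN1r -[X in _ = _ + X]scaleN1r -rbulletZ -rbullet_linl.
  apply: rbullet_eq => // u.
  case: u => [//|d v] _; rewrite merge_sum_cons; module_ring.
rewrite !rbullet_cons wE Hcw DgE Hmerge map_cons.
(* For m = 0 the list [s] may be empty, so no second letter can be split off. *)
case: m IH Hf Hs Hs' Hmerge headP => [|m] IH Hf Hs Hs' _ _.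
  rewrite -/x !rbullet1 [merge_sum (fun u => f (_ :: u)) _]merge_sum_small;
    last first.
    by rewrite /= size_map size_drop Hs'; lia.
  rewrite /mulhd wE'.
  have -> : merge_sum (rbullet 1 n f g) (a :: s)
    = merge_sum (fun u => f ((g (take n u) : C) :: map pi (drop n u))) (a :: s).
    by apply: eq_merge_sum => u _; rewrite rbullet1.
  rewrite Head /rbullet big_ord0 !exprS.
  by case: (sign_cases K n) => ->; module_ring.
case: s Hs Hs' sz @x Hcw cE wE wE' Head DgE => [//|b t] Hs Hs' sz x Hcw cE wE
  wE' Head DgE.
(* Insertion into the first slot ([hd]) is separated from insertion into the later slots ([tl]), to
   which the induction hypothesis for [fun u => f (pi a :: u)] applies. *)
pose hd u := f ((g (take n u) : C) :: map pi (drop n u)).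
pose tl u := if u is c :: v then rbullet m.+1 n (fun u => f (pi c :: u)) g v
  else 0.
have -> : merge_sum (rbullet m.+2 n f g) (a :: b :: t)
    = merge_sum (fun u => hd u + (-1) ^+ n.+1 *: tl u) (a :: b :: t).
  by apply: eq_merge_sum => -[|c' u] // _; rewrite rbullet_cons.
rewrite merge_sum_lin Head merge_sum_cons.
rewrite (IH (fun u => f (pi a :: u)) (b :: t)) //; last exact: multilinear_cons.
(* The first term cancels the left outer face of [g] in [DgE], the second one the face of [tl] that
   multiplies [a] and [b]. *)
have -> : rbullet m.+2 n mulhd g (b :: t)
    = f (pi a * g (take n (b :: t)) :: map pi w)
      + (-1) ^+ n.+1 *: rbullet m.+1 n (fun u => f (pi (a * b) :: u)) g t.
  by rewrite rbullet_cons wE' rmorphM.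
rewrite -/x /=.
rewrite !exprS; case: (sign_cases K n) => ->; module_ring.
Qed.
End Insertion.

Section BulletLeibniz.
Variables (K : comPzRingType) (B C A : kalgType K).
Variables (pi : KAlgHom.type B C) (rho : KAlgHom.type C A) (tau : KAlgHom.type
  B A).
Hypothesis tauE : forall b, tau b = rho (pi b).
Implicit Types (f : seq C -> kmod A) (g : seq B -> kmod C) (s : seq B).

Lemma rbullet_mull m n f g (c : A) s :
  rbullet pi m n (fun u => c * (f u : A) : kmod A) g s
  = c * (rbullet pi m n f g s : A).
Proof. by rewrite [RHS]mulr_sumr; apply: eq_bigr => i _;
  rewrite kmod_scaleAr. Qed.

(** For the left outer face of [f], insertion into the slot of the acting letter produces a cup
    product, and insertion elsewhere leaves the action outside. [rbullet_lastr] is the mirror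
    image. *)
Lemma rbullet_headl m n f g a s :
  rbullet pi m.+1 n
    (fun u => rho (nth (0 : C) u 0) * (f (behead u) : A) : kmod A) g (a :: s)
  = rcup n (fun u => rho (g u) : kmod A) (fun u => f (map pi u)) (a :: s)
    + (-1) ^+ n.+1 *: (tau a * (rbullet pi m n f g s : A) : kmod A).
Proof. by rewrite rbullet_cons /= rbullet_mull tauE. Qed.

Lemma rbullet_lastr m n N f g s : size s = (m + n)%N -> (m + n)%N = N.+1 ->
  rbullet pi m.+1 n
    (fun u => (f (take m u) : A) * rho (nth (0 : C) u m) : kmod A) g s
  = ((rbullet pi m n f g (take N s) : A) * tau (nth (0 : B) s N) : kmod A)
    + (-1) ^+ (m * n.+1)%N *:
      rcup m (fun u => f (map pi u)) (fun u => rho (g u) : kmod A) s.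
Proof.
move=> Hs HN; case/lastP: s Hs => [|s z]; first by rewrite /= HN.
rewrite size_rcons HN => -[Hs]; rewrite /rbullet big_ord_recr /=;
  congr (_ + _ *: _).
  rewrite [RHS]mulr_suml; apply: eq_bigr => i _; have Him := ltn_ord i.
  have takeE k (u : seq B) y : (k <= size u)%N -> take k (rcons u y) = take k u.
    by move=> Hk; rewrite -cats1 takel_cat.
  have Hu : size (map pi (take i s) ++ (g (take n (drop i s)) : C)
                  :: map pi (drop (i + n) s)) = m.
    by rewrite size_cat /= !size_map size_drop size_takel ?Hs; lia.
  have dropE k : (k <= N)%N -> drop k (rcons s z) = rcons (drop k s) z.
    by move=> Hk; rewrite drop_rcons // Hs.
  rewrite kmod_scaleAl (dropE i) ?(dropE (i + n)%N); try lia.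
  rewrite (takeE i) ?(takeE N) ?(takeE n) ?size_drop ?Hs; try lia.
  rewrite map_rcons -rcons_cons -rcons_cat !nth_rcons Hu ltnn eqxx Hs ltnn eqxx.
  by rewrite -cats1 take_size_cat // tauE (@take_oversize _ N s) ?Hs.
have Hm : size (map pi (take m (rcons s z))) = m.
  by rewrite size_map size_takel // size_rcons Hs; lia.
rewrite (@drop_oversize _ (m + n)%N) ?size_rcons ?Hs ?HN // take_size_cat //
  nth_cat Hm ltnn subnn /=.
by rewrite [take n _]take_oversize // size_drop size_rcons Hs; lia.
Qed.

(** Gerstenhaber's formula. The inner faces are [merge_sum_rbullet]; the outer faces of the
    insertion are those of [f] except where the value of [g] is itself the acting letter, and these
    exceptions are the two cup products. Three algebras are allowed because the formula is used with
    the identity on either side of [pi]. *)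
Lemma rdiff_rbullet m n N f g s :
  multilinear m f -> size s = (m + n)%N -> (m + n)%N = N.+1 ->
  rdiff tau N (rbullet pi m n f g) s
  = rbullet pi m n.+1 f (rdiff pi n g) s
    + (-1) ^+ n.+1 *: rbullet pi m.+1 n (rdiff rho m f) g s
    - (-1) ^+ n.+1 *:
        rcup n (fun u => rho (g u) : kmod A) (fun u => f (map pi u)) s
    - (-1) ^+ (n + m * n)%N *:
        rcup m (fun u => f (map pi u)) (fun u => rho (g u) : kmod A) s.
Proof.
move=> Hf Hs HN; case: s Hs => [|a s] Hs; first by rewrite -Hs in HN.
have -> : rbullet pi m.+1 n (rdiff rho m f) g (a :: s)
    = rbullet pi m.+1 n (fun u =>
        ((rho (nth (0 : C) u 0) * (f (behead u) : A) : kmod A) + 1 *: merge_sum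
          f u)
        + (-1) ^+ m.+1 *: ((f (take m u) : A) * rho (nth (0 : C) u m) : kmod A))
        g (a :: s).
  apply: rbullet_eq => // [u Hu|]; last by rewrite Hs.
  by rewrite /rdiff hoch_diffE // scale1r.
rewrite !rbullet_linl rbullet_headl (rbullet_lastr _ _ Hs HN).
rewrite /rdiff hoch_diffE ?Hs // merge_sum_rbullet // -/(rdiff pi n g).
move: (rbullet pi m n.+1 _ _ _) (rbullet pi m.+1 n _ _ _) => P Q.
move: (rcup n _ _ _) (rcup m _ _ _) => R S /=.
move: (tau a * _) (_ * tau _) => T U.
rewrite -HN !(exprS, exprD, exprM, mulnS).
case: (sign_cases K m) => ->; case: (sign_cases K n) => ->;
  rewrite ?(expr1n, expr0); module_ring.
Qed.

End BulletLeibniz.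

(** With the identity as a K-algebra map, the operations on C(A,A) become the relative ones along
    [idfun]. *)
HB.instance Definition _ (K : pzRingType) (A : kalgType K) :=
  isKLinear.Build K A A idfun (fun k x => erefl (kunit k * x)).

(** * Multilinearity of cup and insertion products *)

Section SlotLinear.
Variables (K : comPzRingType) (B : kalgType K) (V : lmodType K).

(** The linearity half of [multilinear], without the vanishing on other lengths, so that it can be
    checked separately on the blocks of an argument list. *)
Definition slot_linear n (F : seq B -> V) : Prop :=
  forall (s t : seq B) (k : K) (a b : B), (size s + size t)%N.+1 = n ->
    F (s ++ kunit k * a + b :: t) = k *: F (s ++ a :: t) + F (s ++ b :: t).

Lemma slot_linear_split i j (F : seq B -> seq B -> V) :
  (forall v : seq B, size v = j -> slot_linear i (F^~ v)) ->
  (forall u : seq B, size u = i -> slot_linear j (F u)) ->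
  slot_linear (i + j) (fun s => F (take i s) (drop i s)).
Proof.
move=> Fi Fj s t k a b Hst; rewrite !take_cat !drop_cat.
case: ltnP => Hi.
  by rewrite Fj ?size_takel ?size_drop //; lia.
have [Ei|Hi'] := eqVneq (i - size s)%N 0%N.
  by rewrite Ei !take0 !drop0 cats0 (Fj s _ [::]) //=; lia.
have [l El] : exists l, (i - size s)%N = l.+1 by exists (i - size s).-1; lia.
by rewrite El /= Fi ?size_drop ?size_takel //=; lia.
Qed.

End SlotLinear.

Lemma slot_linear_map (K : comPzRingType) (B C : kalgType K) (V : lmodType K)
    (pi : KAlgHom.type C B) n (F : seq B -> V) :
  slot_linear n F -> slot_linear n (fun s => F (map pi s)).
Proof.
move=> HF s t k a b Hst.
by rewrite !map_cat /= rmorphD /= klinear HF // !size_map.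
Qed.

Section MultilinearOperations.
Variables (K : comPzRingType) (B A : kalgType K) (pi : KAlgHom.type B A).

Lemma multilinear_rcup m n (x y : seq B -> kmod A) :
  multilinear m x -> multilinear n y -> multilinear (m + n) (rcup m x y).
Proof.
move=> Hx Hy; split=> [s Hs|]; rewrite /rcup; last first.
  apply: (slot_linear_split (F := fun u v => (x u : A) * (y v : A) : kmod A)).
    move=> v _ s t k a b Hst.
    by rewrite -(kmod_scaleAl (A := A)) -mulrDl; congr (_ * _); exact: Hx.2.
  move=> u _ s t k a b Hst.
  by rewrite -(kmod_scaleAr (A := A)) -mulrDr; congr (_ * _); exact: Hy.2.
have [Hm|Hm] := ltnP (size s) m.
  rewrite (multilinear_size Hx) ?mul0r // take_oversize; lia.
by rewrite (multilinear_size Hy) ?mulr0 // size_drop; lia.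
Qed.

Lemma multilinear_rbullet (V : lmodType K) m n N (f : seq A -> V) (g : seq B ->
  kmod A) :
  multilinear m f -> multilinear n g -> (m + n)%N = N.+1 ->
  multilinear N (rbullet pi m n f g).
Proof.
move=> Hf Hg HN; split=> [s Hs|s t k a b Hst]; rewrite /rbullet.
  (* On a wrong length either [f] receives a wrong number of arguments, or [g] receives too few and
     puts a zero among the arguments of [f]. *)
  apply: big1 => i _; have Him := ltn_ord i.
  have [Hin|Hin] := leqP (i + n) (size s).
    rewrite (multilinear_size Hf) ?scaler0 //.
    by rewrite size_cat /= !size_map size_drop size_takel; lia.
  have [Hn|Hn] := posnP n.
    rewrite (multilinear_size Hf) ?scaler0 // size_cat /= !size_map size_drop.
    by rewrite take_oversize; lia.
  rewrite (multilinear_size Hg) ?(multilinear_zero _ _ Hf) ?scaler0 //.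
  by rewrite size_take size_drop; case: ifP; lia.
rewrite scaler_sumr -big_split; apply: eq_bigr => i _ /=; have Him := ltn_ord i.
rewrite scalerA [k * _]mulrC -scalerA -scalerDr; congr (_ *: _).
have Ni : N = (i + (n + (m.-1 - i)))%N by lia.
rewrite [(i + n)%N]addnC -!drop_drop.
apply: (slot_linear_split (F := fun u v => f (map pi u ++ (g (take n v) : A)
          :: map pi (drop n v))) (i := i) (j := n + (m.-1 - i)));
            last by rewrite -Ni.
  move=> v Hv {}s {}t {}k {}a {}b {}Hst.
  rewrite !map_cat /= rmorphD /= klinear -!catA !cat_cons; apply: Hf.2.
  by rewrite size_cat /= !size_map size_drop; lia.
move=> u Hu.
apply: (slot_linear_split (F := fun v w => f (map pi u ++ (g v : A) :: map pi
  w))).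
  move=> v Hv {}s {}t {}k {}a {}b {}Hst.
  have Huv : (size (map pi u) + size (map pi v))%N.+1 = m.
    by rewrite !size_map Hu Hv; lia.
  rewrite Hg.2 //.
  exact: (Hf.2 (map pi u) (map pi v) k (g (s ++ a :: t)) (g (s ++ b :: t)) Huv).
move=> v Hv; apply: (@slot_linear_map _ _ _ _ pi _ (fun w => f (map pi u ++ (g
  v : A) :: w))).
move=> {}s {}t {}k {}a {}b {}Hst; rewrite -!cat_cons !catA; apply: Hf.2.
by rewrite size_cat /= size_map; lia.
Qed.

End MultilinearOperations.

Lemma bulletE (K : comPzRingType) (A : kalgType K) m n (f g : cochain A) s :
  bullet m n f g s = rbullet idfun m n f g s.
Proof. by apply: eq_bigr => i _; rewrite !map_id. Qed.

Lemma rbullet_comp (K : comPzRingType) (B C : kalgType K) (V W : lmodType K)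
    (pi : KAlgHom.type B C) (e : V -> W) m n (f : seq C -> V) (g : seq B ->
      kmod C) s :
  {morph e : x y / x + y} ->
  e (rbullet pi m n f g s) = rbullet pi m n (fun u => e (f u)) g s.
Proof.
by move=> eD; rewrite morph_add_sum //; apply: eq_bigr => i _;
  rewrite morph_add_sign.
Qed.

Lemma rbullet0 (K : comPzRingType) (B C : kalgType K) (V : lmodType K)
    (pi : KAlgHom.type B C) m n (f : seq C -> V) (g : seq B -> kmod C) s :
  (forall u, size u = m -> f u = 0) -> (size s).+1 = (m + n)%N ->
  rbullet pi m n f g s = 0.
Proof.
move=> f0 Hs; have -> : rbullet pi m n f g s = rbullet pi m n (fun=> 0) g s.
  exact: rbullet_eq.
by apply: big1 => i _; rewrite scaler0.
Qed.

(** * Coboundaries of C(B,A) and compatible cochains *)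

Section Coboundary.
Variables (K : comPzRingType) (B A : kalgType K) (pi : KAlgHom.type B A).
Implicit Types (x y : seq B -> kmod A) (f : cochain B) (g : cochain A).

(* Only the values on sequences of length n matter. *)
Definition rcoboundary n x : Prop :=
  match n with
  | 0 => forall s : seq B, size s = 0%N -> x s = 0
  | p.+1 => exists2 h : seq B -> kmod A, multilinear p h &
      forall s : seq B, size s = p.+1 -> x s = rdiff pi p h s
  end.

Lemma rdiff_lin n x y k (s : seq B) :
  rdiff pi n (fun u => x u + k *: y u) s = rdiff pi n x s + k *: rdiff pi n y s.
Proof.
have [Hs|Hs] := eqVneq (size s) n.+1; last first.
  by rewrite /rdiff !hoch_diff_size // scaler0 addr0.
rewrite /rdiff !hoch_diffE // merge_sum_lin.
have -> : pi (nth (0 : B) s 0) * ((x (behead s) + k *: y (behead s) : kmod A) : A)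
   = (pi (nth (0 : B) s 0) * x (behead s) : kmod A)
     + k *: (pi (nth (0 : B) s 0) * y (behead s) : kmod A).
  by rewrite -kmod_scaleAr -mulrDr.
have -> : ((x (take n s) + k *: y (take n s) : kmod A) : A) * pi (nth (0 : B) s n)
   = ((x (take n s) : A) * pi (nth (0 : B) s n) : kmod A)
     + k *: ((y (take n s) : A) * pi (nth (0 : B) s n) : kmod A).
  by rewrite -kmod_scaleAl -mulrDl.
module_ring.
Qed.

Lemma rdiff0 n (s : seq B) : rdiff pi n (fun=> 0) s = 0.
Proof.
have [Hs|Hs] := eqVneq (size s) n.+1; last by rewrite /rdiff hoch_diff_size.
by rewrite /rdiff hoch_diffE // merge_sum0 mulr0 mul0r scaler0 !addr0.
Qed.

Lemma rdiffZ n x k (s : seq B) :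
  rdiff pi n (fun u => k *: x u) s = k *: rdiff pi n x s.
Proof.
have := rdiff_lin n (fun=> 0) x k s; rewrite rdiff0 add0r => <-.
by congr (rdiff _ _ _ _); apply: funext => u; rewrite add0r.
Qed.

Lemma rcoboundaryZ n x k : rcoboundary n x -> rcoboundary n (fun s => k *: x s).
Proof.
case: n => [|p] /=; first by move=> Hx s Hs; rewrite Hx // scaler0.
move=> [h Hh xE]; exists (fun s => k *: h s); first exact: multilinear_scale.
by move=> s Hs; rewrite rdiffZ xE.
Qed.

Lemma rcoboundary_lin n x y k :
  rcoboundary n x -> rcoboundary n y -> rcoboundary n (fun s => x s + k *: y s).
Proof.
case: n => [|p] /=; first by move=> Hx Hy s Hs; rewrite Hx ?Hy // scaler0 addr0.
move=> [h Hh xE] [h' Hh' yE]; exists (fun s => h s + k *: h' s).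
  exact: multilinear_addZ.
by move=> s Hs; rewrite rdiff_lin xE // yE.
Qed.

Lemma rcoboundary_eq n x y :
  (forall s : seq B, size s = n -> x s = y s) -> rcoboundary n x ->
    rcoboundary n y.
Proof.
case: n => [|p] /= xy; first by move=> H s Hs; rewrite -xy ?H.
by move=> [h Hh xE]; exists h => // s Hs; rewrite -xy ?xE.
Qed.

(* f and g become cohomologous as cochains of B with values in A *)
Definition compatible n f g : Prop :=
  rcoboundary n (fun s => (pi (f s) : kmod A) - g (map pi s)).

Lemma hh_diffE (C : kalgType K) n (f : cochain C) : hh_diff n f = rdiff idfun n f.
Proof. by []. Qed.

Lemma cocycle_rdiff (C : kalgType K) n (f : cochain C) (s : seq C) : is_cocycle
  n f ->
  rdiff idfun n f s = 0.
Proof. by case=> _ H; rewrite -hh_diffE H. Qed.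

Lemma pi_morph : {morph (pi : kmod B -> kmod A) : a b / a + b}.
Proof. exact: rmorphD. Qed.

Lemma rdiff_pi n f (s : seq B) :
  rdiff pi n (fun u => pi (f u)) s = pi (rdiff idfun n f s).
Proof.
have [Hs|Hs] := eqVneq (size s) n.+1; last first.
  by rewrite /rdiff !hoch_diff_size // rmorph0.
rewrite /rdiff !hoch_diffE // !pi_morph.
by rewrite (merge_sum_additive _ _ pi_morph) (morph_add_sign _ _ pi_morph)
  !rmorphM.
Qed.

Lemma rdiff_map n g (s : seq B) :
  rdiff pi n (fun u => g (map pi u)) s = rdiff idfun n g (map pi s).
Proof. exact: (hoch_diff_map pi). Qed.
End Coboundary.

Lemma bracketE (K : comPzRingType) (A : kalgType K) m n (f g : cochain A) s :
  bracket m n f g s = bullet m n f g s - (-1) ^+ (m.+1 * n.+1) *: bullet n m g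
    f s.
Proof. by []. Qed.

Lemma bullet0 (K : comPzRingType) (A : kalgType K) n (f g : cochain A) s :
  bullet 0 n f g s = 0.
Proof. by rewrite /bullet big_ord0. Qed.

(** Graded antisymmetry holds already for cochains; it reduces brackets with a left argument of
    degree 0 to those with a right one. *)
Lemma bracketC (K : comPzRingType) (A : kalgType K) m n (f g : cochain A) s :
  bracket m n f g s = - (-1) ^+ (m.+1 * n.+1) *: bracket n m g f s.
Proof.
rewrite !bracketE (mulnC n.+1).
by case: (sign_cases K (m.+1 * n.+1)) => ->; module_ring.
Qed.

(** * Compatibility is preserved by the operations *)

Section Bracket.
Variables (K : comPzRingType) (B A : kalgType K) (pi : KAlgHom.type B A).
Implicit Types (h x y : seq B -> kmod A) (f : cochain B) (g : cochain A).

Local Notation idB := (idfun : KAlgHom.type B B).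
Local Notation idA := (idfun : KAlgHom.type A A).
Let pig g : seq B -> kmod A := fun u => g (map pi u).
Let pif f : seq B -> kmod A := fun u => pi (f u).

(** First pi f is replaced by g pi + x, then, inside g, pi f' by g' pi + x'. The second replacement
    uses that g is additive in each slot. *)
Lemma bullet_defect m n f f' g g' x x' (s : seq B) :
  multilinear m g ->
  (forall u : seq B, size u = m -> pi (f u) = pig g u + x u) ->
  (forall u : seq B, size u = n -> pi (f' u) = pig g' u + x' u) ->
  (size s).+1 = (m + n)%N ->
  pi (bullet m n f f' s)
  = bullet m n g g' (map pi s) + (rbullet pi m n g x' s + rbullet idB m n x f' s).
Proof.
move=> Hg fE f'E Hs.
rewrite !bulletE (rbullet_comp idB (e := pi : kmod B -> kmod A));
  last exact: pi_morph.
have -> : rbullet idB m n (fun u => pi (f u) : kmod A) f' s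
    = rbullet idB m n (fun u => pig g u + 1 *: x u) f' s.
  by apply: rbullet_eq => // u Hu; rewrite scale1r fE.
rewrite rbullet_linl scale1r addrA; congr (_ + _).
have -> : rbullet idB m n (pig g) f' s = rbullet pi m n g (pif f') s.
  by apply: eq_bigr => i _; rewrite /pig map_cat /= !map_id.
have -> : rbullet pi m n g (pif f') s = rbullet pi m n g (fun u => pig g' u +
  x' u) s.
  by apply: rbullet_eq => // u Hu; exact: f'E.
rewrite rbullet_addr //; congr (_ + _); apply: eq_bigr => i _.
by rewrite !map_id /pig !map_take !map_drop.
Qed.

(** [rdiff_rbullet] solved for g o dh, where dg = 0. The next lemma does the same for dh o f, where
    df = 0. *)
Lemma rbullet_coboundaryl m q N g h (s : seq B) :
  is_cocycle m g -> (m + q)%N = N.+1 -> size s = N.+1 ->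
  rbullet pi m q.+1 g (rdiff pi q h) s
  = rdiff pi N (rbullet pi m q g h) s
    + (-1) ^+ q.+1 *: rcup q h (pig g) s
    + (-1) ^+ (q + m * q)%N *: rcup m (pig g) h s.
Proof.
move=> Hg HN Hs; rewrite -HN in Hs.
rewrite (@rdiff_rbullet _ _ _ _ pi idA pi (fun=> erefl) _ _ _ _ h _ Hg.1 Hs HN).
have -> : rbullet pi m.+1 q (rdiff idA m g) h s = 0.
  by apply: rbullet0; [move=> u _; exact: cocycle_rdiff | rewrite Hs].
rewrite -/(pig g); move: (rcup q _ _ s) (rcup m _ _ s) => a b; module_ring.
Qed.

Lemma rbullet_coboundaryr p n N f h (s : seq B) :
  is_cocycle n f -> multilinear p h -> (p + n)%N = N.+1 -> size s = N.+1 ->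
  rbullet idB p.+1 n (rdiff pi p h) f s
  = (-1) ^+ n.+1 *: rdiff pi N (rbullet idB p n h f) s
    + rcup n (pif f) h s - (-1) ^+ (p * n)%N *: rcup p h (pif f) s.
Proof.
move=> Hf Hh HN Hs; rewrite -HN in Hs.
rewrite (@rdiff_rbullet _ _ _ _ idB pi pi (fun=> erefl) _ _ _ _ f _ Hh Hs HN).
have -> : rbullet idB p n.+1 h (rdiff idB n f) s = 0.
  rewrite /rbullet; apply: big1 => i _.
  by rewrite cocycle_rdiff // (multilinear_zero _ _ Hh) scaler0.
have -> : rcup p (fun u => h (map idB u)) (fun u => pi (f u) : kmod A) s
  = rcup p h (pif f) s.
  by rewrite /rcup map_id.
have -> : rcup n (fun u => pi (f u) : kmod A) (fun u => h (map idB u)) s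
  = rcup n (pif f) h s.
  by rewrite /rcup map_id.
move: (rcup p _ _ s) (rcup n _ _ s) (rbullet _ _ _ _ _ s) => a b c.
rewrite !(exprS, exprD).
by case: (sign_cases K n) => ->; module_ring.
Qed.

Lemma rcup_addl m x x' y (s : seq B) k :
  rcup m (fun u => x u + k *: x' u) y s = rcup m x y s + k *: rcup m x' y s.
Proof. by rewrite /rcup -kmod_scaleAl -mulrDl. Qed.

Lemma rcup_addr m x y y' (s : seq B) k :
  rcup m x (fun u => y u + k *: y' u) s = rcup m x y s + k *: rcup m x y' s.
Proof. by rewrite /rcup -kmod_scaleAr -mulrDr. Qed.

Lemma rcup_eq m n x x' y y' (s : seq B) : size s = (m + n)%N ->
  (forall u : seq B, size u = m -> x u = x' u) ->
  (forall u : seq B, size u = n -> y u = y' u) -> rcup m x y s = rcup m x' y' s.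
Proof.
move=> Hs xE yE; rewrite /rcup xE ?yE // ?size_takel ?size_drop ?Hs ?addKn //.
exact: leq_addr.
Qed.

Lemma compatibleP p f g : compatible pi p.+1 f g ->
  exists2 h, multilinear p h &
    forall u : seq B, size u = p.+1 -> pi (f u) = pig g u + rdiff pi p h u.
Proof.
move=> [h Hh fgE]; exists h => // u Hu; rewrite -fgE //.
by rewrite [pig g u + _]addrC subrK.
Qed.

Lemma compatible0 f g : compatible pi 0 f g -> pi (f [::]) = g [::].
Proof. by move=> /(_ [::] erefl) /eqP; rewrite subr_eq0 => /eqP. Qed.

(** The defect consists of boundaries and of cup products of h with g' pi and pi f', and of h' with
    g pi and pi f. After pi f = g pi + dh and pi f' = g' pi + dh' the products with g and g' cancel
    between the two halves of the bracket, and the products of h with dh' and of h' with dh are the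
    Leibniz expansions of h' u h and h u h'. *)
Lemma compatible_bracket_pos p q f f' g g' :
  is_cocycle p.+1 f -> is_cocycle q.+1 f' -> is_cocycle p.+1 g ->
    is_cocycle q.+1 g' ->
  compatible pi p.+1 f g -> compatible pi q.+1 f' g' ->
  compatible pi (p + q).+1 (bracket p.+1 q.+1 f f') (bracket p.+1 q.+1 g g').
Proof.
move=> Hf Hf' Hg Hg' /compatibleP [h Hh fE] /compatibleP [h' Hh' f'E].
(* The primitive: [c1] to [c4] are the insertions whose boundaries appear in g o dh', dh o f', g' o
   dh and dh' o f; [c5] and [c6] absorb the remaining cup products. *)
pose c1 := rbullet pi p.+1 q g h'; pose c2 := rbullet idB p q.+1 h f'.
pose c3 := rbullet pi q.+1 p g' h; pose c4 := rbullet idB q p.+1 h' f.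
pose c5 := rcup q h' h; pose c6 := rcup p h h'.
pose N := (p + q)%N.
pose sg := (-1) ^+ (p.+2 * q.+2) : K.
exists (fun s => c1 s + (-1) ^+ q *: c2 s + (- sg) *: c3 s
   + (- sg * (-1) ^+ p) *: c4 s + 1 *: c5 s
   + (-1) ^+ (p.+1 * q.+1 + p.+1 + q.+1) *: c6 s).
  repeat apply: multilinear_addZ; do ?[by apply: multilinear_rbullet;
    [exact: Hg.1 || exact: Hg'.1 || done|exact: Hf.1 || exact: Hf'.1 ||
      done|rewrite /N; lia]].
    by rewrite addnC; exact: multilinear_rcup.
  exact: multilinear_rcup.
move=> s Hs; rewrite !rdiff_lin.
have Hs2 : size s = (q + p).+1 by rewrite Hs addnC.
have szl : (size s).+1 = (p.+1 + q.+1)%N by rewrite Hs; lia.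
have szr : (size s).+1 = (q.+1 + p.+1)%N by rewrite Hs; lia.
have -> : (pi (bracket p.+1 q.+1 f f' s) : kmod A) - bracket p.+1 q.+1 g g'
  (map pi s)
   = ((pi (bullet p.+1 q.+1 f f' s) : kmod A) - bullet p.+1 q.+1 g g' (map pi s))
     - sg *: ((pi (bullet q.+1 p.+1 f' f s) : kmod A) - bullet q.+1 p.+1 g' g
       (map pi s)).
  have -> : (pi (bracket p.+1 q.+1 f f' s) : kmod A)
      = (pi (bullet p.+1 q.+1 f f' s) : kmod A) - sg *: (pi (bullet q.+1 p.+1
        f' f s) : kmod A).
    rewrite -(morph_add_sign _ _ (@pi_morph _ _ _ pi)); exact: rmorphB.
  have -> : bracket p.+1 q.+1 g g' (map pi s)
      = bullet p.+1 q.+1 g g' (map pi s) - sg *: bullet q.+1 p.+1 g' g (map pi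
        s) by [].
  module_ring.
rewrite (bullet_defect Hg.1 fE f'E szl) (bullet_defect Hg'.1 f'E fE szr).
have e1 : (p.+1 + q)%N = (p + q).+1 by lia.
have e2 : (p + q.+1)%N = (p + q).+1 by lia.
have e3 : (q.+1 + p)%N = (p + q).+1 by lia.
have e4 : (q + p.+1)%N = (p + q).+1 by lia.
rewrite (rbullet_coboundaryl _ Hg e1 Hs) (rbullet_coboundaryr Hf' Hh e2 Hs).
rewrite (rbullet_coboundaryl _ Hg' e3 Hs) (rbullet_coboundaryr Hf Hh' e4 Hs).
have s1 : size s = (q.+1 + p)%N by lia.
have s2 : size s = (p + q.+1)%N by lia.
have s3 : size s = (p.+1 + q)%N by lia.
have s4 : size s = (q + p.+1)%N by lia.
have pifE u : size u = p.+1 -> pif f u = pig g u + 1 *: rdiff pi p h u.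
  by move=> Hu; rewrite scale1r -fE.
have pifE' u : size u = q.+1 -> pif f' u = pig g' u + 1 *: rdiff pi q h' u.
  by move=> Hu; rewrite scale1r -f'E.
rewrite (rcup_eq (y' := h) s1 pifE') // (rcup_eq (x' := h) s2 _ pifE') //.
rewrite (rcup_eq (y' := h') s3 pifE) // (rcup_eq (x' := h') s4 _ pifE) //.
rewrite !rcup_addl !rcup_addr (@rdiff_rcup _ _ _ _ p q) //.
have -> : rdiff pi (p + q) c5 s
    = rcup q.+1 (rdiff pi q h') h s + (-1) ^+ q *: rcup q h' (rdiff pi p h) s.
  by rewrite [(p + q)%N]addnC rdiff_rcup.
move: (rdiff pi _ c1 s) (rdiff pi _ c2 s) (rdiff pi _ c3 s) (rdiff pi _ c4 s)
  => d1 d2 d3 d4.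
move: (bullet _ _ g g' _) (bullet _ _ g' g _) => b1 b2.
move: (rcup q h' (pig g) s) (rcup q h' (rdiff pi p h) s) => r1 r2.
move: (rcup p h (pig g') s) (rcup p h (rdiff pi q h') s) => r3 r4.
move: (rcup p.+1 (pig g) h' s) (rcup p.+1 (rdiff pi p h) h' s) => r5 r6.
move: (rcup q.+1 (pig g') h s) (rcup q.+1 (rdiff pi q h') h s) => r7 r8.
rewrite /sg !(mulSn, mulnS) (mulnC q p) !(exprS, exprD, exprM).
case: (sign_cases K p) => ->; case: (sign_cases K q) => ->;
  rewrite ?(expr1n, expr0); try (case: (sign_cases K q) => ->); module_ring.
Qed.

(** In degree 0 compatibility is the equality pi f' = g', so the defect is dh o f' alone; its cup
    products cancel because f' becomes central in A. *)
Lemma compatible_bracket0r p f f' g g' :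
  is_cocycle p.+1 f -> is_cocycle 0 f' -> is_cocycle p.+1 g -> is_cocycle 0 g' ->
  compatible pi p.+1 f g -> compatible pi 0 f' g' ->
  compatible pi p (bracket p.+1 0 f f') (bracket p.+1 0 g g').
Proof.
move=> Hf Hf' Hg Hg' /compatibleP [h Hh fE] /compatible0 f'E.
pose X (s : seq B) := rbullet idB p.+1 0 (rdiff pi p h) f' s.
apply: (rcoboundary_eq (x := X)) => [s Hs|].
  have f'0 u : size u = 0%N -> pi (f' u) = pig g' u + (fun=> 0 : kmod A) u.
    by case: u => // _; rewrite addr0.
  rewrite !bracketE !bullet0 !scaler0 !subr0 (bullet_defect Hg.1 fE f'0) ?Hs
    ?addn0 //.
  rewrite [rbullet pi _ _ _ _ _]big1 => [|i _]; last first.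
    by rewrite (multilinear_zero _ _ Hg.1) scaler0.
  by rewrite add0r [X in _ = X - _]addrC addrK.
(* That the element commutes with all of A, and not only with the image of B, comes from g' being a
   cocycle of A. *)
have central a : pi (f' [::]) * a = a * pi (f' [::]).
  have := cocycle_rdiff [:: a] Hg'.
  rewrite /rdiff hoch_diffE // merge_sum_small // addr0 expr1 scaleN1r f'E.
  by move=> /eqP; rewrite subr_eq0 => /eqP.
(* For p = 0 the target degree is 0 and the defect, a commutator with the central element, has to
   vanish exactly. *)
case: p Hf Hg h Hh fE @X => [|p] Hf Hg h Hh fE X.
  case=> // _; rewrite /X rbullet1 /rdiff hoch_diffE // merge_sum_small //=.
  rewrite addr0 expr1 scaleN1r; apply/eqP; rewrite subr_eq0; apply/eqP.
  exact: central.
exists (fun s => (-1) *: rbullet idB p.+1 0 h f' s).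
  exact/multilinear_scale/(multilinear_rbullet idB Hh Hf'.1 (addn0 p.+1)).
move=> s Hs; rewrite /X (rbullet_coboundaryr Hf' Hh (addn0 p.+1) Hs) rdiffZ.
rewrite expr1 muln0 expr0 scale1r /rcup take0 drop0.
rewrite drop_oversize ?Hs // take_oversize ?Hs // /pif central.
by rewrite -addrA subrr addr0.
Qed.

Lemma compatible_bracket m n f f' g g' :
  is_cocycle m f -> is_cocycle n f' -> is_cocycle m g -> is_cocycle n g' ->
  compatible pi m f g -> compatible pi n f' g' ->
  compatible pi (m + n).-1 (bracket m n f f') (bracket m n g g').
Proof.
case: m => [|p]; case: n => [|q] Hf Hf' Hg Hg' Hfg Hfg'.
- by case=> // _; rewrite !bracketE !bullet0 !scaler0 !subrr rmorph0 subrr.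
- have := compatible_bracket0r Hf' Hf Hg' Hg Hfg' Hfg.
  move=> /(rcoboundaryZ (- (-1) ^+ (1 * q.+2))); apply: rcoboundary_eq => s _.
  rewrite !(bracketC 0) scalerBr; congr (_ - _).
  rewrite !scaleNr.
  by rewrite -(morph_add_sign _ _ (@pi_morph _ _ _ pi)); exact/esym/rmorphN.
- by rewrite addn0; exact: compatible_bracket0r.
by rewrite addSn addnS; exact: compatible_bracket_pos.
Qed.

(** Now h has odd degree, and the cup products in g o dh + dh o f add up to (pi f - g pi) u h - h u
    (pi f - g pi), that is dh u h - h u dh = d(h u h). *)
Lemma compatible_bullet_even m f g : ~~ odd m ->
  is_cocycle m f -> is_cocycle m g -> compatible pi m f g ->
  compatible pi (m + m).-1 (bullet m m f f) (bullet m m g g).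
Proof.
case: m => [_ _ _ _ s _|p]; first by rewrite !bullet0 rmorph0 subrr.
move=> m_even Hf Hg /compatibleP [h Hh fE]; rewrite addSn addnS.
have p_odd : odd p = true by move: m_even; rewrite [odd _]/= negbK.
pose c1 := rbullet pi p.+1 p g h; pose c2 := rbullet idB p p.+1 h f.
exists (fun s => c1 s + (-1) *: c2 s + 1 *: rcup p h h s).
  repeat apply: multilinear_addZ.
  - by apply: multilinear_rbullet => //; exact: Hg.1.
  - by apply: multilinear_rbullet; [|exact: Hf.1|rewrite addnS].
  - exact: multilinear_rcup.
move=> s Hs; rewrite !rdiff_lin.
have szl : (size s).+1 = (p.+1 + p.+1)%N by rewrite Hs; lia.
have e1 : (p.+1 + p)%N = (p + p).+1 by lia.
have e2 : (p + p.+1)%N = (p + p).+1 by lia.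
have s1 : size s = (p.+1 + p)%N by lia.
have s2 : size s = (p + p.+1)%N by lia.
have pifE u : size u = p.+1 -> pif f u = pig g u + 1 *: rdiff pi p h u.
  by move=> Hu; rewrite scale1r -fE.
rewrite (bullet_defect Hg.1 fE fE szl).
rewrite (rbullet_coboundaryl _ Hg e1 Hs) (rbullet_coboundaryr Hf Hh e2 Hs).
rewrite (rcup_eq (y' := h) s1 pifE) // (rcup_eq (x' := h) s2 _ pifE) //.
rewrite rcup_addl rcup_addr (@rdiff_rcup _ _ _ _ p p) // -/c1 -/c2.
have sp : (-1) ^+ p = -1 :> K by rewrite -signr_odd p_odd.
have spp : (-1) ^+ (p * p) = -1 :> K by rewrite exprM sp -signr_odd p_odd.
move: (bullet _ _ g g _) (rdiff pi _ c1 s) (rdiff pi _ c2 s) => b d1 d2.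
move: (rcup p h _ s) (rcup p h _ s) (rcup p.+1 _ h s) (rcup p.+1 _ h s) => r1
  r2 r3 r4.
rewrite !(mulSn, mulnS) !(exprS, exprD) sp spp; module_ring.
Qed.

Lemma rcoboundary0 n x : (forall s : seq B, x s = 0) -> rcoboundary pi n x.
Proof.
case: n => [|n] x0; first by move=> s _.
by exists (fun=> 0); [exact: multilinear0|move=> s _; rewrite rdiff0].
Qed.

Lemma rcoboundary_rcupl m n x y : multilinear n y ->
  (forall s, rdiff pi n y s = 0) ->
  rcoboundary pi m x -> rcoboundary pi (m + n) (rcup m x y).
Proof.
move=> Hy dy; case: m => [x0|p [h Hh xE]].
  by apply: rcoboundary0 => s; rewrite /rcup take0 x0 // mul0r.
exists (rcup p h y); first exact: multilinear_rcup.
move=> s Hs; rewrite rdiff_rcup // [X in _ + _ *: X]/rcup dy mulr0 scaler0 addr0.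
exact: (rcup_eq (m := p.+1) Hs xE (fun u _ => erefl (y u))).
Qed.

Lemma rcoboundary_rcupr m n x y : multilinear m x ->
  (forall s, rdiff pi m x s = 0) ->
  rcoboundary pi n y -> rcoboundary pi (m + n) (rcup m x y).
Proof.
move=> Hx dx; case: n => [y0|q [h Hh yE]].
  apply: (rcoboundary_eq (x := fun=> 0)) => [s Hs|]; last exact: rcoboundary0.
  by rewrite /rcup y0 ?mulr0 // size_drop Hs addn0 subnn.
rewrite addnS; exists (fun s => (-1) ^+ m *: rcup m x h s).
  exact/multilinear_scale/multilinear_rcup.
move=> s Hs; rewrite rdiffZ rdiff_rcup // [X in _ *: (X + _)]/rcup dx mul0r add0r.
rewrite scalerA -exprD addnn -mul2n exprM sqrrN !expr1n scale1r.
by rewrite -addnS in Hs; exact: (rcup_eq (n :=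
  q.+1) Hs (fun u _ => erefl (x u)) yE).
Qed.

Lemma multilinear_pi n f : multilinear n f -> multilinear n (pif f).
Proof.
move=> Hf; have pilin k a b : (pi (k *: (a : kmod B) + b) : kmod A)
  = k *: (pi a : kmod A) + pi b.
  by rewrite pi_morph; congr (_ + _); exact: klinear.
have := multilinear_comp idB pilin Hf.
by congr multilinear; apply: funext => s; rewrite map_id.
Qed.

Lemma multilinear_map n g : multilinear n g -> multilinear n (pig g).
Proof. exact: (multilinear_comp pi (V := kmod A) (W := kmod A) (f := id)). Qed.

(** The defect is (pi f - g pi) u pi f' + g pi u (pi f' - g' pi): in each term a coboundary is
    multiplied by a cocycle. *)
Lemma compatible_cup m n f f' g g' :
  is_cocycle m f -> is_cocycle n f' -> is_cocycle m g -> is_cocycle n g' ->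
  compatible pi m f g -> compatible pi n f' g' ->
  compatible pi (m + n) (cup m f f') (cup m g g').
Proof.
move=> Hf Hf' Hg Hg' Hfg Hfg'.
have Hpf := multilinear_pi Hf'.1; have Hpg := multilinear_map Hg.1.
have H1 := rcoboundary_rcupl Hpf _ Hfg.
have H2 := rcoboundary_rcupr Hpg _ Hfg'.
apply: rcoboundary_eq (rcoboundary_lin 1 (H1 _) (H2 _)) => [s Hs|s|s].
- rewrite scale1r /rcup /cup /pif /pig rmorphM -map_take -map_drop.
  by rewrite mulrBl mulrBr addrA subrK.
- by rewrite rdiff_pi cocycle_rdiff // rmorph0.
- by rewrite rdiff_map cocycle_rdiff.
Qed.

Lemma coboundary_pi n f : is_coboundary n f -> rcoboundary pi n (pif f).
Proof.
case: n => [-> s _|n [h Hh ->]]; first exact: rmorph0.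
by exists (pif h); [exact: multilinear_pi|move=> s _; rewrite rdiff_pi].
Qed.

Lemma coboundary_map n g : is_coboundary n g -> rcoboundary pi n (pig g).
Proof.
case: n => [-> s _|n [h Hh ->]] //.
by exists (pig h); [exact: multilinear_map|move=> s _; rewrite rdiff_map].
Qed.

Lemma compatible_coboundary n f f' g g' :
  is_coboundary n (f - f') -> is_coboundary n (g - g') ->
  compatible pi n f g -> compatible pi n f' g'.
Proof.
move=> /coboundary_pi Hf /coboundary_map Hg H.
apply: rcoboundary_eq (rcoboundary_lin 1 (rcoboundary_lin (-1) H Hf) Hg) => s _.
have -> : pif (f - f') s = (pi (f s) : kmod A) - pi (f' s) by exact: rmorphB.
have -> : pig (g - g') s = g (map pi s) - g' (map pi s) by [].
module_ring.
Qed.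

Lemma compatible_lin n k f f' g g' :
  compatible pi n f g -> compatible pi n f' g' ->
  compatible pi n (k *: f + f') (k *: g + g').
Proof.
move=> H H'; apply: rcoboundary_eq (rcoboundary_lin k H' H) => s _.
rewrite !cochain_linE pi_morph.
have -> : pi (k *: f s) = k *: (pi (f s) : kmod A) by exact: klinear.
module_ring.
Qed.

End Bracket.

(** * The operations map cocycles to cocycles *)

Section Cocycles.
Variables (K : comPzRingType) (A : kalgType K).
Implicit Types (f g : cochain A) (s : seq A).
Local Notation idA := (idfun : KAlgHom.type A A).

Lemma multilinear_bullet m n N f g : multilinear m f -> multilinear n g ->
  (m + n)%N = N.+1 -> multilinear N (bullet m n f g : cochain A).
Proof.
move=> Hf Hg HN; have := multilinear_rbullet idA Hf Hg HN.
by congr multilinear; apply: funext => s; rewrite bulletE.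
Qed.

Lemma is_cocycleP n f : multilinear n f ->
  (forall s, size s = n.+1 -> rdiff idA n f s = 0) -> is_cocycle n f.
Proof.
move=> Hf df; split=> //; apply: funext => s.
have [Hs|Hs] := eqVneq (size s) n.+1; first exact: df.
exact: hoch_diff_size.
Qed.

(** For cocycles only the two cup products of [rdiff_rbullet] survive. They cancel after
    antisymmetrization in the bracket, and against each other when f = g has even degree. *)
Lemma rdiff_bullet m n N f g s :
  is_cocycle m f -> is_cocycle n g -> (m + n)%N = N.+1 -> size s = N.+1 ->
  rdiff idA N (bullet m n f g) s
  = - (-1) ^+ n.+1 *: rcup n g f s - (-1) ^+ (n + m * n)%N *: rcup m f g s.
Proof.
move=> Hf Hg HN Hs; have Hs' := Hs; rewrite -HN in Hs'.
have -> : bullet m n f g = rbullet idA m n f g by apply: funext => u;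
  rewrite bulletE.
rewrite (@rdiff_rbullet _ _ _ _ idA idA idA (fun=> erefl) _ _ _ _ g _ Hf.1 Hs'
  HN).
rewrite [rbullet _ m.+1 n _ _ _]rbullet0 ?Hs' // => [|u _];
  last exact: cocycle_rdiff.
rewrite [rbullet _ _ _ _ _ _]big1 => [|i _]; last first.
  by rewrite cocycle_rdiff // (multilinear_zero _ _ Hf.1) scaler0.
rewrite /rcup !map_id /=; move: (_ * f _) (_ * g _) => a b; module_ring.
Qed.

Lemma cocycle_bracket m n f g : is_cocycle m f -> is_cocycle n g ->
  is_cocycle (m + n).-1 (bracket m n f g).
Proof.
move=> Hf Hg; case E: (m + n)%N => [|N].
  have [-> ->] : m = 0%N /\ n = 0%N by lia.
  have -> : bracket 0 0 f g = 0.
    by apply: funext => s; rewrite bracketE !bullet0 scaler0 subrr.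
  apply: is_cocycleP => [|s _]; [exact: multilinear0|exact: rdiff0].
have E' : (n + m)%N = N.+1 by rewrite addnC.
apply: is_cocycleP => [|s Hs].
  have := multilinear_addZ (- (-1) ^+ (m.+1 * n.+1))
    (multilinear_bullet Hf.1 Hg.1 E) (multilinear_bullet Hg.1 Hf.1 E').
  by congr multilinear; apply: funext => s; rewrite bracketE scaleNr.
have := rdiff_lin idA N (bullet m n f g) (bullet n m g f) (- (-1) ^+ (m.+1 *
  n.+1)) s.
have -> : (fun u => bullet m n f g u + - (-1) ^+ (m.+1 * n.+1) *: bullet n m g
  f u)
    = bracket m n f g by apply: funext => u; rewrite bracketE scaleNr.
move=> ->; rewrite (rdiff_bullet Hf Hg E Hs) (rdiff_bullet Hg Hf E' Hs).
rewrite !(mulSn, mulnS) (mulnC n m) !(exprS, exprD, exprM).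
move: (rcup n g f s) (rcup m f g s) => a b.
case: (sign_cases K m) => ->; case: (sign_cases K n) => ->;
  rewrite ?(expr1n, expr0); try (case: (sign_cases K n) => ->); module_ring.
Qed.

Lemma cocycle_bullet_even m f : ~~ odd m -> is_cocycle m f ->
  is_cocycle (m + m).-1 (bullet m m f f).
Proof.
move=> m_even Hf; case: m m_even Hf => [|p] m_even Hf.
  have -> : bullet 0 0 f f = 0 by apply: funext => s; rewrite bullet0.
  apply: is_cocycleP => [|s _]; [exact: multilinear0|exact: rdiff0].
rewrite addSn addnS; have E : (p.+1 + p.+1)%N = (p + p).+2 by rewrite addSn addnS.
apply: is_cocycleP => [|s Hs]; first exact: (multilinear_bullet Hf.1 Hf.1 E).
rewrite (rdiff_bullet Hf Hf E Hs) -scaleNr -scalerDl.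
have p_odd : odd p = true by move: m_even; rewrite [odd _]/= negbK.
have sp : (-1) ^+ p = -1 :> K by rewrite -signr_odd p_odd.
have spp : (-1) ^+ (p * p) = -1 :> K by rewrite exprM sp -signr_odd p_odd.
rewrite !(mulSn, mulnS) !(exprS, exprD) sp spp; move: (rcup _ _ _ _) => a.
module_ring.
Qed.

Lemma cocycle_cup m n f g : is_cocycle m f -> is_cocycle n g ->
  is_cocycle (m + n) (cup m f g).
Proof.
move=> Hf Hg; apply: is_cocycleP => [|s Hs]; first exact: multilinear_rcup Hf.1
  Hg.1.
rewrite [rdiff _ _ _ _](rdiff_rcup idA f g Hs) /rcup !cocycle_rdiff // mul0r
  mulr0.
by rewrite scaler0 addr0.
Qed.

Lemma cocycle_one : is_cocycle 0 (fun s => (if s is [::] then 1 else 0 : A) :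
  kmod A).
Proof.
apply: is_cocycleP => [|[//|a [|//]] _]; first by split=> [[]|].
rewrite /rdiff hoch_diffE // merge_sum_small //= mul1r mulr1 addr0 expr1.
by rewrite scaleN1r subrr.
Qed.
End Cocycles.

(** * Projective resolutions *)

Section LinearOf.
Variables (R : pzRingType) (U V : lmodType R) (f : U -> V) (f_lin : linear f).
(** The proof is kept in the term so that the linear structure can be inferred from it. *)
Definition lin_of : U -> V := let _ := f_lin in f.
Lemma lin_of_linear : linear lin_of. Proof. exact: f_lin. Qed.
HB.instance Definition _ := GRing.isLinear.Build R U V *:%R lin_of lin_of_linear.
End LinearOf.

Section Image.
Variables (R : pzRingType) (U V : lmodType R) (f : {linear U -> V}).

Definition lin_image : {pred V} := fun v => `[< exists u, v = f u >].

Lemma lin_image_submod : submod_closed lin_image.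
Proof.
split=> [|r x y /asboolP [u ->] /asboolP [v ->]]; apply/asboolP.
  by exists 0; rewrite linear0.
by exists (r *: u + v); rewrite linearP.
Qed.
HB.instance Definition _ := GRing.isSubmodClosed.Build R V lin_image
  lin_image_submod.

Lemma lin_imageP v : reflect (exists u, v = f u) (v \in lin_image).
Proof. exact: asboolP. Qed.

(** Projectivity is applied to [f] corestricted to its image, through which [g] factors. *)
Lemma projective_lift (P : lmodType R) (g : {linear P -> V}) :
  projective P -> (forall x, exists u, g x = f u) ->
  exists h : {linear P -> U}, forall x, f (h x) = g x.
Proof.
move=> projP gf.
pose p0 u : subq_car lin_image :=
  SubqCar (introT (lin_imageP (f u)) (ex_intro _ u erefl)).
pose g0 x : subq_car lin_image := SubqCar (introT (lin_imageP (g x)) (gf x)).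
have p0_lin : linear p0 by move=> r u v; apply: val_inj; rewrite /= linearP.
have g0_lin : linear g0 by move=> r u v; apply: val_inj; rewrite /= linearP.
have [|h hE] := projP _ _ (lin_of p0_lin : {linear U -> subq_car lin_image})
  (lin_of g0_lin : {linear P -> subq_car lin_image}).
  case=> v Hv; have [u vE] := elimT (lin_imageP v) Hv.
  by exists u; apply: val_inj; exact/esym.
by exists h => x; have /(congr1 val) := hE x.
Qed.
End Image.

Section Resolutions.
Variable R : pzRingType.

Definition is_complex (P : modseq R) : Prop :=
  forall n x, mdif P n (mdif P n.+1 x) = 0.

Lemma resolution_complex (M : lmodType R) (P : modseq R) (eps : {linear P 0%N
  -> M}) :
  projective_resolution eps -> is_complex P.
Proof. by case=> _ _ _ exP n x; apply/exP; exists x. Qed.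

Lemma resolution_aug (M : lmodType R) (P : modseq R) (eps : {linear P 0%N ->
  M}) x :
  projective_resolution eps -> eps (mdif P 0%N x) = 0.
Proof. by case=> _ _ ex0 _; apply/ex0; exists x. Qed.

Section Comparison.
Variables (P Q : modseq R) (N : lmodType R) (eps : {linear Q 0%N -> N}).
Hypotheses (projP : forall n, projective (P n)) (complexP : is_complex P).
Hypothesis resQ : projective_resolution eps.

Let cycle n : Q n -> Prop :=
  match n with
  | 0 => fun y => eps y = 0
  | m.+1 => fun y => mdif Q m y = 0
  end.

Let cycle_bound n (y : Q n) : cycle y -> exists z, y = mdif Q n z.
Proof. by case: resQ => _ _ ex0 exn; case: n y => [|n] y /=;
  [case: (ex0 y)|case: (exn n y)]. Qed.

(** The comparison theorem. The source is any complex of projectives, so that a shifted resolution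
    qualifies as well. *)
Lemma chain_map_exists (f : {linear P 0%N -> N}) :
  (forall x, f (mdif P 0%N x) = 0) ->
  exists c : forall n, {linear P n -> Q n},
    chain_map c /\ forall x, eps (c 0%N x) = f x.
Proof.
move=> fd; have [_ surj _ _] := resQ.
pose good n (c : {linear P n -> Q n}) := forall x, cycle (c (mdif P n x)).
have [c0 c0E] := projective_lift (f := eps) (g := f) (@projP 0%N)
  (fun x => let: ex_intro y yE := surj (f x) in ex_intro _ y (esym yE)).
(* The chain map is data built by recursion, so each lift is chosen by [cid] and carries the
   invariant that it sends boundaries to cycles. *)
have step n (c : {c | good n c}) : {c' : {linear P n.+1 -> Q n.+1} |
    good n.+1 c' /\ forall x, mdif Q n (c' x) = sval c (mdif P n x)}.
  case: c => c Hc; apply: cid.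
  have [|c' c'E] := projective_lift (f := mdif Q n) (g :=
    c \o mdif P n) (@projP n.+1).
    by move=> x; exact: (cycle_bound (Hc x)).
  by exists c'; split=> // x; rewrite /cycle c'E /= complexP linear0.
have good0 : good 0%N c0 by move=> x; rewrite /cycle c0E fd.
pose fix seqc n : {c | good n c} := match n with
  | 0 => exist _ c0 good0
  | m.+1 => let: exist c' Hc' := step m (seqc m) in exist _ c' Hc'.1
  end.
exists (fun n => sval (seqc n)); split=> [n x|]; last exact: c0E.
by rewrite /=; case: (step n (seqc n)) => c' [].
Qed.

(** Two lifts of the same map are homotopic. In the given degree a - b = d s' + s d, and the cocycle
    g kills d s', so g a - g b = g s d. *)
Lemma homotopic_coboundary (a b : forall n, {linear P n -> Q n}) :
  chain_map a -> chain_map b -> (forall x, eps (a 0%N x) = eps (b 0%N x)) ->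
  forall (L : lmodType R) k (g : {linear Q k -> L}),
    (forall x, g (mdif Q k x) = 0) ->
    hom_coboundary (fun x => g (a k x) - g (b k x)).
Proof.
move=> Ha Hb ab L.
have [s0 s0E] : exists s : {linear P 0%N -> Q 1%N},
    forall x, mdif Q 0%N (s x) = a 0%N x - b 0%N x.
  have [|s sE] := projective_lift (f := mdif Q 0%N) (g :=
    a 0%N \- b 0%N) (@projP 0%N).
    by move=> x; apply: cycle_bound; rewrite /= linearB ab subrr.
  by exists s.
have step n (s : {linear P n -> Q n.+1}) :
    (forall x, mdif Q n (s (mdif P n x)) = a n (mdif P n x) - b n (mdif P n x)) ->
    exists s' : {linear P n.+1 -> Q n.+2}, forall x,
      mdif Q n.+1 (s' x) = a n.+1 x - b n.+1 x - s (mdif P n x).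
  move=> sE.
  have [|s' s'E] := projective_lift (f := mdif Q n.+1)
    (g := (a n.+1 \- b n.+1) \- (s \o mdif P n)) (@projP n.+1).
    move=> x; apply: cycle_bound.
    by rewrite /= !linearB /= sE Ha Hb subrr.
  by exists s'.
(* Only the behaviour of the homotopy on boundaries is carried to the next degree, so its mere
   existence in each degree is enough. *)
have exs n : exists s : {linear P n -> Q n.+1}, forall x,
    mdif Q n (s (mdif P n x)) = a n (mdif P n x) - b n (mdif P n x).
  elim: n => [|n [s sE]]; first by exists s0.
  have [s' s'E] := step n s sE; exists s' => x.
  by rewrite s'E complexP linear0 subr0.
case=> [|n] g gd /=.
  by move=> x; rewrite -linearB -s0E gd.
have [s sE] := exs n; have [s' s'E] := step n s sE.
exists (g \o s) => x /=; rewrite -linearB.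
by rewrite -[a _ x - _](subrK (s (mdif P n x))) -s'E linearD gd add0r.
Qed.
End Comparison.

Section Contraction.
Variables (P : modseq R) (M : lmodType R) (eps : {linear P 0%N -> M}).
Variables (phi0 : M -> P 0%N) (phi : forall n, P n -> P n.+1).
Hypothesis phi0K : cancel phi0 eps.
Hypothesis phiD : forall n, {morph @phi n : x y / x + y}.
Hypothesis phi0D : {morph phi0 : x y / x + y}.
Hypothesis htpy0 : forall x, mdif P 0%N (phi x) = x - phi0 (eps x).
Hypothesis htpy : forall n (x : P n.+1), mdif P n.+1 (phi x)
  = x - phi (mdif P n x).
Hypothesis gen_phi : forall n (x : P n.+1), exists s : seq (R * P n),
  x = \sum_(p <- s) p.1 *: phi p.2.

Let lin_eq0 n (N : lmodType R) (f : {linear P n.+1 -> N}) :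
  (forall x, f (phi x) = 0) -> forall x, f x = 0.
Proof.
move=> f0 x; have [s ->] := gen_phi x; rewrite linear_sum big1 // => p _.
by rewrite linearZ /= f0 scaler0.
Qed.

Lemma contraction_aug x : eps (mdif P 0%N x) = 0.
Proof.
apply: (lin_eq0 (f := eps \o mdif P 0%N)) => y /=.
by rewrite htpy0 linearB phi0K subrr.
Qed.

(** The homotopy identity gives d d phi x = phi d d x (in degree 0, phi0 eps d x), which is 0 by
    induction. As the values of [phi] generate the module and d d is linear, d d = 0. *)
Lemma contraction_complex : is_complex P.
Proof.
elim=> [|n IH] x; apply: (lin_eq0 (f := mdif P _ \o mdif P _)) => y /=;
  rewrite htpy linearB.
  rewrite htpy0 contraction_aug subKr.
  exact: morph_add0.
by rewrite htpy IH (morph_add0 (@phiD _)) subr0 subrr.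
Qed.

Lemma contraction_resolution :
  (forall n, projective (P n)) -> projective_resolution eps.
Proof.
move=> projP; split=> // [m|x|n x].
- by exists (phi0 m); rewrite phi0K.
- split=> [x0|[y ->]]; last exact: contraction_aug.
  by exists (phi x); rewrite htpy0 x0 (morph_add0 phi0D) subr0.
split=> [x0|[y ->]]; last exact: contraction_complex.
by exists (phi x); rewrite htpy x0 (morph_add0 (@phiD _)) subr0.
Qed.
End Contraction.
End Resolutions.

(** * Additive maps, extension of scalars and coinduction *)

Section AdditiveExtensionality.
Variables (R : pzRingType) (Z : zmodType).

Lemma umod_additive_ext (X : Type) (adm : forall G : lmodType R, (X -> G) -> Prop)
    (f g : umod adm -> Z) :
  {morph f : x y / x + y} -> {morph g : x y / x + y} ->
  (forall r x, f (r *: gen adm x) = g (r *: gen adm x)) -> f =1 g.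
Proof.
move=> fD gD fg x; have [s ->] := umod_sum x.
by rewrite !morph_add_sum //; apply: eq_bigr => p _.
Qed.
End AdditiveExtensionality.

Section ScalextTheory.
Variables (R S : pzRingType) (phi : {rmorphism R -> S}).

Lemma etens_linear (M : lmodType R) :
  linear (@etens R S phi M : M -> scalres phi (scalext phi M)).
Proof. exact: etens_phi_linear. Qed.
HB.instance Definition _ (M : lmodType R) := GRing.isLinear.Build R M
  (scalres phi (scalext phi M)) *:%R (@etens R S phi M) (@etens_linear M).

Lemma etensD (M : lmodType R) (x y : M) :
  etens phi (x + y) = etens phi x + etens phi y.
Proof. exact: (linearD (@etens R S phi M : {linear M ->
  scalres phi (scalext phi M)})). Qed.

Lemma etens0 (M : lmodType R) : etens phi (0 : M) = 0.
Proof. exact: (linear0 (@etens R S phi M : {linear M ->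
  scalres phi (scalext phi M)})). Qed.

Lemma etensZ (M : lmodType R) r (x : M) : etens phi (r *: x)
  = phi r *: etens phi x.
Proof. exact: (linearZ_LR (@etens R S phi M : {linear M ->
  scalres phi (scalext phi M)})). Qed.

Lemma scalext_liftE (M : lmodType R) (G : lmodType S) (f : M -> G)
    (hf : phi_linear phi f) x : scalext_lift hf (etens phi x) = f x.
Proof. exact: umod_lift_gen. Qed.

Lemma scalext_mapE (M N : lmodType R) (f : {linear M -> N}) x :
  scalext_map phi f (etens phi x) = etens phi (f x).
Proof. exact: umod_lift_gen. Qed.

Lemma scalext_additive_ext (Z : zmodType) (M : lmodType R) (f g : scalext phi M
  -> Z) :
  {morph f : x y / x + y} -> {morph g : x y / x + y} ->
  (forall s x, f (s *: etens phi x) = g (s *: etens phi x)) -> f =1 g.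
Proof. exact: umod_additive_ext. Qed.

Lemma scalext_umod_additive_ext (Z : zmodType) (X : Type)
    (adm : forall G : lmodType R, (X -> G) ->
      Prop) (f g : scalext phi (umod adm) -> Z) :
  {morph f : x y / x + y} -> {morph g : x y / x + y} ->
  (forall s x, f (s *: etens phi (gen adm x)) = g (s *: etens phi (gen adm x))) ->
  f =1 g.
Proof.
move=> fD gD fg; apply: scalext_additive_ext => // s.
apply: umod_additive_ext => [x y|x y|r x].
- by rewrite etensD scalerDr fD.
- by rewrite etensD scalerDr gD.
by rewrite etensZ scalerA.
Qed.

(** Extension of scalars is left adjoint to restriction, and restriction preserves surjections. *)
Lemma scalext_projective (M : lmodType R) : projective M ->
  projective (scalext phi M).
Proof.
move=> projM U V p f surj.
have f_lin : linear (fun x => f (etens phi x) : scalres phi V).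
  by move=> r x y; rewrite etens_phi_linear linearP.
have p_lin : linear (p : scalres phi U -> scalres phi V).
  by move=> r x y; exact: linearP.
have [//|g gE] := projM _ _ (lin_of p_lin : {linear scalres phi U ->
  scalres phi V})
  (lin_of f_lin : {linear M -> scalres phi V}).
have g_lin : phi_linear phi (g : M -> U) by move=> r x y; exact: linearP.
exists (scalext_lift g_lin); apply: (umod_ext (f :=
  p \o scalext_lift g_lin)) => x /=.
by rewrite [umod_lift _ _]scalext_liftE; exact: gE.
Qed.
End ScalextTheory.

(* The coinduced module Hom_Z(R, Z). An additive map M -> Z out of an         *)
(* R-module M is the same as an R-linear map M -> coind; this is how additive *)
(* maps which are not R-linear are defined on a module given by generators.   *)
Section Coinduced.
Variables (R : pzRingType) (Z : zmodType).

Definition additive_pred : {pred R -> Z} :=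
  fun f => `[< {morph f : x y / x + y} >].
Lemma additive_pred_zmod : zmod_closed additive_pred.
Proof.
split=> [|f g /asboolP fD /asboolP gD]; apply/asboolP => x y.
  by rewrite -[RHS]/(0 + 0) addr0.
by rewrite -![(f - g) _]/(f _ - g _) fD gD opprD addrACA.
Qed.
HB.instance Definition _ :=
  GRing.isZmodClosed.Build (R -> Z) additive_pred additive_pred_zmod.

Record coind := Coind { coind_val :> R -> Z; _ : coind_val \in additive_pred }.
HB.instance Definition _ := [isSub for coind_val].
HB.instance Definition _ := [Choice of coind by <:].
HB.instance Definition _ := [SubChoice_isSubZmodule of coind by <:].

Definition mk_coind (f : R -> Z) (fD : {morph f : x y / x + y}) : coind :=
  Coind (introT (asboolP _) fD).

Lemma coind_additive (f : coind) : {morph f : x y / x + y}.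
Proof. by case: f => f /= /asboolP. Qed.

Lemma coindP (f g : coind) : f =1 g -> f = g.
Proof. by move=> fg; apply: val_inj; apply: funext. Qed.

Lemma coindD (f g : coind) x : (f + g) x = f x + g x.
Proof. by []. Qed.

Definition coind_scale (r : R) (f : coind) : coind :=
  mk_coind (fun x y : R => (etrans (congr1 f (mulrDl x y r)) (coind_additive f
    _ _)
    : f ((x + y) * r) = f (x * r) + f (y * r))).

Lemma coind_scaleA r s f : coind_scale r (coind_scale s f)
  = coind_scale (r * s) f.
Proof. by apply: coindP => x /=; rewrite mulrA. Qed.
Lemma coind_scale1 : left_id 1 coind_scale.
Proof. by move=> f; apply: coindP => x /=; rewrite mulr1. Qed.
Lemma coind_scaleDr : right_distributive coind_scale +%R.
Proof. by move=> r f g; apply: coindP => x. Qed.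
Lemma coind_scaleDl f : {morph coind_scale^~ f : r s / r + s}.
Proof. by move=> r s; apply: coindP => x /=; rewrite mulrDr coind_additive. Qed.
HB.instance Definition _ := GRing.Zmodule_isLmodule.Build R coind
  coind_scaleA coind_scale1 coind_scaleDr coind_scaleDl.

Lemma coindZ r (f : coind) x : (r *: f) x = f (x * r).
Proof. by []. Qed.

Definition coind_eval (M : lmodType R) (h : {linear M -> coind}) (x : M) : Z :=
  h x 1.

Lemma coind_evalD (M : lmodType R) (h : {linear M -> coind}) :
  {morph coind_eval h : x y / x + y}.
Proof. by move=> x y; rewrite /coind_eval linearD. Qed.

Lemma coind_evalZ (M : lmodType R) (h : {linear M -> coind}) r x :
  coind_eval h (r *: x) = h x r.
Proof. by rewrite /coind_eval linearZ coindZ mul1r. Qed.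
End Coinduced.

(** * Trivial extensions and central elements along ring epimorphisms *)

Definition trivext (K : comPzRingType) (A : kalgType K) (M : lmodType (ev A)) :
  Type :=
  (A * M)%type.

Lemma tensM (K : comPzRingType) (A : kalgType K) (a b c d : A) :
  tens a b * tens c d = tens (a * c) (d * b) :> ev A.
Proof. exact: ev_mul_tens. Qed.

Lemma tensDl (K : comPzRingType) (A : kalgType K) (a a' b : A) :
  tens (a + a') b = tens a b + tens a' b.
Proof. by have := tens_linl 1 a a' b; rewrite rmorph1 mul1r scale1r. Qed.

Lemma tensDr (K : comPzRingType) (A : kalgType K) (a b b' : A) :
  tens a (b + b') = tens a b + tens a b'.
Proof. by have := tens_linr 1 a b b'; rewrite rmorph1 mul1r scale1r. Qed.

Section TrivialExtension.
Variables (K : comPzRingType) (A : kalgType K) (M : lmodType (ev A)).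
Local Notation T := (trivext M).
HB.instance Definition _ := GRing.Zmodule.on T.

Definition trivext_mul (x y : T) : T :=
  (x.1 * y.1, tens x.1 1 *: y.2 + tens 1 y.1 *: x.2).

Lemma trivext_mulA : associative trivext_mul.
Proof.
move=> [a x] [b y] [c z]; congr (_, _) => /=; first by rewrite mulrA.
by rewrite !scalerDr !scalerA !tensM !(mulr1, mul1r) addrA.
Qed.
Lemma trivext_mul1 : left_id ((1, 0) : T) trivext_mul.
Proof.
move=> [a x]; congr (_, _) => /=; first by rewrite mul1r.
by rewrite scaler0 addr0; exact: scale1r.
Qed.
Lemma trivext_mulr1 : right_id ((1, 0) : T) trivext_mul.
Proof.
move=> [a x]; congr (_, _) => /=; first by rewrite mulr1.
by rewrite scaler0 add0r; exact: scale1r.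
Qed.
Lemma trivext_mulDl : left_distributive trivext_mul +%R.
Proof.
move=> [a x] [b y] [c z]; congr (_, _) => /=; first by rewrite mulrDl.
by rewrite tensDl scalerDl scalerDr addrACA.
Qed.
Lemma trivext_mulDr : right_distributive trivext_mul +%R.
Proof.
move=> [a x] [b y] [c z]; congr (_, _) => /=; first by rewrite mulrDr.
by rewrite tensDr scalerDl scalerDr addrACA.
Qed.
HB.instance Definition _ := GRing.Zmodule_isPzRing.Build T
  trivext_mulA trivext_mul1 trivext_mulr1 trivext_mulDl trivext_mulDr.

Definition trivext_in (a : A) : T := (a, 0).

Lemma trivext_in_zmod : zmod_morphism trivext_in.
Proof. by move=> a b; congr (_, _); rewrite /= subrr. Qed.
Lemma trivext_in_monoid : monoid_morphism trivext_in.
Proof. by split=> // a b; congr (_, _); rewrite /= !scaler0 addr0. Qed.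
HB.instance Definition _ := GRing.isZmodMorphism.Build A T trivext_in
  trivext_in_zmod.
HB.instance Definition _ := GRing.isMonoidMorphism.Build A T trivext_in
  trivext_in_monoid.

Variable m : M.
(** The graph of the inner derivation given by [m]; it is multiplicative by the Leibniz rule. *)
Definition trivext_der (a : A) : T := (a, tens a 1 *: m - tens 1 a *: m).
Lemma trivext_der_zmod : zmod_morphism trivext_der.
Proof.
apply: morph_addB => a b; congr (_, _).
by rewrite /= tensDl tensDr !scalerDl opprD addrACA.
Qed.
Lemma trivext_der_monoid : monoid_morphism trivext_der.
Proof.
split=> [|a b]; first by congr (_, _); rewrite /= subrr.
congr (_, _); rewrite /= !scalerBr !scalerA !tensM !(mulr1, mul1r).
by rewrite addrA subrK.
Qed.
HB.instance Definition _ := GRing.isZmodMorphism.Build A T trivext_der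
  trivext_der_zmod.
HB.instance Definition _ := GRing.isMonoidMorphism.Build A T trivext_der
  trivext_der_monoid.
End TrivialExtension.

(* The derivation a |-> a m - m a vanishes on B, so the maps of A to A (+) M  *)
(* with components (id, 0) and (id, derivation) agree on B.                   *)
Lemma ring_epimorphism_central (K : comPzRingType) (B A : kalgType K)
    (pi : KAlgHom.type B A) (M : lmodType (ev A)) (m : M) :
  ring_epimorphism pi ->
  (forall b, tens (pi b) 1 *: m = tens 1 (pi b) *: m) ->
  forall a, tens a 1 *: m = tens 1 a *: m.
Proof.
move=> epi pim a.
have /(congr1 snd) /= : trivext_der m a = trivext_in M a.
  by apply: esym; apply: epi => b; congr (_, _); rewrite /= pim subrr.
by move=> /eqP; rewrite subr_eq0 => /eqP.
Qed.

(** * The bar resolution *)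

Section MultilinearLifting.
Variables (K : comPzRingType) (A : kalgType K).

Definition multilinear_pred (V : lmodType K) n : {pred seq A -> V} :=
  fun f => `[< multilinear n f >].
Lemma multilinear_pred_submod (V : lmodType K) n :
  submod_closed (@multilinear_pred V n).
Proof.
split=> [|k f g /asboolP Hf /asboolP Hg]; apply/asboolP;
  first exact: multilinear0.
have := multilinear_addZ k Hg Hf; congr multilinear.
by apply: funext => s; rewrite addrC.
Qed.
HB.instance Definition _ (V : lmodType K) n :=
  GRing.isSubmodClosed.Build K (seq A -> V)
  (@multilinear_pred V n) (@multilinear_pred_submod V n).

Lemma multilinear_predP (V : lmodType K) n (f : seq A -> V) :
  reflect (multilinear n f) (f \in @multilinear_pred V n).
Proof. exact: asboolP. Qed.

Local Notation multilin V n := (subq_car (@multilinear_pred V n)).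
Definition mk_multilin (V : lmodType K) n (f : seq A ->
  V) (Hf : multilinear n f) : multilin V n :=
  SubqCar (introT (multilinear_predP n f) Hf).
Lemma multilinP (V : lmodType K) n (f : multilin V n) : multilinear n (\val f).
Proof. by case: f => f Hf; exact: (elimT (multilinear_predP n f) Hf). Qed.

Hypothesis projA : projective (kmod A).

(** Tensor powers of a projective module are projective, in curried form: the first argument is
    lifted as a linear map into the module of multilinear maps in the others, onto which the
    induction hypothesis gives a surjection. *)
Lemma multilinear_lift (V W : lmodType K) (p : {linear V -> W}) n (f : seq A ->
  W) :
  (forall w, exists v, p v = w) -> multilinear n f ->
  exists2 g, multilinear n g & forall s, p (g s) = f s.
Proof.
move=> surj; elim: n f => [|n IH] f Hf.
  have [v vE] := surj (f [::]).
  exists (fun s => if s is [::] then v else 0); first by split=> [[]|].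
  by case=> [//|a s]; rewrite linear0 (multilinear_size Hf).
pose F0 (a : kmod A) := mk_multilin (multilinear_cons a Hf).
have pP (g : multilin V n) : multilinear n (fun s => p (\val g s)).
  split=> [s Hs|s t k a b Hst].
    by rewrite (multilinear_size (multilinP g)) // linear0.
  by rewrite (multilinP g).2 // linearP.
pose P0 g := mk_multilin (pP g).
have F0_lin : linear F0.
  move=> k a b; apply: val_inj; apply: funext => s.
  have [Hs|Hs] := eqVneq (size s) n; first by apply: (Hf.2 [::] s k a b);
    rewrite /= Hs.
  rewrite -[RHS]/(k *: f ((a : A) :: s) + f ((b : A) :: s)) /=.
  by rewrite !(multilinear_size Hf) ?scaler0 ?addr0.
have P0_lin : linear P0.
  by move=> k g h; apply: val_inj; apply: funext => s; rewrite /= linearP.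
have [|G GE] := projA (p := lin_of P0_lin : {linear multilin V n -> multilin W n})
    (lin_of F0_lin : {linear kmod A -> multilin W n}).
  move=> h; have [g Hg gE] := IH _ (multilinP h).
  by exists (mk_multilin Hg); apply: val_inj; apply: funext.
exists (fun s => if s is a :: u then \val (G a) u else 0).
  split=> [[//|a s] Hs|[|c s] t k a b [Hst]] /=.
  - by rewrite (multilinear_size (multilinP _)).
  - have -> : G (kunit k * a + b) = k *: G a + G b by exact: (linearP G k a b).
    by [].
  - by rewrite (multilinP _).2.
case=> [|a s]; first by rewrite linear0 (multilinear_size Hf).
by have /(congr1 (fun h : multilin W n => \val h s)) := GE a.
Qed.
End MultilinearLifting.

(** The extra degeneracy that puts [a] in front. The face multiplying [a] with the next letter
    matches the left outer face of [s], all later faces are shifted by one place, and only the left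
    action of [a] remains. It serves both bar resolutions. *)
Lemma hoch_diff_contraction (K : comPzRingType) (A : kalgType K) (G G' :
  lmodType K)
    (l r : A -> G -> G) (l' r' : A -> G' -> G') (F : seq A -> G) (F' : seq A ->
      G')
    (E : G' -> G') (phi : G -> G') a n s :
  {morph E : x y / x + y} -> {morph phi : x y / x + y} ->
  (forall c u, phi (l c (F u)) = E (F' (a * c :: u))) ->
  (forall u, phi (F u) = E (F' (a :: u))) ->
  (forall c u, phi (r c (F u)) = E (r' c (F' (a :: u)))) ->
  size s = n.+1 ->
  E (hoch_diff l' r' n.+1 F' (a :: s)) = E (l' a (F' s)) - phi (hoch_diff l r n
    F s).
Proof.
move=> ED phiD phil phiF phir Hs.
rewrite !hoch_diffE /= ?Hs // !ED !phiD.
have -> : phi (merge_sum F s) = merge_sum (fun u => E (F' (a :: u))) s.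
  by rewrite (merge_sum_additive _ _ phiD); apply: eq_merge_sum => u _.
rewrite (morph_add_sign _ _ ED) (morph_add_sign _ _ phiD) phir.
case: s Hs => [//|b t] Hs; rewrite phil merge_sum_cons (morph_addB ED) /=.
rewrite -[- F' _]sub0r (morph_addB ED) (morph_add0 ED) (merge_sum_additive _ _
  ED).
by rewrite (exprS _ n.+1); module_ring.
Qed.

Section BarResolution.
Variables (K : comPzRingType) (A : kalgType K).
Implicit Types (s : seq A).

Lemma ev_scaleE k (e : ev A) : k *: e = kunit k * e.
Proof. by rewrite -[kunit k]/(ev_unit A k) -ev_scaleAl [ev_one A * _]ev_mul1r.
  Qed.

Lemma tens_scale k (a b : A) : k *: tens a b = tens (kunit k * a) b.
Proof.
have t0 : tens 0 b = 0 by apply: (morph_add0 (f := fun x => tens x b)) => x y;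
  exact: tensDl.
by have := tens_linl k a 0 b; rewrite addr0 t0 addr0.
Qed.

Lemma bar_additive_ext n (Z : zmodType) (f g : bar_obj A n -> Z) :
  {morph f : x y / x + y} -> {morph g : x y / x + y} ->
  (forall a b s, size s = n ->
     f (tens a b *: bar_sym n s) = g (tens a b *: bar_sym n s)) -> f =1 g.
Proof.
move=> fD gD fg; apply: umod_additive_ext => // e s; move: e.
have [Hs|Hs] := eqVneq (size s) n; last first.
  move=> e; rewrite -[gen _ _]/(bar_sym n s) (multilinear_size
    (bar_sym_multilinear A n)) //.
  by rewrite scaler0 !morph_add0.
suff: (fun e : ev A => f (e *: bar_sym n s)) =1 (fun e => g (e *: bar_sym n s))
  by [].
apply: (@umod_additive_ext K Z _ (@bilin K A)).
- by move=> x y; rewrite scalerDl fD.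
- by move=> x y; rewrite scalerDl gD.
move=> k [a b].
by rewrite [k *: _]tens_scale; exact: fg.
Qed.

Let phis_sym n s (p : A * A) : scalres (@kunit K (ev A)) (bar_obj A n.+1) :=
  tens 1 p.2 *: bar_sym n.+1 (p.1 :: s).

Let phis_bilin n s : bilin (phis_sym n s).
Proof.
split=> k a a' b; rewrite /phis_sym /=; last first.
  by rewrite tens_linr ev_scaleE scalerDl -scalerA.
have -> : bar_sym n.+1 (kunit k * a + a' :: s)
    = (kunit k : ev A) *: bar_sym n.+1 (a :: s) + bar_sym n.+1 (a' :: s).
  have [Hs|Hs] := eqVneq (size s) n.
    by apply: ((bar_sym_multilinear A n.+1).2 [::] s k a a'); rewrite /= Hs.
  by rewrite !(multilinear_size (bar_sym_multilinear A n.+1)) // scaler0 addr0.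
by rewrite scalerDr scalerA -kunit_central -scalerA.
Qed.

Let phis_add n s : {morph (umod_lift (phis_bilin n s) : ev A -> bar_obj A n.+1) :
  x y / x + y}.
Proof. by move=> x y; exact: (linearD (umod_lift (phis_bilin n s))). Qed.

Let phis n s : coind (ev A) (bar_obj A n.+1) :=
  @mk_coind (ev A) (bar_obj A n.+1) (umod_lift (phis_bilin n s)) (phis_add n s).

Let phisE n s a b : phis n s (tens a b) = tens 1 b *: bar_sym n.+1 (a :: s).
Proof. exact: (umod_lift_gen (phis_bilin n s) (a, b)). Qed.

Let phis_adm n : bar_adm n (phis n).
Proof.
have ext (f g : coind (ev A) (bar_obj A n.+1)) :
    (forall a b, f (tens a b) = g (tens a b)) -> f = g.
  move=> fg; apply: coindP; apply: (@umod_additive_ext K _ _ (@bilin K A)).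
  - by move=> x y; exact: (coind_additive f x y).
  - by move=> x y; exact: (coind_additive g x y).
  by move=> k [a b]; rewrite [k *: _]tens_scale; exact: fg.
split=> [s Hs|s t k a b Hst]; apply: ext => c d.
  rewrite phisE (multilinear_size (bar_sym_multilinear A n.+1)) //.
  by rewrite scaler0; exact: esym.
rewrite -[RHS]/(phis n (s ++ a :: t) (tens c d * kunit k) + phis n (s ++ b ::
  t) (tens c d)).
rewrite -kunit_central -ev_scaleE tens_scale !phisE.
rewrite -!(cat_cons (kunit k * c)) -!(cat_cons c) (bar_sym_multilinear A
  n.+1).2 /=; last first.
  by rewrite addSn Hst.
rewrite scalerDr; congr (_ + _).
rewrite -[_ :: s ++ _](cat0s) (multilinearZ [::] _ _ _ (bar_sym_multilinear A
  n.+1)).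
by [].
Qed.

(** The contraction sending a (x) s (x) b to 1 (x) a (x) s (x) b. It is not left A-linear, hence the
    passage through [coind]. *)
Definition bar_phi n : bar A n -> bar A n.+1 :=
  coind_eval (umod_lift (@phis_adm n)).

Lemma bar_phiD n : {morph @bar_phi n : x y / x + y}.
Proof. exact: coind_evalD. Qed.

Lemma bar_phiE n a b s :
  bar_phi (tens a b *: bar_sym n s) = tens 1 b *: bar_sym n.+1 (a :: s).
Proof. by rewrite /bar_phi coind_evalZ /= [umod_lift _ _](umod_lift_gen
  (@phis_adm n)) phisE. Qed.

Definition bar_phi0 (a : bimod A) : bar A 0 := tens 1 (a : A) *: bar_sym 0 [::].

Lemma bar_difE n s : mdif (bar A) n (bar_sym n.+1 s) = bar_face n s.
Proof. exact: umod_lift_gen. Qed.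

Lemma bar_augE a b : bar_aug A (tens a b *: bar_sym 0 [::]) = a * b.
Proof.
rewrite linearZ; have -> : bar_aug A (bar_sym 0 [::]) = 1 by exact: umod_lift_gen.
by rewrite [LHS]bimod_scale_tens mulr1.
Qed.

Lemma bar_htpy0 x : mdif (bar A) 0 (bar_phi x) = x - bar_phi0 (bar_aug A x).
Proof.
have phi0D : {morph bar_phi0 : a b / a + b}.
  by move=> a b; rewrite /bar_phi0 tensDr scalerDl.
move: x; apply: bar_additive_ext => [x y|x y|a b [|//] _].
- by rewrite bar_phiD linearD.
- by rewrite linearD phi0D opprD addrACA.
rewrite bar_phiE bar_augE linearZ /= bar_difE /bar_face hoch_diffE //.
rewrite merge_sum_small // addr0 expr1 scaleN1r.
by rewrite scalerBr !scalerA !tensM !(mulr1, mul1r).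
Qed.

Lemma bar_htpy n (x : bar A n.+1) :
  mdif (bar A) n.+1 (bar_phi x) = x - bar_phi (mdif (bar A) n x).
Proof.
move: x; apply: bar_additive_ext => [x y|x y|a b s Hs].
- by rewrite bar_phiD linearD.
- by rewrite linearD bar_phiD opprD addrACA.
rewrite bar_phiE !linearZ /= !bar_difE /bar_face.
pose R n := scalres (@kunit K (ev A)) (bar_obj A n).
pose L n c (x : R n) : R n := tens c 1 *: (x : bar_obj A n).
pose T n c (x : R n) : R n := tens 1 c *: (x : bar_obj A n).
(* The right factor [b] is a passenger: the outer map is its action. *)
rewrite [LHS](@hoch_diff_contraction _ _ (R n) (R n.+1) (L n) (T n) (L n.+1) (T
  n.+1)
  (bar_sym n) (bar_sym n.+1) (T n.+1 b)
  (fun x => bar_phi (tens a b *: (x : bar_obj A n))) a n s); rewrite /L /T //.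
- by rewrite scalerA tensM !(mulr1, mul1r).
- by move=> x y; exact: (scalerDr (tens 1 b) (x : bar_obj A n.+1) y).
- move=> x y; have /(congr1 (@bar_phi n)) :=
  scalerDr (tens a b) (x : bar_obj A n) y.
  by rewrite bar_phiD.
- by move=> c u; rewrite scalerA tensM !(mulr1, mul1r) bar_phiE.
- by move=> u; rewrite bar_phiE.
by move=> c u; rewrite !scalerA !tensM !(mulr1, mul1r) bar_phiE.
Qed.

Lemma bar_gen_phi n (x : bar A n.+1) : exists s : seq (ev A * bar A n),
  x = \sum_(p <- s) p.1 *: bar_phi p.2.
Proof.
have [s ->] := umod_sum x.
(* The symbol of the empty sequence is 0 in degree n+1, so it is represented by the zero pair. *)
exists [seq if p.2 is a :: u then (p.1, tens a 1 *: bar_sym n u) else (0,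
  0) | p <- s].
rewrite big_map; apply: eq_bigr => -[e [|a u]] _ /=.
  rewrite -[gen _ _]/(bar_sym n.+1 [::]).
  by rewrite (multilinear_size (bar_sym_multilinear A n.+1)) // scaler0 scale0r.
by rewrite bar_phiE; congr (_ *: _); exact/esym/scale1r.
Qed.

(** Linear maps out of the bar module are multilinear maps on A, which lift by
    [multilinear_lift]. *)
Lemma bar_projective n : projective (kmod A) -> projective (bar A n).
Proof.
move=> projA M N p f surj; pose rs (L : lmodType (ev A)) :=
  scalres (@kunit K (ev A)) L.
have p_lin : linear (p : rs M -> rs N) by move=> k x y; exact: linearP.
have f_mult : multilinear n (fun s => f (bar_sym n s) : rs N).
  split=> [s Hs|s t k a b Hst].
    by rewrite (multilinear_size (bar_sym_multilinear A n)) // linear0.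
  by rewrite (bar_sym_multilinear A n).2 //; exact: (linearP f).
have [//|g Hg gE] := multilinear_lift projA (p :=
  lin_of p_lin : {linear rs M -> rs N})
  _ f_mult.
exists (umod_lift (Hg : bar_adm n (g : seq A -> M))).
apply: (umod_ext (f := p \o umod_lift _)) => s /=.
by rewrite umod_lift_gen; exact: gE.
Qed.

Lemma bar_resolution : projective (kmod A) -> projective_resolution (bar_aug A).
Proof.
move=> projA; apply: (@contraction_resolution _ _ _ _ bar_phi0 bar_phi).
- by move=> a; rewrite /bar_phi0 bar_augE mul1r.
- exact: bar_phiD.
- by move=> a b; rewrite /bar_phi0 tensDr scalerDl.
- exact: bar_htpy0.
- exact: bar_htpy.
- exact: bar_gen_phi.
by move=> n; exact: bar_projective.
Qed.
End BarResolution.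

(** * The resolution of the left B-module A *)

(** Termwise comparison of two differentials with different coefficients inside a common abelian
    group; every compatibility of differentials below is an instance. *)
Lemma hoch_diff_morph (K : comPzRingType) (A : kalgType K) (G G' : lmodType K)
    (Z : zmodType) (l r : A -> G -> G) (l' r' : A -> G' -> G')
    (F : seq A -> G) (F' : seq A -> G') (phi : G -> Z) (phi' : G' -> Z) n s :
  {morph phi : x y / x + y} -> {morph phi' : x y / x + y} ->
  (forall c u, phi (l c (F u)) = phi' (l' c (F' u))) ->
  (forall u, phi (F u) = phi' (F' u)) ->
  (forall c u, phi (r c (F u)) = phi' (r' c (F' u))) ->
  phi (hoch_diff l r n F s) = phi' (hoch_diff l' r' n F' s).
Proof.
move=> phiD phiD' phil phiF phir.
have phiS i x x' : phi x = phi' x' -> phi ((-1) ^+ i *: x)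
  = phi' ((-1) ^+ i *: x').
  move=> xx'; rewrite -signr_odd !scaler_sign; case: odd => //.
  rewrite -[- x]sub0r -[- x']sub0r (morph_addB phiD) (morph_addB phiD') xx'.
  by rewrite (morph_add0 phiD) (morph_add0 phiD').
have [Hs|Hs] := eqVneq (size s) n.+1; last first.
  by rewrite !hoch_diff_size // (morph_add0 phiD) (morph_add0 phiD').
rewrite !hoch_diffE // !phiD !phiD' phil (phiS _ _ _ (phir _ _));
  congr (_ + _ + _).
rewrite (morph_add_sum _ _ _ phiD) (morph_add_sum _ _ _ phiD').
by apply: eq_bigr => i _; exact: phiS.
Qed.

Section LinearMaps.
Variables (K : comPzRingType) (V W : lmodType K).

Definition linear_pred : {pred V -> W} := fun f => `[< linear f >].
Lemma linear_predP (f : V -> W) : reflect (linear f) (f \in linear_pred).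
Proof. exact: asboolP. Qed.
Lemma linear_pred_submod : submod_closed linear_pred.
Proof.
split=> [|k f g /asboolP Hf /asboolP Hg]; apply/asboolP => l x y.
  by rewrite -[LHS]/0 -[RHS]/(l *: 0 + 0) scaler0 addr0.
rewrite -![(k *: f + g) _]/(k *: f _ + g _) Hf Hg; module_ring.
Qed.
HB.instance Definition _ :=
  GRing.isSubmodClosed.Build K (V -> W) linear_pred linear_pred_submod.

Definition homK : lmodType K := subq_car linear_pred.
Definition homK_fun (f : homK) : V -> W := \val (f : subq_car linear_pred).
Definition mk_homK (f : V -> W) (f_lin : linear f) : homK :=
  SubqCar (introT (linear_predP f) f_lin).

Lemma mk_homKE (f : V -> W) (f_lin : linear f) x : homK_fun (mk_homK f_lin) x
  = f x.
Proof. by []. Qed.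
Lemma homK_linear f : linear (homK_fun f).
Proof. by case: f => f Hf; exact: (elimT (linear_predP f) Hf). Qed.
Lemma homK_inj f g : homK_fun f =1 homK_fun g -> f = g.
Proof. by move=> fg; apply: val_inj; apply: funext. Qed.
Lemma homK_funE k f g x : homK_fun (k *: f + g) x
  = k *: homK_fun f x + homK_fun g x.
Proof. by []. Qed.
Lemma homK_fun0 x : homK_fun 0 x = 0.
Proof. by []. Qed.
End LinearMaps.

Lemma linear_lift (K : comPzRingType) (P V W : lmodType K) (p : {linear V -> W}) :
  projective P -> (forall w, exists v, p v = w) ->
  forall f, linear f -> exists2 g : P -> V, linear g & forall x, p (g x) = f x.
Proof.
move=> projP surj f f_lin.
have [//|g gE] := projP _ _ p (lin_of f_lin : {linear P -> W}).
by exists g => //; exact: linearP.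
Qed.

Section Lbar.
Variables (K : comPzRingType) (B A : kalgType K) (pi : KAlgHom.type B A).
Local Notation rs G := (scalres (@kunit K B) G).
Implicit Types (s : seq B) (a : A).

(* [lbar_obj n] is B (x) B^(x)n (x) A, the left B-module generated by the     *)
(* symbols [b_1, ..., b_n; a].                                                *)
Definition lbar_adm n (G : lmodType B) (f : seq B * A -> G) : Prop :=
  (forall a, multilinear n (fun s => f (s, a) : rs G)) /\
  (forall s, linear ((fun a => f (s, a)) : kmod A -> rs G)).

Definition lbar_obj n : lmodType B := umod (lbar_adm n).
Definition lbar_sym n s a : lbar_obj n := gen (lbar_adm n) (s, a).

Lemma lbar_sym_adm n : lbar_adm n (fun p => lbar_sym n p.1 p.2).
Proof.
split=> [a|s k a a'].
  split=> [s Hs|s t k b b' Hst]; apply: umodP => G f hf.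
    by rewrite umod_eval0 // umod_eval_gen //; case: hf => /(_ a) [-> ].
  rewrite umod_evalD // umod_evalZ // !umod_eval_gen //.
  by case: hf => /(_ a) [_ H] _; exact: H.
apply: umodP => G f hf; rewrite umod_evalD // umod_evalZ // !umod_eval_gen //.
by case: hf => _ /(_ s k a a').
Qed.

Lemma lbar_sym_multilinear n a : multilinear n (fun s => lbar_sym n s a : rs
  (lbar_obj n)).
Proof. exact: (lbar_sym_adm n).1. Qed.
Lemma lbar_sym_linear n s : linear (lbar_sym n s : kmod A -> rs (lbar_obj n)).
Proof. exact: (lbar_sym_adm n).2. Qed.

Local Notation Fun n := (kmod A -> rs (lbar_obj n)).

(* d [b_1, ..., b_(n+1); a] has the last face [b_1, ..., b_n; b_(n+1) a]; the *)
(* right action of B is therefore the one on the functions of a.              *)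
Definition lbar_actl n (b : B) (f : Fun n) : Fun n :=
  fun a => b *: (f a : lbar_obj n).
Definition lbar_actr n (b : B) (f : Fun n) : Fun n :=
  fun a => f (pi b * (a : A) : A).
Definition lbar_face n s : Fun n :=
  hoch_diff (@lbar_actl n) (@lbar_actr n) n (lbar_sym n : seq B -> Fun n) s.

Local Notation Lin n := (homK (kmod A) (rs (lbar_obj n))).

Let actl_lin n b (f : Lin n) : linear (lbar_actl b (homK_fun f)).
Proof.
move=> k x y; rewrite /lbar_actl homK_linear [LHS]scalerDr; congr (_ + _).
by rewrite [LHS]scalerA [RHS]scalerA -kunit_central.
Qed.
Let actr_lin n b (f : Lin n) : linear (lbar_actr b (homK_fun f)).
Proof.
move=> k x y; rewrite /lbar_actr -homK_linear; congr (homK_fun f _).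
by rewrite mulrDr [in LHS]mulrA -kunit_central -mulrA.
Qed.

Let symL n s : Lin n := mk_homK (@lbar_sym_linear n s).
Let actl n b (f : Lin n) : Lin n := mk_homK (@actl_lin n b f).
Let actr n b (f : Lin n) : Lin n := mk_homK (@actr_lin n b f).
Let actlE n b (f : Lin n) a : homK_fun (actl b f) a
  = b *: (homK_fun f a : lbar_obj n).
Proof. by []. Qed.
Let actrE n b (f : Lin n) a : homK_fun (actr b f) a
  = homK_fun f (pi b * (a : A) : A).
Proof. by []. Qed.

Let symL_multilinear n : multilinear n (@symL n).
Proof.
split=> [s Hs|s t k b b' Hst]; apply: homK_inj => a.
  by rewrite homK_fun0; exact: (multilinear_size (lbar_sym_multilinear n a)).
by rewrite homK_funE; exact: (lbar_sym_multilinear n a).2.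
Qed.

Let actl_bilinear n : action_bilinear (@actl n).
Proof.
split=> [k b b' f|b k f f']; apply: homK_inj => a; rewrite homK_funE !actlE.
  by rewrite [LHS]scalerDl -[in LHS]scalerA.
rewrite homK_funE [LHS]scalerDr; congr (_ + _).
by rewrite [LHS]scalerA -kunit_central -[LHS]scalerA.
Qed.

Let actr_bilinear n : action_bilinear (@actr n).
Proof.
split=> [k b b' f|b k f f']; apply: homK_inj => a; rewrite homK_funE !actrE.
  rewrite rmorphD /= klinear mulrDl -mulrA; exact: (homK_linear f).
by rewrite homK_funE.
Qed.

(** On K-linear functions of [a] the right action is also linear in the acting letter, so
    [hoch_diff_multilinear] applies to the face computed in [homK]. *)
Let lbar_faceE n s : lbar_face n s = homK_fun (hoch_diff (@actl n) (@actr n) n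
  (@symL n) s).
Proof.
by apply: esym; apply: (@hoch_diff_morph _ _ (Lin n) (Fun n) (Fun n) _ _ _ _
  (@symL n) _ (@homK_fun _ _ _) id).
Qed.

Lemma lbar_face_adm n : lbar_adm n.+1 (fun p => lbar_face n p.1 p.2 : lbar_obj n).
Proof.
have [Hz Hl] := hoch_diff_multilinear (@actl_bilinear n) (@actr_bilinear n)
  (@symL_multilinear n).
split=> [a|s k a a'] /=; last first.
  by rewrite lbar_faceE; exact: (homK_linear (hoch_diff (@actl n) (@actr n) n
    (@symL n) s)).
split=> [s Hs|s t k b b' Hst]; rewrite !lbar_faceE; first by rewrite Hz.
by rewrite (Hl _ _ k b b' Hst) homK_funE.
Qed.

Definition lbar_dif n : {linear lbar_obj n.+1 -> lbar_obj n} :=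
  umod_lift (@lbar_face_adm n).
Definition lbar : modseq B := ModSeq lbar_dif.

Lemma lbar_difE n s a : mdif lbar n (lbar_sym n.+1 s a) = lbar_face n s a.
Proof. exact: umod_lift_gen. Qed.

Let phis_add n s a : {morph (fun b : B => lbar_sym n.+1 (b :: s) a) : x y / x +
  y}.
Proof.
move=> x y; have [Hs|Hs] := eqVneq (size s) n; last first.
  by rewrite !(multilinear_size (lbar_sym_multilinear n.+1 a)) ?addr0.
by apply: (@multilinearD _ _ _ _ _ [::] s x y (lbar_sym_multilinear n.+1 a));
  rewrite /= Hs.
Qed.

Let phis n (p : seq B * A) : coind B (lbar_obj n.+1) :=
  @mk_coind B (lbar_obj n.+1) _ (phis_add n p.1 p.2).

Let phis_adm n : lbar_adm n (phis n).
Proof.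
have kE k (f : coind B (lbar_obj n.+1)) (b : B) : (k *: (f : rs _) : coind B _)
  b = f (kunit k * b).
  by rewrite kunit_central.
have kF m k s a (b : B) : lbar_sym m (kunit k * b :: s) a
  = (kunit k : B) *: lbar_sym m (b :: s) a.
  exact: (multilinearZ [::] s k b (lbar_sym_multilinear m a)).
split=> [a|s k a a'].
  split=> [s Hs|s t k b b' Hst]; apply: coindP => c.
    by rewrite /= (multilinear_size (lbar_sym_multilinear n.+1 a)).
  rewrite coindD kE /= kF -!(cat_cons c).
  by apply: (lbar_sym_multilinear n.+1 a).2; rewrite /= addSn Hst.
apply: coindP => c; rewrite coindD kE /= kF.
exact: (lbar_sym_linear n.+1 (c :: s) k a a').
Qed.

Definition lbar_phi n : lbar n -> lbar n.+1 :=
  coind_eval (umod_lift (@phis_adm n)).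

Lemma lbar_phiD n : {morph @lbar_phi n : x y / x + y}.
Proof. exact: coind_evalD. Qed.

Lemma lbar_phiE n b s a : lbar_phi (b *: lbar_sym n s a)
  = lbar_sym n.+1 (b :: s) a.
Proof. by rewrite /lbar_phi coind_evalZ /= [umod_lift _ _](umod_lift_gen
  (@phis_adm n)). Qed.

Local Notation piA := (scalres pi A^o).

Lemma pi_kunit k : pi (kunit k) = kunit k.
Proof. by rewrite -[kunit k]mulr1 klinear rmorph1 mulr1. Qed.

Lemma lbar_aug_subproof : lbar_adm 0%N (fun p => (if p.1 is [::] then p.2 else
  0) : piA).
Proof.
split=> [a|[|b s] k a a'] //=; first by split=> [[]|].
  rewrite -[RHS]/(pi (kunit k) * a + a') pi_kunit; exact: erefl.
exact/esym/(etrans (addr0 _))/scaler0.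
Qed.

Definition lbar_aug : {linear lbar 0%N -> piA} := umod_lift lbar_aug_subproof.

Lemma lbar_augE b a : lbar_aug (b *: lbar_sym 0 [::] a) = pi b * a.
Proof. by rewrite linearZ; congr (_ * _); exact: (umod_lift_gen
  lbar_aug_subproof ([::], a)). Qed.

Definition lbar_phi0 (a : piA) : lbar 0 := lbar_sym 0 [::] (a : A).

Lemma lbar_phi0D : {morph lbar_phi0 : x y / x + y}.
Proof.
move=> x y; have := lbar_sym_linear 0 [::] 1 x y.
by rewrite !scale1r.
Qed.

Lemma lbar_additive_ext n (Z : zmodType) (f g : lbar_obj n -> Z) :
  {morph f : x y / x + y} -> {morph g : x y / x + y} ->
  (forall b s a, size s = n -> f (b *: lbar_sym n s a)
    = g (b *: lbar_sym n s a)) ->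
  f =1 g.
Proof.
move=> fD gD fg; apply: umod_additive_ext => // b [s a].
have [Hs|Hs] := eqVneq (size s) n; first exact: fg.
rewrite -[gen _ _]/(lbar_sym n s a) (multilinear_size (lbar_sym_multilinear n
  a)) //.
by rewrite [b *: _]scaler0 (morph_add0 fD) (morph_add0 gD).
Qed.

Lemma lbar_htpy0 x : mdif lbar 0 (lbar_phi x) = x - lbar_phi0 (lbar_aug x).
Proof.
move: x; apply: lbar_additive_ext => [x y|x y|b [|//] a _].
- by rewrite lbar_phiD linearD.
- by rewrite linearD lbar_phi0D opprD addrACA.
rewrite lbar_phiE lbar_augE lbar_difE /lbar_face hoch_diffE //.
by rewrite merge_sum_small // addr0 expr1 scaleN1r.
Qed.

Lemma lbar_htpy n (x : lbar n.+1) :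
  mdif lbar n.+1 (lbar_phi x) = x - lbar_phi (mdif lbar n x).
Proof.
move: x; apply: lbar_additive_ext => [x y|x y|b s a Hs].
- by rewrite lbar_phiD linearD.
- by rewrite linearD lbar_phiD opprD addrACA.
rewrite lbar_phiE linearZ /= !lbar_difE /lbar_face.
pose phi (f : Fun n) : Fun n.+1 := fun a => lbar_phi (b *: (f a : lbar_obj n)).
have H := @hoch_diff_contraction _ _ (Fun n) (Fun n.+1) (@lbar_actl n)
  (@lbar_actr n)
  (@lbar_actl n.+1) (@lbar_actr n.+1) (lbar_sym n) (lbar_sym n.+1) id phi b n s.
rewrite [LHS](congr1 (fun f : Fun n.+1 => f a) (H _ _ _ _ _ Hs)) //.
- move=> f g; apply: funext => x.
  have /(congr1 (@lbar_phi n)) := scalerDr b (f x : lbar_obj n) (g x).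
  by rewrite lbar_phiD.
- move=> c u; apply: funext => x; rewrite /phi /lbar_actl scalerA;
  exact: lbar_phiE.
- by move=> u; apply: funext => x; exact: lbar_phiE.
by move=> c u; apply: funext => x; exact: lbar_phiE.
Qed.

Lemma lbar_gen_phi n (x : lbar n.+1) : exists s : seq (B * lbar n),
  x = \sum_(p <- s) p.1 *: lbar_phi p.2.
Proof.
have [s ->] := umod_sum x.
exists [seq if p.2.1 is b :: u then (p.1, b *: lbar_sym n u p.2.2) else (0,
  0) | p <- s].
rewrite big_map; apply: eq_bigr => -[b [[|c u] a]] _ /=;
  last by rewrite lbar_phiE.
rewrite -[gen _ _]/(lbar_sym n.+1 [::] a).
by rewrite (multilinear_size (lbar_sym_multilinear n.+1 a)) // [b *: _]scaler0
  scale0r.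
Qed.

Hypotheses (projB : projective (kmod B)) (projA : projective (kmod A)).

(** A map out of [lbar n] is a multilinear map on B with values in Hom_K(A, -): projectivity of A
    makes this functor preserve surjections, and projectivity of B lifts the multilinear map. *)
Lemma lbar_projective n : projective (lbar n).
Proof.
move=> M N p f surj.
have p_lin : linear (p : rs M -> rs N) by move=> k x y; exact: linearP.
pose LM := homK (kmod A) (rs M); pose LN := homK (kmod A) (rs N).
have pg_lin (g : LM) : linear (fun a : kmod A => p (homK_fun g a) : rs N).
  by move=> k x y; rewrite (homK_linear g); exact: (linearP p).
pose P0 g : LN := mk_homK (pg_lin g).
have P0_lin : linear P0.
  move=> k g h; apply: homK_inj => x; rewrite homK_funE !mk_homKE homK_funE.
  exact: (linearP p).
have surjP (h : LN) : exists g, (lin_of P0_lin : {linear LM -> LN}) g = h.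
  have [g Hg gE] := linear_lift (p := lin_of p_lin : {linear rs M ->
    rs N}) projA surj
    (homK_linear h).
  by exists (mk_homK Hg); apply: homK_inj => x; rewrite mk_homKE; exact: gE.
have fs_lin s : linear (fun a : kmod A => f (lbar_sym n s a) : rs N).
  by move=> k x y; rewrite lbar_sym_linear; exact: (linearP f).
pose F0 s : LN := mk_homK (fs_lin s).
have F0_mult : multilinear n F0.
  split=> [s Hs|s t k b b' Hst]; apply: homK_inj => a.
    rewrite homK_fun0 mk_homKE (multilinear_size (lbar_sym_multilinear n a)) //.
    exact: linear0.
  rewrite homK_funE !mk_homKE (lbar_sym_multilinear n a).2 //; exact: (linearP f).
have [G Hg GE] := multilinear_lift projB surjP F0_mult.
have g_adm : lbar_adm n (fun p => homK_fun (G p.1) p.2 : M).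
  split=> [a|s]; last exact: (homK_linear (G s)).
  split=> [s Hs|s t k b b' Hst] /=; first by rewrite (multilinear_size Hg).
  by rewrite Hg.2 // homK_funE.
exists (umod_lift g_adm); apply: (umod_ext (f := p \o umod_lift _)) => -[s a] /=.
rewrite umod_lift_gen /=.
by have /(congr1 (fun h : LN => homK_fun h a)) := GE s.
Qed.

Lemma lbar_resolution : projective_resolution lbar_aug.
Proof.
apply: (@contraction_resolution _ _ _ _ lbar_phi0 lbar_phi).
- by move=> a; have := lbar_augE 1 a; rewrite scale1r rmorph1 mul1r.
- exact: lbar_phiD.
- exact: lbar_phi0D.
- exact: lbar_htpy0.
- exact: lbar_htpy.
- exact: lbar_gen_phi.
exact: lbar_projective.
Qed.
End Lbar.

(** * Base change of the bar resolution *)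

Lemma ev_additive_ext (K : comPzRingType) (A : kalgType K) (Z : zmodType)
    (f g : ev A -> Z) :
  {morph f : x y / x + y} -> {morph g : x y / x + y} ->
  (forall a b, f (tens a b) = g (tens a b)) -> f =1 g.
Proof.
move=> fD gD fg; apply: (@umod_additive_ext K Z _ (@bilin K A)) => // k [a b].
by rewrite [k *: _]tens_scale; exact: fg.
Qed.

Section QuotientMap.
Variables (R : pzRingType) (U V : lmodType R) (f : {linear U -> V}).

Local Notation full := (lin_image (idfun : {linear V -> V})).
Let in_full v : v \in full.
Proof. by apply/lin_imageP; exists v. Qed.

Definition coker : lmodType R  := Defs.subq full (lin_image f).
Definition coker_pi (v : V) : coker := subq_pi (lin_image f) (SubqCar (in_full
  v)).

Lemma coker_pi_linear : linear coker_pi.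
Proof.
move=> r x y.
have -> : r *: coker_pi x = subq_pi (lin_image f) (r *: SubqCar (in_full x)).
  exact: subq_piZ.
rewrite -subq_piD; apply/subq_piP.
by rewrite /= subrr rpred0.
Qed.
HB.instance Definition _ := GRing.isLinear.Build R V coker *:%R coker_pi
  coker_pi_linear.

Lemma coker_piP v : coker_pi v = 0 <-> exists u, v = f u.
Proof.
rewrite -(linear0 coker_pi) /coker_pi subq_piP /= subr0.
by split=> [/lin_imageP|H]; last exact/lin_imageP.
Qed.
End QuotientMap.

Section BaseChange.
Variables (K : comPzRingType) (B A : kalgType K) (pi : KAlgHom.type B A).
Implicit Types (s : seq B) (a : A) (b : B).
Local Notation evm := (ev_map pi).
Local Notation W n := (base_change pi (bar_obj B n)).
Local Notation V n := (scalext pi (lbar_obj B A n)).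

Lemma evm_tens b b' : evm (tens b b') = tens (pi b) (pi b').
Proof. exact: ev_map_tens. Qed.

Lemma base_change_counitE a a' b :
  base_change_counit pi (tens a a' *: etens evm (b : bimod B)) = a * pi b * a'.
Proof.
rewrite linearZ /=; have -> : base_change_counit pi (etens evm (b : bimod B))
  = pi b.
  exact: (scalext_liftE (base_change_counit_subproof pi) b).
exact: bimod_scale_tens.
Qed.

(** The inverse sends a to a m, where m is the class of 1. As m commutes with B, it commutes with A,
    so every element is moved into this form. *)
Lemma base_change_counit_bij : ring_epimorphism pi ->
  bijective (base_change_counit pi).
Proof.
move=> epi; pose m : base_change pi (bimod B) := etens evm (1 : bimod B).
have mE b : etens evm (b : bimod B) = tens (pi b) 1 *: m.
  rewrite -[X in tens _ X](rmorph1 pi) -evm_tens -etensZ; congr etens.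
  by rewrite [RHS]bimod_scale_tens !mulr1.
have mE' b : etens evm (b : bimod B) = tens 1 (pi b) *: m.
  rewrite -[X in tens X _](rmorph1 pi) -evm_tens -etensZ; congr etens.
  by rewrite [RHS]bimod_scale_tens !mul1r.
have mC := ring_epimorphism_central epi (fun b => etrans (esym (mE b)) (mE' b)).
exists (fun a : bimod A => tens (a : A) 1 *: m) => [x|a]; last first.
  by rewrite base_change_counitE rmorph1 !mulr1.
move: x; apply: scalext_additive_ext => [x y|//|e b].
  by rewrite linearD [tens (_ + _) _]tensDl scalerDl.
move: e; apply: ev_additive_ext => [x y|x y|a a'].
- by rewrite scalerDl linearD [tens (_ + _) _]tensDl scalerDl.
- by rewrite scalerDl.
rewrite base_change_counitE mE scalerA tensM mul1r.
have -> : tens (a * pi b) a' = tens (a * pi b) 1 * tens 1 a' by rewrite tensM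
  !mulr1.
by rewrite -scalerA -mC scalerA tensM mulr1.
Qed.

Lemma base_change_bar_ext n (Z : zmodType) (f g : W n -> Z) :
  {morph f : x y / x + y} -> {morph g : x y / x + y} ->
  (forall a a' s, size s = n -> f (tens a a' *: etens evm (bar_sym n s))
                              = g (tens a a' *: etens evm (bar_sym n s))) ->
  f =1 g.
Proof.
move=> fD gD fg; apply: scalext_umod_additive_ext => // e s; move: e.
rewrite -[gen _ _]/(bar_sym n s); set v := etens _ _.
suff: (fun e : ev A => f (e *: v)) =1 (fun e => g (e *: v)) by [].
apply: ev_additive_ext => [x y|x y|a a'].
- by rewrite scalerDl fD.
- by rewrite scalerDl gD.
rewrite /v; have [Hs|Hs] := eqVneq (size s) n; first exact: fg.
rewrite (multilinear_size (bar_sym_multilinear B n)) //.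
by rewrite etens0 scaler0 (morph_add0 fD) (morph_add0 gD).
Qed.

Definition tensl (a : A) : ev A := tens a 1.
Lemma tensl_zmod : zmod_morphism tensl.
Proof. by apply: morph_addB => a b; exact: tensDl. Qed.
Lemma tensl_monoid : monoid_morphism tensl.
Proof. by split=> // a b; rewrite /tensl tensM mulr1. Qed.
HB.instance Definition _ := GRing.isZmodMorphism.Build A (ev A) tensl tensl_zmod.
HB.instance Definition _ := GRing.isMonoidMorphism.Build A (ev A) tensl
  tensl_monoid.

Lemma kunit_ev (C : kalgType K) k : (kunit k : ev C) = tens (kunit k) 1.
Proof. by rewrite -[kunit k]mulr1 -ev_scaleE [k *: _]tens_scale mulr1. Qed.

Lemma evm_kunit k : evm (kunit k) = kunit k.
Proof. by rewrite !kunit_ev evm_tens pi_kunit rmorph1. Qed.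

Lemma tensr_lbar_adm (M : lmodType (ev A)) n (v : seq B -> M) :
  multilinear n (v : seq B -> scalres (@kunit K (ev A)) M) ->
  lbar_adm n (fun p => tens 1 p.2 *: v p.1 : scalres pi (scalres tensl M)).
Proof.
move=> Hv.
have scaleE k (x : M) : (k *: (x : scalres (@kunit K B) (scalres pi (scalres
  tensl M))))
    = (kunit k : ev A) *: x.
  by rewrite kunit_ev -(pi_kunit pi).
split=> [a|s k a a'].
  split=> [s Hs|s t k b b' Hst] /=; first by rewrite (multilinear_size Hv) //;
    exact: (@scaler0 (ev A) M).
  rewrite scaleE Hv.2 // [LHS]scalerDr; congr (_ + _).
  by rewrite [LHS]scalerA -kunit_central -scalerA.
by rewrite scaleE /= tens_linr ev_scaleE [LHS]scalerDl -scalerA.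
Qed.

Lemma coind_bar_adm (Z : lmodType A) n (v : seq B ->
  coind (ev A) Z) (u : seq B -> A -> Z) :
  (forall s a a', v s (tens a a') = a *: u s a') ->
  (forall a, multilinear n (fun s => u s a : scalres (@kunit K A) Z)) ->
  bar_adm n (v : seq B -> scalres evm (coind (ev A) Z)).
Proof.
move=> vE Hu.
have ext (f g : coind (ev A) Z) : (forall c d, f (tens c d) = g (tens c d)) ->
  f = g.
  by move=> fg; apply: coindP; apply: ev_additive_ext => //;
    exact: coind_additive.
split=> [s Hs|s t k b b' Hst]; apply: ext => c d.
  by rewrite vE (multilinear_size (Hu d)) //; exact: (@scaler0 A Z).
rewrite -[RHS]/(v (s ++ b :: t) (tens c d * evm (kunit k)) + v (s ++ b' :: t)
  (tens c d)).
rewrite evm_kunit -kunit_central -ev_scaleE [k *: _]tens_scale !vE.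
rewrite (Hu d).2 // scalerDr; congr (_ + _).
by rewrite [LHS]scalerA -kunit_central.
Qed.

Local Notation rsW n := (scalres (@kunit K (ev A)) (W n)).
Local Notation rsV n := (scalres (@kunit K A) (V n)).

Let bar_gen n s : W n := etens evm (bar_sym n s).

Let bar_gen_multilinear n : multilinear n (fun s => bar_gen n s : rsW n).
Proof.
split=> [s Hs|s t k b b' Hst]; rewrite /bar_gen.
  by rewrite (multilinear_size (bar_sym_multilinear B n)) // etens0.
rewrite (bar_sym_multilinear B n).2 // etensD; congr (_ + _).
apply: etrans (etensZ _ _ _) _.
exact: (congr1 (fun e : ev A => e *: bar_gen n (s ++ b :: t)) (evm_kunit k)).
Qed.

Let lbar_gen n s a : V n := etens pi (lbar_sym n s a).

Let lbar_gen_multilinear n a : multilinear n (fun s => lbar_gen n s a : rsV n).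
Proof.
split=> [s Hs|s t k b b' Hst]; rewrite /lbar_gen.
  by rewrite (multilinear_size (lbar_sym_multilinear B n a)) // etens0.
rewrite (lbar_sym_multilinear B n a).2 // etensD; congr (_ + _).
apply: etrans (etensZ _ _ _) _.
exact: (congr1 (fun e : A => e *: lbar_gen n (s ++ b :: t) a) (pi_kunit pi k)).
Qed.

Let lbar_gen_linear n s k a a' : lbar_gen n s (kunit k * a + a')
  = kunit k *: lbar_gen n s a + lbar_gen n s a'.
Proof.
rewrite /lbar_gen [lbar_sym _ _ _](@lbar_sym_linear _ _ _ n s k a a') etensD;
  congr (_ + _).
apply: etrans (etensZ _ _ _) _.
exact: (congr1 (fun e : A => e *: lbar_gen n s a) (pi_kunit pi k)).
Qed.

(* The isomorphism A (x)_B (B (x) B^(x)n (x) A) = A (x) B^(x)n (x) A.         *)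
Let lbar_to_FB_adm n : lbar_adm n (fun p => tens 1 p.2 *: bar_gen n p.1 :
  scalres pi (scalres tensl (W n))).
Proof. exact: tensr_lbar_adm. Qed.

Let lbar_to_FB0_linear n : phi_linear pi (umod_lift (@lbar_to_FB_adm n) :
  lbar_obj B A n -> scalres tensl (W n)).
Proof. by move=> b x y; exact: (linearP (umod_lift (@lbar_to_FB_adm n))). Qed.

Definition lbar_to_FB n : {linear V n -> scalres tensl (W n)} :=
  scalext_lift (@lbar_to_FB0_linear n).

Lemma lbar_to_FBE n a s a' : lbar_to_FB n (a *: etens pi (lbar_sym n s a'))
  = tens a a' *: etens evm (bar_sym n s) :> W n.
Proof.
rewrite linearZ.
have -> : lbar_to_FB n (etens pi (lbar_sym n s a'))
  = tens 1 a' *: bar_gen n s :> W n.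
  rewrite /lbar_to_FB scalext_liftE; exact: (umod_lift_gen (@lbar_to_FB_adm n)
    (s, a')).
by rewrite -[LHS]/(tens a 1 *: (tens 1 a' *: bar_gen n s)) scalerA tensM
  !(mulr1, mul1r).
Qed.

Lemma lbar_to_FBD n : {morph (lbar_to_FB n : V n -> W n) : x y / x + y}.
Proof. by move=> x y; exact: (linearD (lbar_to_FB n)). Qed.

Let FB_to_lbar_bil n s (p : A * A) : rsV n := p.1 *: lbar_gen n s p.2.

Let FB_to_lbar_bilin n s : bilin (@FB_to_lbar_bil n s).
Proof.
split=> k a a' b; rewrite /FB_to_lbar_bil /=; first by rewrite scalerDl -scalerA.
by rewrite lbar_gen_linear scalerDr scalerA -kunit_central -scalerA.
Qed.

Let FB_to_lbar_add n s : {morph (umod_lift (@FB_to_lbar_bilin n s) : ev A ->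
  V n) : x y / x + y}.
Proof. by move=> x y; exact: (linearD (umod_lift (@FB_to_lbar_bilin n s))). Qed.

Let FB_to_lbar_sym n s : coind (ev A) (V n) := mk_coind (@FB_to_lbar_add n s).

Let FB_to_lbar_symE n s a a' : FB_to_lbar_sym n s (tens a a')
  = a *: lbar_gen n s a'.
Proof. exact: (umod_lift_gen (@FB_to_lbar_bilin n s) (a, a')). Qed.

Let FB_to_lbar_adm n : bar_adm n (@FB_to_lbar_sym n : seq B ->
  scalres evm (coind (ev A) (V n))).
Proof. exact: coind_bar_adm (@FB_to_lbar_symE n) (@lbar_gen_multilinear n). Qed.

Let FB_to_lbar0_linear n : phi_linear evm (umod_lift (@FB_to_lbar_adm n) :
  bar_obj B n -> coind (ev A) (V n)).
Proof. by move=> e x y; exact: (linearP (umod_lift (@FB_to_lbar_adm n))). Qed.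

(** The inverse of [lbar_to_FB]. The module [V n] is given only as a left A-module, so the map out
    of [W n] is built as an additive one. *)
Definition FB_to_lbar n : W n -> V n := coind_eval (scalext_lift
  (@FB_to_lbar0_linear n)).

Lemma FB_to_lbarE n a a' s : FB_to_lbar (tens a a' *: etens evm (bar_sym n s))
  = a *: etens pi (lbar_sym n s a').
Proof.
rewrite /FB_to_lbar coind_evalZ /= [umod_lift _ _](scalext_liftE
  (@FB_to_lbar0_linear n)).
by rewrite [umod_lift _ _](umod_lift_gen (@FB_to_lbar_adm n)) FB_to_lbar_symE.
Qed.

Lemma FB_to_lbarD n : {morph @FB_to_lbar n : x y / x + y}. Proof. exact:
  coind_evalD. Qed.

Lemma lbar_to_FBK n : cancel (lbar_to_FB n : V n -> W n) (@FB_to_lbar n).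
Proof.
apply: (@scalext_umod_additive_ext _ _ pi (V n) _ (lbar_adm n)) => [x y|//|a [s
  a']].
  by rewrite lbar_to_FBD FB_to_lbarD.
by rewrite lbar_to_FBE FB_to_lbarE.
Qed.

Lemma FB_to_lbarK n : cancel (@FB_to_lbar n) (lbar_to_FB n : V n -> W n).
Proof.
apply: base_change_bar_ext => [x y|//|a a' s _];
  first by rewrite FB_to_lbarD lbar_to_FBD.
by rewrite FB_to_lbarE lbar_to_FBE.
Qed.
End BaseChange.

(** * The base-changed bar complex is a resolution of A *)

Section BaseChangeResolution.
Variables (K : comPzRingType) (B A : kalgType K) (pi : KAlgHom.type B A).
Implicit Types (s : seq B) (a : A) (b : B).
Local Notation evm := (ev_map pi).
Local Notation W n := (base_change pi (bar_obj B n)).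
Local Notation V n := (scalext pi (lbar_obj B A n)).
Local Notation lbar_to_FB := (@lbar_to_FB K B A pi).
Local Notation FB_to_lbar := (@FB_to_lbar K B A pi).
Local Notation FB := (scalext_seq evm (bar B)).
Local Notation FL := (scalext_seq pi (lbar pi)).

Lemma FB_difE n e s : mdif FB n (e *: etens evm (bar_sym n.+1 s))
  = e *: etens evm (bar_face n s).
Proof.
rewrite linearZ; congr (_ *: _); apply: etrans (scalext_mapE _ _ _) _.
by congr (etens _ _); exact: bar_difE.
Qed.

Lemma FL_difE n a s a' : mdif FL n (a *: etens pi (lbar_sym n.+1 s a'))
  = a *: etens pi (lbar_face pi n s a' : lbar_obj B A n).
Proof.
rewrite linearZ; congr (_ *: _); apply: etrans (scalext_mapE _ _ _) _.
by congr (etens _ _); exact: lbar_difE.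
Qed.

Lemma lbar_to_FB_chain n (v : V n.+1) : lbar_to_FB n (mdif FL n v)
  = mdif FB n (lbar_to_FB n.+1 v).
Proof.
move: v; apply: (@scalext_umod_additive_ext _ _ pi (W n) _ (lbar_adm n.+1)) =>
  [x y|x y|a [s a']].
- by rewrite (linearD (mdif FL n)) lbar_to_FBD.
- by rewrite lbar_to_FBD (linearD (mdif FB n)).
rewrite FL_difE lbar_to_FBE FB_difE.
pose G := kmod A -> scalres (@kunit K B) (lbar_obj B A n).
pose G' := scalres (@kunit K (ev B)) (bar_obj B n).
pose phi (f : G) : W n := lbar_to_FB n (a *: etens pi (f a' : lbar_obj B A n)).
pose phi' (y : G') : W n := tens a a' *: etens evm (y : bar_obj B n).
have phiE (f : G) : phi f = lbar_to_FB n (a *: etens pi (f a' : lbar_obj B A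
  n)) by [].
have phi'E (y : G') : phi' y = tens a a' *: etens evm (y : bar_obj B n) by [].
apply: (@hoch_diff_morph _ _ G G' (W n) _ _ _ _ (@lbar_sym _ _ _ n) (@bar_sym _
  _ n) phi phi').
- by move=> f g; rewrite !phiE -lbar_to_FBD -scalerDr -etensD.
- by move=> x y; rewrite !phi'E -scalerDr -etensD.
- move=> c u; rewrite phiE phi'E etensZ scalerA lbar_to_FBE.
  apply: esym; rewrite etensZ scalerA; congr (_ *: _).
  apply: etrans (congr1 (fun e : ev A => tens a a' * e) (evm_tens pi c 1)) _.
  by rewrite tensM rmorph1 mul1r.
- by move=> u; rewrite phiE phi'E lbar_to_FBE.
move=> c u; rewrite phiE phi'E lbar_to_FBE etensZ scalerA; congr (_ *: _).
apply: esym; apply: etrans (congr1 (fun e : ev A => tens a a' * e) (evm_tens pi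
  1 c)) _.
by rewrite tensM rmorph1 mulr1.
Qed.

Hypotheses (projB : projective (kmod B)) (projA : projective (kmod A)).
Hypothesis homepi : homological_epimorphism pi.

Definition FB_aug : {linear FB 0%N -> bimod A} :=
  base_change_counit pi \o scalext_map evm (bar_aug B).

Lemma FB_aug_etens e y : FB_aug (e *: etens evm y)
  = e *: (pi (bar_aug B y) : bimod A).
Proof.
rewrite linearZ; congr (_ *: _).
have E : scalext_map evm (bar_aug B) (etens evm y) = etens evm (bar_aug B y).
  exact: scalext_mapE.
apply: etrans (congr1 (base_change_counit pi) E) _.
exact: (scalext_liftE (base_change_counit_subproof pi)).
Qed.

Lemma FB_augE a a' : FB_aug (tens a a' *: etens evm (bar_sym 0 [::])) = a * a'.
Proof.
rewrite FB_aug_etens.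
have -> : bar_aug B (bar_sym 0 [::]) = 1.
  by have := bar_augE (1 : B) 1; rewrite scale1r mulr1.
by rewrite rmorph1 [LHS]bimod_scale_tens mulr1.
Qed.

Lemma FB_complex : is_complex FB.
Proof.
move=> n x; have cB := resolution_complex (bar_resolution projB).
move: x; apply: scalext_umod_additive_ext => [x y|x y|e s].
- by rewrite !linearD.
- by rewrite addr0.
have -> : mdif FB n.+1 (e *: etens evm (gen (bar_adm n.+2) s))
    = e *: etens evm (mdif (bar B) n.+1 (bar_sym n.+2 s)).
  by rewrite linearZ; congr (_ *: _); exact: scalext_mapE.
rewrite linearZ; apply: etrans (congr1 _ (scalext_mapE _ _ _)) _.
by rewrite [X in etens _ X]cB etens0; exact: (@scaler0 (ev A) (W n)).
Qed.

Let e0 : W 0 := etens evm (bar_sym 0 [::]).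

Lemma FB_dif1 b : mdif FB 0 (etens evm (bar_sym 1 [:: b]))
  = tens (pi b) 1 *: e0 - tens 1 (pi b) *: e0.
Proof.
have := FB_difE 0 1 [:: b]; rewrite !scale1r => ->.
have -> : bar_face 0 [:: b] = tens b 1 *: bar_sym 0 [::] - tens 1 b *: bar_sym
  0 [::].
  by rewrite /bar_face hoch_diffE // merge_sum_small // addr0 expr1 scaleN1r.
rewrite (morph_addB (@etensD _ _ _ _)) /e0; congr (_ - _).
  apply: etrans (etensZ _ _ _) _.
  exact: (congr1 (fun e : ev A => e *: e0) (etrans (evm_tens pi b 1) (congr1 _
    (rmorph1 pi)))).
apply: etrans (etensZ _ _ _) _.
exact: (congr1 (fun e : ev A => e *: e0)
  (etrans (evm_tens pi 1 b) (congr1 (fun x => tens x (pi b)) (rmorph1 pi)))).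
Qed.

(** In the cokernel of the differential the class of 1 (x) 1 commutes with B, hence with A; so the
    class of y is determined by the augmentation of y. *)
Lemma FB_exact0 (x : W 0) : FB_aug x = 0 -> exists y, x = mdif FB 0 y.
Proof.
pose q := coker_pi (mdif FB 0 : {linear W 1 -> W 0}).
have qZ e (y : W 0) : q (e *: y) = e *: q y by exact: linearZ_LR.
have qD : {morph q : y z / y + z} by exact: linearD.
have qe b : tens (pi b) 1 *: q e0 = tens 1 (pi b) *: q e0.
  have : q (tens (pi b) 1 *: e0 - tens 1 (pi b) *: e0) = 0.
    by apply/coker_piP; exists (etens evm (bar_sym 1 [:: b])); rewrite FB_dif1.
  by rewrite (morph_addB qD) !qZ => /eqP; rewrite subr_eq0 => /eqP.
have qC := ring_epimorphism_central homepi.1 qe.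
have qE (y : W 0) : q y = tens (FB_aug y : A) 1 *: q e0.
  move: y; apply: base_change_bar_ext => [y z|y z|a a' [|//] _];
    first by rewrite qD.
    by rewrite (linearD FB_aug) [tens (_ + _) _]tensDl scalerDl.
  rewrite FB_augE qZ.
  have -> : tens a a' = tens a 1 * tens 1 a' by rewrite tensM !mulr1.
  by rewrite -scalerA -qC scalerA tensM mulr1.
move=> x0; apply/coker_piP; rewrite -/q qE x0.
have -> : tens 0 1 = 0 :> ev A by apply: (morph_add0 (f :=
  fun x => tens x 1)) => y z; exact: tensDl.
by rewrite scale0r.
Qed.

Lemma FB_resolution : projective_resolution FB_aug.
Proof.
have augD x : FB_aug (mdif FB 0 x) = 0.
  move: x; apply: (@scalext_umod_additive_ext _ _ evm (bimod A) _ (bar_adm 1)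
    (fun x => FB_aug (mdif FB 0 x)) (fun=> 0)) => [x y|x y|e s].
  - by rewrite (linearD (mdif FB 0)) (linearD FB_aug).
  - by rewrite addr0.
  have -> : mdif FB 0 (e *: etens evm (gen (bar_adm 1) s))
      = e *: etens evm (mdif (bar B) 0 (bar_sym 1 s)).
    by rewrite linearZ; congr (_ *: _); exact: scalext_mapE.
  by rewrite FB_aug_etens (resolution_aug _ (bar_resolution projB)) rmorph0;
    exact: scaler0.
split=> [n|a|x|n x].
- by apply: scalext_projective; exact: bar_projective.
- by exists (tens (a : A) 1 *: e0); rewrite FB_augE mulr1.
- by split=> [/FB_exact0|[y ->]].
split=> [x0|[y ->]]; last exact: FB_complex.
(* The cycle is moved to A (x)_B [lbar], where vanishing of Tor makes it a boundary, and the
   preimage is moved back. *)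
have [|v vE] := homepi.2 _ _ (lbar_resolution pi projB projA) n (FB_to_lbar x).
  apply: (can_inj (@lbar_to_FBK _ _ _ pi n)); rewrite lbar_to_FB_chain
    FB_to_lbarK x0.
  by rewrite (morph_add0 (@lbar_to_FBD _ _ _ pi n)).
by exists (lbar_to_FB n.+2 v); rewrite -lbar_to_FB_chain -vE FB_to_lbarK.
Qed.
End BaseChangeResolution.

(** * Cochains as linear maps *)

Section HomCoboundary.
Variable R : pzRingType.

Lemma hom_coboundary_eq (P : modseq R) (N : lmodType R) k (X Y : P k -> N) :
  X =1 Y -> hom_coboundary X -> hom_coboundary Y.
Proof.
case: k X Y => [|k] X Y XY /=; first by move=> X0 x; rewrite -XY.
by move=> [h hE]; exists h => x; rewrite -XY.
Qed.

Lemma hom_coboundaryD (P : modseq R) (N : lmodType R) k (X Y : P k -> N) :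
  hom_coboundary X -> hom_coboundary Y -> hom_coboundary (fun x => X x + Y x).
Proof.
case: k X Y => [|k] X Y /=; first by move=> X0 Y0 x; rewrite X0 Y0 addr0.
by move=> [h hE] [h' hE']; exists (h \+ h') => x; rewrite hE hE'.
Qed.

Lemma hom_coboundaryN (P : modseq R) (N : lmodType R) k (X : P k -> N) :
  hom_coboundary X -> hom_coboundary (fun x => - X x).
Proof.
case: k X => [|k] X /=; first by move=> X0 x; rewrite X0 oppr0.
by move=> [h hE]; exists (\- h) => x; rewrite hE.
Qed.

Lemma hom_coboundary_comp (P Q : modseq R) (N : lmodType R)
    (a : forall n, {linear P n -> Q n}) k (X : Q k -> N) :
  chain_map a -> hom_coboundary X -> hom_coboundary (fun x => X (a k x)).
Proof.
move=> ca; case: k X => [|k] X /=; first by move=> X0 x.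
by move=> [h hE]; exists (h \o a k) => x; rewrite hE /= ca.
Qed.

Lemma shift_map_exists (P : modseq R) (M : lmodType R) (eps : {linear P 0%N ->
  M}) k
    (f : {linear P k -> M}) :
  projective_resolution eps -> (forall x, f (mdif P k x) = 0) ->
  exists u : forall i, {linear P (i + k)%N -> P i},
    shift_map u /\ forall x, eps (u 0%N x) = f x.
Proof.
move=> res fd; have [projP _ _ _] := res.
pose P' := @ModSeq R (fun i => P (i + k)%N) (fun i => mdif P (i + k)%N).
have cP : is_complex P' by move=> n x; exact: (resolution_complex res).
have [c [cc cE]] := @chain_map_exists _ P' P M eps (fun n => projP (n + k)%N)
  cP res f fd.
(* This sign turns a chain map for the differential d into one for (-1)^k d on the shifted
   complex. *)
have u_lin i : linear (fun x : P (i + k)%N => (-1) ^+ (k * i) *: c i x).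
  move=> r x y; rewrite linearP scalerDr !scalerA; congr (_ *: _ + _).
  exact/esym/commr_sign.
pose u i : {linear P (i + k)%N -> P i} := lin_of (u_lin i).
have uE i x : u i x = (-1) ^+ (k * i) *: c i x by [].
exists u; split=> [i x|x]; last by rewrite uE muln0 scale1r cE.
rewrite !uE [c i _]cc linearZ /= scalerA -exprD mulnS addnA exprD.
by rewrite -[(-1) ^+ (k + k)]signr_odd oddD addbb mul1r.
Qed.
End HomCoboundary.

Section Dictionary.
Variables (K : comPzRingType) (B A : kalgType K) (pi : KAlgHom.type B A).
Implicit Types (s : seq B).
Local Notation evm := (ev_map pi).
Local Notation FB := (scalext_seq evm (bar B)).

Lemma bimod_kunit (C : kalgType K) k (x : bimod C) : (kunit k : ev C) *: x
  = kunit k * x.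
Proof. by rewrite kunit_ev [LHS]bimod_scale_tens mulr1. Qed.

(** The K-module structure of A and the one it receives through A^ev coincide, though they are built
    differently. *)
Lemma multilinear_bimod (C : kalgType K) n (f : seq C -> bimod A) :
  multilinear n (f : seq C -> kmod A) <->
  multilinear n (f : seq C -> scalres (@kunit K (ev A)) (bimod A)).
Proof.
have kE k (x : bimod A) : k *: (x : scalres (@kunit K (ev A)) (bimod A))
  = kunit k * x.
  exact: bimod_kunit.
split=> -[f0 fP]; split=> // s t k a b Hst; apply: etrans (fP s t k a b Hst) _.
  by apply: (congr1 (fun x : A => x + f (s ++ b :: t))); exact/esym/kE.
by apply: (congr1 (fun x : A => x + f (s ++ b :: t))); exact: kE.
Qed.

(* Linear maps A (x)_B bar_n(B) (x)_B A -> A are the cochains of B with       *)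
(* values in A.                                                               *)
Definition FB_cochain n (T : {linear FB n -> bimod A}) : seq B -> kmod A :=
  fun s => T (etens evm (bar_sym n s)).

Lemma FB_cochain_multilinear n (T : {linear FB n -> bimod A}) :
  multilinear n (FB_cochain T).
Proof.
apply/multilinear_bimod; split=> [s Hs|s t k b b' Hst]; rewrite /FB_cochain.
  by rewrite (multilinear_size (bar_sym_multilinear B n)) // etens0 linear0.
rewrite (bar_sym_multilinear B n).2 // etensD linearD; congr (_ + _).
apply: etrans (congr1 T (etensZ _ _ _)) _; rewrite linearZ.
exact: (congr1 (fun e : ev A => e *: T _) (evm_kunit pi k)).
Qed.

Lemma FB_linear_exists n (N : lmodType (ev A)) (v : seq B -> N) :
  multilinear n (v : seq B -> scalres (@kunit K (ev A)) N) ->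
  exists T : {linear FB n -> N}, forall s, T (etens evm (bar_sym n s)) = v s.
Proof.
move=> Hv.
have v_adm : bar_adm n (v : seq B -> scalres evm N).
  have kE k (x : N) :
      k *: (x : scalres (@kunit K (ev B)) (scalres evm N))
        = (kunit k : ev A) *: x.
    exact: (congr1 (fun e : ev A => e *: x) (evm_kunit pi k)).
  case: Hv => v0 vP; split=> // s t k a b Hst; apply: etrans (vP s t k a b Hst) _.
  by apply: (congr1 (fun x : N => x + v (s ++ b :: t))); exact/esym/kE.
have T_lin : phi_linear evm (umod_lift v_adm : bar_obj B n -> N).
  by move=> e x y; exact: (linearP (umod_lift v_adm)).
exists (scalext_lift T_lin) => s.
by rewrite scalext_liftE; exact: (umod_lift_gen v_adm).
Qed.

Lemma FB_cochain_exists n (h : seq B -> kmod A) : multilinear n h ->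
  exists T : {linear FB n -> bimod A}, forall s, FB_cochain T s = h s.
Proof. by move=> /multilinear_bimod; exact: FB_linear_exists. Qed.

Lemma FB_cochain_dif n (T : {linear FB n -> bimod A}) s :
  T (mdif FB n (etens evm (bar_sym n.+1 s))) = rdiff pi n (FB_cochain T) s.
Proof.
have -> : mdif FB n (etens evm (bar_sym n.+1 s)) = etens evm (bar_face n s).
  by have := FB_difE pi n 1 s; rewrite !scale1r.
apply: (@hoch_diff_morph _ _ (scalres (@kunit K (ev B)) (bar_obj B n)) (kmod A)
  (kmod A)
  _ _ _ _ (@bar_sym _ _ n) (FB_cochain T) (fun x => T (etens evm (x : bar_obj B
    n))) id).
- by move=> x y; rewrite -linearD -etensD.
- by [].
- move=> c u; apply: etrans (congr1 T (etensZ _ _ _)) _; rewrite linearZ.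
  apply: etrans (congr1 (fun e : ev A => e *: T _) (evm_tens pi c 1)) _.
  by rewrite rmorph1 [LHS]bimod_scale_tens mulr1.
- by [].
move=> c u; apply: etrans (congr1 T (etensZ _ _ _)) _; rewrite linearZ.
apply: etrans (congr1 (fun e : ev A => e *: T _) (evm_tens pi 1 c)) _.
by rewrite rmorph1 [LHS]bimod_scale_tens mul1r.
Qed.

Lemma FB_cochain_ext n (T T' : {linear FB n -> bimod A}) :
  (forall s, size s = n -> FB_cochain T s = FB_cochain T' s) -> T =1 T'.
Proof.
move=> TT'; have E s : FB_cochain T s = FB_cochain T' s.
  have [Hs|Hs] := eqVneq (size s) n; first exact: TT'.
  by rewrite !(multilinear_size (FB_cochain_multilinear _)).
apply: base_change_bar_ext => [x y|x y|a a' s _]; try exact: linearD.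
by rewrite (linearZ_LR T) (linearZ_LR T') -![_ (etens _ _)]/(FB_cochain _ s) E.
Qed.

(** Under [FB_cochain], composition with the differential becomes [rdiff], so the complex of maps
    from the base-changed bar complex to A is C(B,A). *)
Lemma FB_coboundaryP n (T : {linear FB n -> bimod A}) :
  hom_coboundary T <-> rcoboundary pi n (FB_cochain T).
Proof.
case: n T => [|n] T /=.
  split=> [T0 s _|T0 x]; first exact: T0.
  have -> : (0 : bimod A) = (\0 : {linear FB 0 -> bimod A}) x by [].
  move: x; apply: FB_cochain_ext => s Hs; exact: T0.
split=> [[h hE]|[h Hh hE]].
  exists (FB_cochain h); first exact: FB_cochain_multilinear.
  by move=> s _; rewrite /FB_cochain hE; exact: FB_cochain_dif.
have [H HE] := FB_cochain_exists Hh; exists H => x.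
rewrite -[RHS]/((H \o mdif FB n) x); move: x; apply: FB_cochain_ext => s Hs.
rewrite hE // -[RHS]/(H (mdif FB n (etens evm (bar_sym n.+1 s)))) FB_cochain_dif.
by congr (rdiff _ _ _ _); apply: funext => u; rewrite HE.
Qed.

End Dictionary.

Section BarDictionary.
Variables (K : comPzRingType) (A : kalgType K).
Implicit Types (s : seq A) (f : cochain A).

Definition bar_cochain n (F : {linear bar A n -> bimod A}) : cochain A :=
  fun s => F (bar_sym n s).

Lemma bar_cochain_multilinear n (F : {linear bar A n -> bimod A}) :
  multilinear n (bar_cochain F).
Proof.
apply/multilinear_bimod; split=> [s Hs|s t k b b' Hst]; rewrite /bar_cochain.
  by rewrite (multilinear_size (bar_sym_multilinear A n)) // linear0.
by rewrite (bar_sym_multilinear A n).2 // linearD; congr (_ + _);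
  exact: linearZ_LR.
Qed.

Lemma bar_cochain_exists n f : multilinear n f ->
  exists F : {linear bar A n -> bimod A}, represents F f.
Proof.
move=> Hf; have f_adm : bar_adm n (f : seq A ->
  bimod A) by apply/multilinear_bimod.
by exists (umod_lift f_adm) => s; exact: (umod_lift_gen f_adm).
Qed.

Lemma bar_cochain_dif n (F : {linear bar A n -> bimod A}) f s : represents F f ->
  F (mdif (bar A) n (bar_sym n.+1 s)) = rdiff idfun n f s.
Proof.
move=> Ff; rewrite [mdif _ _ _]bar_difE.
apply: (@hoch_diff_morph _ _ (scalres (@kunit K (ev A)) (bar_obj A n)) (kmod A)
  (kmod A)
  _ _ _ _ (@bar_sym _ _ n) f (fun x => F (x : bar_obj A n)) id) => //.
- by move=> x y; exact: linearD.
- move=> c u; apply: etrans (linearZ_LR F _ _) _; rewrite Ff.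
  by rewrite [LHS]bimod_scale_tens mulr1.
move=> c u; apply: etrans (linearZ_LR F _ _) _; rewrite Ff.
by rewrite [LHS]bimod_scale_tens mul1r.
Qed.

Lemma bar_cochain_ext n (F G : {linear bar A n -> bimod A}) :
  (forall s, size s = n -> F (bar_sym n s) = G (bar_sym n s)) -> F =1 G.
Proof.
move=> FG; apply: umod_ext => s; have [Hs|Hs] := eqVneq (size s) n;
  first exact: FG.
rewrite -[gen _ _]/(bar_sym n s) (multilinear_size (bar_sym_multilinear A n)) //.
by rewrite !linear0.
Qed.

Lemma cocycle_linear n (F : {linear bar A n -> bimod A}) f : represents F f ->
  is_cocycle n f <-> forall x, F (mdif (bar A) n x) = 0.
Proof.
move=> Ff; split=> [[_ df] x|Fd].
  rewrite -[LHS]/((F \o mdif (bar A) n) x) -[RHS]/((\0 : {linear bar A n.+1 ->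
    bimod A}) x).
  move: x; apply: bar_cochain_ext => s _; rewrite /= (bar_cochain_dif _ Ff).
  by rewrite -hh_diffE df.
have fE : f = bar_cochain F by apply: funext => s; rewrite -Ff.
apply: is_cocycleP => [|s _]; first by rewrite fE; exact: bar_cochain_multilinear.
by rewrite -(bar_cochain_dif s Ff) Fd.
Qed.

Lemma coboundary_linear n (F : {linear bar A n -> bimod A}) f : represents F f ->
  hom_coboundary F -> is_coboundary n f.
Proof.
move=> Ff; have fE : f = bar_cochain F by apply: funext => s; rewrite -Ff.
case: n F Ff fE => [|n] F Ff fE /=.
  by move=> F0; apply: funext => s; rewrite -Ff F0.
move=> [h hE]; exists (bar_cochain h); first exact: bar_cochain_multilinear.
by apply: funext => s; rewrite -Ff hE (bar_cochain_dif (f := bar_cochain h)).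
Qed.
End BarDictionary.

Section Classes.
Variables (K : comPzRingType) (A : kalgType K).
Implicit Types (f g : cochain A).

Lemma cocyclesP n f : reflect (is_cocycle n f) (f \in @cocycles K A n).
Proof. exact: asboolP. Qed.

Lemma hh_classE n f (Hf : is_cocycle n f) :
  hh_class n f = subq_pi (@coboundaries K A n) (SubqCar (introT (cocyclesP n f)
    Hf)).
Proof.
rewrite /hh_class /subq_class; case: insubP => [u _ uE|/negP[]];
  last exact/cocyclesP.
by congr subq_pi; apply: val_inj.
Qed.

Lemma hh_classP n f g : is_cocycle n f -> is_cocycle n g ->
  hh_class n f = hh_class n g <-> is_coboundary n (f - g).
Proof.
move=> Hf Hg; rewrite (hh_classE Hf) (hh_classE Hg) subq_piP /=.
by split=> [/asboolP|H]; last exact/asboolP.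
Qed.

Lemma hh_rep_cocycle n (x : HH A n) : is_cocycle n (hh_rep x).
Proof. by rewrite /hh_rep /subq_rep; case: subq_repr => f Hf;
  exact/cocyclesP. Qed.

Lemma hh_repK n (x : HH A n) : hh_class n (hh_rep x) = x.
Proof.
rewrite (hh_classE (hh_rep_cocycle x)) -[RHS]subq_repK; congr subq_pi.
exact: val_inj.
Qed.

Lemma cocycle_lin n k f g : is_cocycle n f -> is_cocycle n g ->
  is_cocycle n (k *: f + g).
Proof.
move=> Hf Hg; apply/cocyclesP; have := @cocycles_submod K A n => -[_ H].
by apply: H; exact/cocyclesP.
Qed.

Lemma hh_class_lin n k f g : is_cocycle n f -> is_cocycle n g ->
  hh_class n (k *: f + g) = k *: hh_class n f + hh_class n g.
Proof.
move=> Hf Hg; rewrite (hh_classE Hf) (hh_classE Hg) (hh_classE (cocycle_lin k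
  Hf Hg)).
set u := SubqCar _; set v := SubqCar _; set w := SubqCar _.
have -> : k *: subq_pi (@coboundaries K A n) v
  = subq_pi (@coboundaries K A n) (k *: v).
  exact: subq_piZ.
rewrite -subq_piD; congr subq_pi; apply: val_inj; apply: esym.
exact: (linearP \val k v w).
Qed.
Lemma hh_rep_lin n k (x y : HH A n) :
  hh_class n (k *: hh_rep x + hh_rep y) = k *: x + y.
Proof. by rewrite hh_class_lin ?hh_repK //; exact: hh_rep_cocycle. Qed.
End Classes.

(** * The derived image of a class *)

Section DerivedImage.
Variables (K : comPzRingType) (B A : kalgType K) (pi : KAlgHom.type B A).
Implicit Types (f : cochain B) (g : cochain A).
Local Notation evm := (ev_map pi).
Local Notation FB := (scalext_seq evm (bar B)).

(** On cochains, composition with this explicit map c is restriction along [pi]. *)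
Lemma FB_to_bar_exists : exists c : forall n, {linear FB n -> bar A n},
  [/\ chain_map c, forall x, bar_aug A (c 0%N x) = FB_aug pi x
    & forall n (s : seq B), c n (etens evm (bar_sym n s)) = bar_sym n (map pi s)].
Proof.
have ex n : {T : {linear FB n -> bar A n} |
    forall s : seq B, T (etens evm (bar_sym n s)) = bar_sym n (map pi s)}.
  apply: cid; apply: (@FB_linear_exists _ _ _ pi n (bar_obj A n) (fun s : seq B
    => bar_sym n (map pi s))).
  exact: (multilinear_comp pi (f := id) _ (bar_sym_multilinear A n)).
exists (fun n => sval (ex n)); have cE n := svalP (ex n); split=> // [n x|x].
  move: x; apply: base_change_bar_ext => [x y|x y|a a' s _].
  - by rewrite (linearD (mdif FB n)) linearD.
  - by rewrite (linearD (sval (ex n.+1))) linearD.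
  rewrite FB_difE !linearZ_LR cE; congr (_ *: _); rewrite [RHS]bar_difE.
  rewrite /bar_face -(hoch_diff_map pi).
  apply: (@hoch_diff_morph _ _ (scalres (@kunit K (ev B)) (bar_obj B n))
    (scalres (@kunit K (ev A)) (bar_obj A n)) (bar A n) _ _ _ _ (@bar_sym _ _ n)
    (fun u : seq B => bar_sym n (map pi u))
    (fun x => sval (ex n) (etens evm (x : bar_obj B n))) (fun x => x : bar_obj
      A n)).
  - by move=> x y; rewrite -linearD -etensD.
  - by [].
  - move=> b u; apply: etrans (congr1 (sval (ex n)) (etensZ _ _ _)) _;
    rewrite linearZ_LR cE.
    exact: (congr1 (fun e : ev A => e *: _) (etrans (evm_tens pi b 1) (congr1 _
      (rmorph1 pi)))).
  - exact: cE.
  move=> b u; apply: etrans (congr1 (sval (ex n)) (etensZ _ _ _)) _;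
    rewrite linearZ_LR cE.
  exact: (congr1 (fun e : ev A => e *: _)
    (etrans (evm_tens pi 1 b) (congr1 (fun x => tens x (pi b)) (rmorph1 pi)))).
move: x; apply: base_change_bar_ext => [x y|x y|a a' [|//] _].
- by rewrite linearD (linearD (bar_aug A)).
- by rewrite linearD.
by rewrite FB_augE linearZ_LR cE bar_augE.
Qed.

Hypotheses (projB : projective (kmod B)) (projA : projective (kmod A)).
Hypothesis homepi : homological_epimorphism pi.

Let resB := bar_resolution projB.
Let resA := bar_resolution projA.
Let resFB := FB_resolution projB projA homepi.

Lemma bar_to_FB_exists : exists d : forall n, {linear bar A n -> FB n},
  chain_map d /\ forall x, FB_aug pi (d 0%N x) = bar_aug A x.
Proof.
have [projQ _ _ _] := resA.
by apply: (chain_map_exists projQ (resolution_complex resA) resFB) => x;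
  exact: resolution_aug resA.
Qed.

(* A (x)_B F (x)_B A followed by A (x)_B B (x)_B A = A *)
Definition FB_map n (F : {linear bar B n -> bimod B}) : {linear FB n ->
  bimod A} :=
  base_change_counit pi \o scalext_map evm F.

Lemma FB_mapE n (F : {linear bar B n -> bimod B}) e x :
  FB_map F (e *: etens evm x) = e *: (pi (F x) : bimod A).
Proof.
rewrite linearZ_LR; congr (_ *: _).
apply: etrans (congr1 (base_change_counit pi) (scalext_mapE evm F x)) _.
exact: (scalext_liftE (base_change_counit_subproof pi)).
Qed.

Lemma FB_map_cocycle n (F : {linear bar B n -> bimod B}) :
  (forall x, F (mdif (bar B) n x) = 0) -> forall x, FB_map F (mdif FB n x) = 0.
Proof.
move=> Fd; apply: base_change_bar_ext => [x y|x y|a a' s _].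
- by rewrite (linearD (mdif FB n)) linearD.
- by rewrite addr0.
by rewrite FB_difE FB_mapE -bar_difE [F _]Fd rmorph0;
  exact: (@scaler0 (ev A) (bimod A)).
Qed.

Lemma FB_map_comp n (u : {linear bar B n -> bar B 0}) (F : {linear bar B n ->
  bimod B}) :
  (forall x, bar_aug B (u x) = F x) ->
  forall x, FB_aug pi (scalext_map evm u x) = FB_map F x.
Proof.
move=> uF; apply: base_change_bar_ext => [x y|x y|a a' s _].
- by rewrite (linearD (scalext_map evm u)) linearD.
- by rewrite linearD.
rewrite FB_mapE linearZ_LR.
have -> : scalext_map evm u (etens evm (bar_sym n s))
  = etens evm (u (bar_sym n s)).
  exact: scalext_mapE.
by rewrite FB_aug_etens uF.
Qed.

Lemma linear_bar_map n (f : cochain B) (F : {linear bar B n ->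
  bimod B}) : represents F f ->
  forall s : seq B, FB_cochain (FB_map F) s = pi (f s).
Proof.
move=> Ff s; rewrite /FB_cochain -[X in FB_map F X]scale1r FB_mapE Ff.
exact: (@scale1r (ev A) (bimod A)).
Qed.

Lemma compatible_linear n f g (F : {linear bar B n -> bimod B})
    (G : {linear bar A n -> bimod A}) (c : forall n, {linear FB n -> bar A n}) :
  represents F f -> represents G g ->
  (forall n (s : seq B), c n (etens evm (bar_sym n s)) = bar_sym n (map pi s)) ->
  hom_coboundary (fun x => G (c n x) - FB_map F x) <-> compatible pi n f g.
Proof.
move=> Ff Gg cE.
have TE (s : seq B) : FB_cochain ((G \o c n) \- FB_map F) s
    = (-1) *: ((pi (f s) : kmod A) - g (map pi s)).
  have -> : FB_cochain ((G \o c n) \- FB_map F) s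
      = (G (c n (etens evm (bar_sym n s))) : kmod A) - FB_cochain (FB_map F) s
        by [].
  by rewrite cE Gg (linear_bar_map Ff) scaleN1r opprB.
rewrite -[X in X <-> _]/(hom_coboundary ((G \o c n) \- FB_map F)) FB_coboundaryP.
split=> [H|H].
  apply: rcoboundary_eq (rcoboundaryZ (-1) H) => s _.
  by rewrite TE scalerA mulrNN mulr1 scale1r.
by apply: rcoboundary_eq (rcoboundaryZ (-1) H) => s _; rewrite TE.
Qed.

(** The derived image compares G with (pi F) d on Bar(A), compatibility compares G c with pi F on
    the base-changed complex. Composing with c or d passes from one to the other, since d c and c d
    are homotopic to identities, whichever comparison map d is given. *)
Lemma derived_imageP n f g (F : {linear bar B n -> bimod B})
    (G : {linear bar A n -> bimod A}) :
  is_cocycle n f -> is_cocycle n g -> represents F f -> represents G g ->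
  derived_image (base_change_counit pi) (bar_aug B) (bar_aug A) F G
  <-> compatible pi n f g.
Proof.
move=> Hf Hg Ff Gg.
have Fd := (cocycle_linear Ff).1 Hf; have Gd := (cocycle_linear Gg).1 Hg.
have [c [cc ca cE]] := FB_to_bar_exists.
have [projFB _ _ _] := resFB; have [projQ _ _ _] := resA.
have Td := FB_map_cocycle Fd.
rewrite -(compatible_linear Ff Gg cE); split.
  move=> [_ _ _ [u [d [_ uF dd da H]]]].
  have H1 := hom_coboundary_comp cc H.
  have H2 : hom_coboundary (fun x => FB_map F (d n (c n x)) - FB_map F x).
    apply: (@homotopic_coboundary _ FB FB _ (FB_aug pi) projFB
      (resolution_complex resFB) resFB (fun n => d n \o c n) (fun n => idfun))
        => //.
    - by move=> m x /=; rewrite cc dd.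
    - by move=> x /=; rewrite [LHS]da ca.
  apply: hom_coboundary_eq (hom_coboundaryD H1 H2) => x /=.
  by rewrite [base_change_counit _ _](FB_map_comp uF) addrA subrK.
move=> H; split; [exact: resB|exact: resA|exact: resFB|].
have [u [us uF]] := shift_map_exists resB Fd.
have [d [dd da]] := bar_to_FB_exists.
exists u, d; split=> //.
have H1 := hom_coboundary_comp dd H.
have H2 : hom_coboundary (fun x => G (c n (d n x)) - G x).
  apply: (@homotopic_coboundary _ (bar A) (bar A) _ (bar_aug A) projQ
    (resolution_complex resA) resA (fun n => c n \o d n) (fun n => idfun)) => //.
  - by move=> m x /=; rewrite dd cc.
  - by move=> x /=; rewrite ca da.
apply: hom_coboundary_eq (hom_coboundaryD H1 (hom_coboundaryN H2)) => x.
rewrite opprB addrC addrA subrK; congr (_ - _).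
exact/esym/(FB_map_comp uF).
Qed.

(** The partner of f is the cochain of (pi F) d: its restriction (pi F) d c differs from pi F by a
    coboundary. *)
Lemma compatible_total n f : is_cocycle n f ->
  exists2 g, is_cocycle n g & compatible pi n f g.
Proof.
move=> Hf; have [F Ff] := bar_cochain_exists Hf.1.
have Fd := (cocycle_linear Ff).1 Hf; have Td := FB_map_cocycle Fd.
have [c [cc ca cE]] := FB_to_bar_exists; have [d [dd da]] := bar_to_FB_exists.
have [projFB _ _ _] := resFB.
pose G : {linear bar A n -> bimod A} := FB_map F \o d n.
have Gg : represents G (bar_cochain G) by [].
exists (bar_cochain G).
  by apply/(cocycle_linear Gg) => x; exact: etrans (congr1 (FB_map F) (dd n x))
    (Td _).
apply/(compatible_linear Ff Gg cE).
apply: (@homotopic_coboundary _ FB FB _ (FB_aug pi) projFB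
  (resolution_complex resFB) resFB (fun n => d n \o c n) (fun n => idfun)) => //.
- by move=> m x /=; rewrite cc dd.
- by move=> x /=; rewrite [LHS]da ca.
Qed.

(** If G c is a coboundary then so is G c d, which is cohomologous to G. *)
Lemma compatible_inj n g : is_cocycle n g -> compatible pi n 0 g ->
  is_coboundary n g.
Proof.
move=> Hg H; have [G Gg] := bar_cochain_exists Hg.1.
have F0 : represents (\0 : {linear bar B n -> bimod B}) 0 by [].
have Gd := (cocycle_linear Gg).1 Hg.
have [c [cc ca cE]] := FB_to_bar_exists; have [d [dd da]] := bar_to_FB_exists.
have [projQ _ _ _] := resA.
apply: (coboundary_linear Gg).
have := (compatible_linear F0 Gg cE).2 H => H1.
have T0 x : FB_map (\0 : {linear bar B n -> bimod B}) x = 0.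
  move: x; apply: base_change_bar_ext => [x y|x y|a a' s _]; first exact: linearD.
    by rewrite addr0.
  by rewrite FB_mapE rmorph0; exact: (@scaler0 (ev A) (bimod A)).
have H2 : hom_coboundary (fun x => G (c n (d n x)) - G x).
  apply: (@homotopic_coboundary _ (bar A) (bar A) _ (bar_aug A) projQ
    (resolution_complex resA) resA (fun n => c n \o d n) (fun n => idfun)) => //.
  - by move=> m x /=; rewrite dd cc.
  - by move=> x /=; rewrite ca da.
apply: hom_coboundary_eq (hom_coboundaryD (hom_coboundary_comp dd H1)
  (hom_coboundaryN H2)) => x.
by rewrite T0 subr0 opprB addrC subrK.
Qed.
End DerivedImage.

(** * The induced map on Hochschild cohomology *)

Section InducedMap.
Variables (K : comPzRingType) (B A : kalgType K) (pi : KAlgHom.type B A).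
Hypotheses (projB : projective (kmod B)) (projA : projective (kmod A)).
Hypothesis homepi : homological_epimorphism pi.

Let image n (x : HH B n) : {g | is_cocycle n g /\ compatible pi n (hh_rep x) g}.
Proof.
by apply: cid; have [g] := compatible_total projB projA homepi (hh_rep_cocycle
  x); exists g.
Qed.

Definition hh_map n (x : HH B n) : HH A n := hh_class n (sval (image x)).

(** The map can be computed from any compatible pair of cocycles: the difference of two candidates
    is compatible with 0, hence a coboundary. *)
Lemma hh_map_class n (f : cochain B) (g : cochain A) :
  is_cocycle n f -> is_cocycle n g -> compatible pi n f g ->
  hh_map (hh_class n f) = hh_class n g.
Proof.
move=> Hf Hg Hfg; rewrite /hh_map; case: (image _) => g' [Hg' Hfg'] /=.
apply/hh_classP => //; apply: (compatible_inj projB projA homepi).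
  by have := cocycle_lin (-1) Hg Hg'; rewrite scaleN1r addrC.
have : compatible pi n (hh_rep (hh_class n f)) g.
  apply: compatible_coboundary Hfg.
    by apply/(hh_classP Hf (hh_rep_cocycle _)); rewrite hh_repK.
  by apply/(hh_classP Hg Hg).
move=> /(compatible_lin (-1)) /(_ Hfg'); rewrite !scaleN1r addNr.
by rewrite addrC.
Qed.

Lemma hh_map_compatible n (x : HH B n) : compatible pi n (hh_rep x) (hh_rep
  (hh_map x)).
Proof.
rewrite /hh_map; case: (image x) => g [Hg Hfg] /=.
apply: compatible_coboundary Hfg.
  by apply/hh_classP => //; exact: hh_rep_cocycle.
by apply/(hh_classP Hg (hh_rep_cocycle _)); rewrite hh_repK.
Qed.

Lemma hh_map_linear n : linear (@hh_map n).
Proof.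
move=> k x y.
have Hx := hh_rep_cocycle x; have Hy := hh_rep_cocycle y.
have Hx' := hh_rep_cocycle (hh_map x); have Hy' := hh_rep_cocycle (hh_map y).
rewrite -(hh_rep_lin k x y) -(hh_rep_lin k (hh_map x) (hh_map y)).
apply: hh_map_class; [exact: cocycle_lin|exact: cocycle_lin|].
by apply: compatible_lin; exact: hh_map_compatible.
Qed.

Lemma hh_derived_imageP n (x : HH B n) (y : HH A n) :
  hh_derived_image pi x y <-> hh_map x = y.
Proof.
split=> [[f [g [F [G [[Hf <-] [Hg <-] Ff Gg]]]]]|<-].
  by move=> /(derived_imageP projB projA homepi Hf Hg Ff Gg); exact: hh_map_class.
have Hf := hh_rep_cocycle x; have Hg := hh_rep_cocycle (hh_map x).
have [F Ff] := bar_cochain_exists Hf.1; have [G Gg] := bar_cochain_exists Hg.1.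
exists (hh_rep x), (hh_rep (hh_map x)), F, G.
split; [by split; last exact: hh_repK|by split;
  last exact: hh_repK|exact: Ff|exact: Gg|].
by apply/(derived_imageP projB projA homepi Hf Hg Ff Gg);
  exact: hh_map_compatible.
Qed.
End InducedMap.

Theorem theorem2 (K : comPzRingType) (B A : kalgType K)
    (pi : KAlgHom.type B A)
    (projB : projective (kmod B)) (projA : projective (kmod A))
    (homepi : homological_epimorphism pi) :
  bijective (base_change_counit pi) /\
  exists pi_ : forall n : nat, {linear HH B n -> HH A n},
    [/\ forall (n : nat) (x : HH B n) (y : HH A n),
          hh_derived_image pi x y <-> pi_ n x = y,
        pi_ 0%N (hh_one B) = hh_one A,
        forall (m n : nat) (x : HH B m) (y : HH B n),
          pi_ (m + n)%N (hh_cup x y) = hh_cup (pi_ m x) (pi_ n y),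
        forall (m n : nat) (x : HH B m) (y : HH B n),
          pi_ (m + n)%N.-1 (hh_bracket x y) = hh_bracket (pi_ m x) (pi_ n y)
      & forall (n : nat) (x : HH B (2 * n)%N),
          pi_ (4 * n)%N.-1 (hh_sq x) = hh_sq (pi_ (2 * n)%N x)].
Proof.
split; first exact: base_change_counit_bij homepi.1.
pose pi_ n : {linear HH B n -> HH A n} := lin_of (@hh_map_linear _ _ _ _ projB
  projA homepi n).
have pi_E n x : pi_ n x = hh_map projB projA homepi x by [].
have piC n (x : HH B n) : compatible pi n (hh_rep x) (hh_rep (pi_ n x)).
  by rewrite pi_E; exact: hh_map_compatible.
have piH n f g : is_cocycle n f -> is_cocycle n g -> compatible pi n f g ->
    pi_ n (hh_class n f) = hh_class n g.
  by move=> Hf Hg H; rewrite pi_E; exact: hh_map_class.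
have Hrep (C : kalgType K) n (x : HH C n) := hh_rep_cocycle x.
exists pi_; split=> [n x y||m n x y|m n x y|n x].
- exact: hh_derived_imageP.
(* Operations on classes are by definition classes of operations on representatives, so each
   identity reduces to two cocycle conditions and one compatibility. *)
- by apply: piH; [exact: cocycle_one|exact: cocycle_one|case=> // _;
  rewrite rmorph1 subrr].
- by apply: piH; [exact: cocycle_cup|exact: cocycle_cup|exact: compatible_cup].
- by apply: piH; [exact: cocycle_bracket|exact: cocycle_bracket|exact:
  compatible_bracket].
have even2 : ~~ odd (2 * n) by rewrite oddM.
have -> : hh_sq (pi_ (2 * n)%N x)
    = hh_class (4 * n)%N.-1 (bullet (2 * n)%N (2 * n)%N (hh_rep (pi_ _ x))
      (hh_rep (pi_ _ x))) by [].
(* The degree of the square is stated with 4n but obtained from the bullet product with 2n + 2n. *)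
have d4 : (4 * n)%N = (2 * n + 2 * n)%N by rewrite -mulnDl.
by apply: piH; rewrite d4; [exact: cocycle_bullet_even|exact: cocycle_bullet_even
  |exact: compatible_bullet_even].
Qed.
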